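(* Suppose Assumptions 1 and 2 (stated in the context) hold and $\bar F(x)=x^{-\alpha}L(x)$ is regularly varying with $\alpha\in(1.5,2]$. Then for any $\beta\in(2,2\alpha-1)$, the choice $$p_k=\frac{\bar G^{(\beta)}_I(b+n_{k-1}\mu)-\bar G^{(\beta)}_I(b+n_k\mu)}{\bar G^{(\beta)}_I(b)},\qquad k\ge1,$$ yields a family of unbiased estimators $(Z(b)=Z_K(b)/p_K: b>0)$ of $\mathbb{P}\{\tau_b<\infty\}$ achieving 1. strong efficiency: $\displaystyle\limsup_{b\to\infty}\frac{\mathrm{Var}^Q[Z(b)]}{\mathbb{P}\{\tau_b<\infty\}^2}<\infty$, and 2. finite expected termination time: $\displaystyle\mathbb{E}^Q[\nu_b]\le\frac{r+o(1)}{\mu(\beta-2)}\,b$, as $b\nearrow\infty$.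
   Context: $X,X_1,X_2,\dots$ are i.i.d. real random variables with distribution function $F$, $\mathbb{E}X=0$, under a probability measure $\mathbb{P}$; $S_0=0$, $S_n=X_1+\dots+X_n$. Fix $\mu>0$ and an integer $r>1$. For $b>0$, $\tau_b:=\inf\{n\ge0: S_n-n\mu>b\}$. $n_0=0$, $n_k=r^k$ for $k\ge1$. Assumption 1: $\bar F(x):=\mathbb{P}\{X>x\}=x^{-\alpha}L(x)$ for some $\alpha>1$ and some slowly varying $L$ (i.e. $L(tx)/L(x)\to1$ as $x\to\infty$ for every $t>0$). Further, if $\mathrm{Var}[X]=\infty$, then $\limsup_{x\to\infty}\mathbb{P}\{X<-x\}/\mathbb{P}\{X>x\}<\infty$. Assumption 2: there is $t_0>0$ such that $L$ is continuously differentiable on $[t_0,\infty)$, and $L'(x)=o(L(x)/x)$ as $x\nearrow\infty$. For $\beta>2$: $\bar G^{(\beta)}(x):=\bar F(x)/x^{\beta-\alpha}$ and $\bar G^{(\beta)}_I(x):=\int_x^\infty\bar G^{(\beta)}(u)\,du$. Also $q_k(b):=\sum_{i=n_{k-1}+1}^{n_k}\bar F(b+i\mu)$. Events: $A_k=\bigcup_{i=n_{k-1}+1}^{n_k}\{X_i>b+i\mu\}$, $B_k=\bigcap_{i=1}^{n_k}\{X_i<b+n_{k-1}\mu\}$; bars denote complements. Measure $\mathbb{P}_{k,1}$: choose $J\in\{n_{k-1}+1,\dots,n_k\}$ with $\Pr\{J=n\}=\bar F(b+n\mu)/q_k(b)$; then generate independently $X_n$, $n\le n_k$, from $F(\cdot\mid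 X_n\ge b+n\mu)$ if $n=J$ and from $F$ otherwise. Estimator: $$Z_{k,1}(b):=\frac{q_k(b)}{\#\{n_{k-1}<i\le n_k: X_i\ge b+i\mu\}}\mathbb{I}(n_{k-1}<\tau_b\le n_k,\ A_k).$$ Measure $\mathbb{P}_{k,2}$: let $\theta_k=\theta_k(b):=\frac{-\log(n_k\bar F(b+n_{k-1}\mu))}{b+n_{k-1}\mu}$ (positive for all $k$ once $b$ is large) and $\Lambda_k(\theta):=\log\int_{-\infty}^{b+n_{k-1}\mu}e^{\theta x}F(dx)$, $\theta\ge0$. Generate $X_1,\dots,X_{\tau_b\wedge n_k}$ independently from $F_k$, where $\frac{dF_k(x)}{dF(x)}=\exp(\theta_kx-\Lambda_k(\theta_k))\mathbf 1(x<b+n_{k-1}\mu)$; the remaining increments up to index $n_k$ have law $F$ independently. Estimator: $$Z_{k,2}(b):=\exp(-\theta_kS_{\tau_b}+\tau_b\Lambda_k(\theta_k))\,\mathbb{I}(n_{k-1}<\tau_b\le n_k,\ B_k).$$ Measure $\mathbb{P}_{k,3}$: choose $J$ uniformly from $\{1,\dots,n_k\}$; generate independently $X_n$, $n\le n_k$, from $F(\cdot\mid X_n\ge b+n_{k-1}\mu)$ if $n=J$ and from $F$ otherwise. Estimator: $$Z_{k,3}(b):=\frac{n_k\bar F(b+n_{k-1}\mu)}{\#\{1\le i\le n_k: X_i\ge b+n_{k-1}\mu\}}\mathbb{I}(n_{k-1}<\tau_b\le n_k,\ \bar A_k\cap\bar B_k).$$ $Z_k(b):=Z_{k,1}(b)+Z_{k,2}(b)+Z_{k,3}(b)$,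 with the three summands generated independently under $\mathbb{P}_{k,1},\mathbb{P}_{k,2},\mathbb{P}_{k,3}$ respectively; it estimates $\mathbb{P}\{n_{k-1}<\tau_b\le n_k\}$. Overall estimator: given a probability mass function $(p_k:k\ge1)$ with all $p_k>0$ (possibly depending on $b$), draw $K$ with $\Pr\{K=k\}=p_k$; given $K=k$ generate $Z_{k,1}(b),Z_{k,2}(b),Z_{k,3}(b)$ independently under $\mathbb{P}_{k,1},\mathbb{P}_{k,2},\mathbb{P}_{k,3}$ respectively and form their sum $Z_k(b)$; set $Z(b):=Z_K(b)/p_K$. $Q$ is the probability measure induced by this procedure, with expectation $\mathbb{E}^Q$ and variance $\mathrm{Var}^Q$. $\nu_b$ denotes the largest index of the increment random variables considered for simulation in a run; since the procedure generates $X_1,\dots,X_{n_K}$ and none with larger index, $\nu_b=n_K$.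
   Formalization: Unbiasedness is asserted only for those b>0 (all large b included) with θ_k(b)≥0 for every k and F having no atom at any b+nμ; with such an atom the P{X>c} weights versus {X≥c} conditioning bias Z(b), and Λ_k is defined only for θ≥0. *)

(* Defs.v *)
From HB Require Import structures.
From mathcomp Require Import all_boot all_order all_algebra.
From mathcomp Require Import all_classical all_reals all_analysis.

Set Implicit Arguments.
Unset Strict Implicit.
Unset Printing Implicit Defensive.

Import Order.TTheory GRing.Theory Num.Theory.
Import numFieldNormedType.Exports.

Local Open Scope classical_set_scope.
Local Open Scope ring_scope.

Section sequence_of_increments.
Context d (T : measurableType d) (R : realType) (P : probability T R).

Definition mutually_independent (X : nat -> {RV P >-> R}) : Prop :=
  forall (s : seq nat) (A : nat -> set R), uniq s ->
    (forall i, measurable (A i)) ->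
    P (\bigcap_(i in [set` s]) X i @^-1` A i)
    = (\prod_(i <- s) P (X i @^-1` A i))%E.

(* [X 0] is the generic copy "X" of the increments [X 1], [X 2], ... *)
Definition iid (X : nat -> {RV P >-> R}) : Prop :=
  mutually_independent X /\
  forall i (A : set R), measurable A ->
    distribution P (X i) A = distribution P (X 0%N) A.

End sequence_of_increments.

Section regular_variation.
Context {R : realType}.

Definition slowly_varying (L : R -> R) : Prop :=
  forall t : R, 0 < t -> L (t * x) / L x @[x --> +oo] --> (1 : R).

(* Upper tail of a law [F] on the line: x |-> F(x, +oo). *)
Definition tail (F : probability R R) (x : R) : R :=
  fine (F `]x, +oo[%classic).

Definition assumption1 d (T : measurableType d) (P : probability T R)
    (X : {RV P >-> R}) (alpha : R) (L : R -> R) : Prop :=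
  [/\ 1 < alpha,
      slowly_varying L,
      forall x, 0 < x -> tail (distribution P X) x = x `^ (- alpha) * L x &
      ('V_P[X] = +oo -> limf_esup
         (fun x : R => (fine (P [set w | X w < - x]%R) /
                        fine (P [set w | X w > x]%R))%:E) +oo%R < +oo)%E].

(* As [t0] is existential, a two-sided derivative at [t0] loses nothing. *)
Definition assumption2 (L : R -> R) : Prop :=
  exists2 t0 : R, 0 < t0 &
    (forall x, t0 <= x ->
       derivable L x 1 /\ derive1 L y @[y --> x] --> derive1 L x) /\
    (forall eps, 0 < eps ->
       \forall x \near +oo, `|derive1 L x| <= eps * `|L x / x|).

End regular_variation.

(* Trajectories are sequences of increments x_1, x_2, ...; x_0 is ignored. *)
Section first_passage.
Context {R : realType}.
Implicit Types (mu b : R) (x : nat -> R).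

Definition partial_sum x (n : nat) : R := \sum_(1 <= i < n.+1) x i.

Definition tau mu b x : \bar R :=
  ereal_inf [set n%:R%:E | n in [set n : nat | b < partial_sum x n - n%:R * mu]].

(* [tau] as a natural number; only meaningful where [tau] is finite. *)
Definition tau_nat mu b x : nat := Num.truncn (fine (tau mu b x)).

Definition blk (r k : nat) : nat := if k is 0%N then 0%N else (r ^ k)%N.

Definition window mu b r k : set (nat -> R) :=
  [set x | ((blk r k.-1)%:R%:E < tau mu b x <= (blk r k)%:R%:E)%E].

Definition evA mu b r k : set (nat -> R) :=
  \bigcup_(i in [set i | (blk r k.-1 < i <= blk r k)%N])
    [set x | x i > b + i%:R * mu].

(* The barrier b + n_(k-1) mu. *)
Definition barrier mu b r k : R := b + (blk r k.-1)%:R * mu.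

Definition evB mu b r k : set (nat -> R) :=
  \bigcap_(i in [set i | (1 <= i <= blk r k)%N])
    [set x | x i < barrier mu b r k].

End first_passage.

Section estimators.
Context {R : realType} (F : probability R R).
Context (mu : R) (r : nat) (b : R).
Implicit Types (k i j : nat) (x y : nat -> R).

Local Notation n_ := (blk r).
Local Notation c_ := (barrier mu b r).

Definition q_ k : R := \sum_((n_ k.-1).+1 <= i < (n_ k).+1) tail F (b + i%:R * mu).

Definition Z1 k x : R :=
  q_ k / (count (fun i => b + i%:R * mu <= x i)
                (index_iota (n_ k.-1).+1 (n_ k).+1))%:R
  * \1_(window mu b r k `&` evA mu b r k) x.

Definition theta k : R := - ln ((n_ k)%:R * tail F (c_ k)) / c_ k.

Definition Lambda k (t : R) : R :=
  ln (\int[F]_(x in `]-oo, c_ k[) expR (t * x)).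

Definition Z2 k x : R :=
  expR (- theta k * partial_sum x (tau_nat mu b x)
        + (tau_nat mu b x)%:R * Lambda k (theta k))
  * \1_(window mu b r k `&` evB mu b r k) x.

Definition Z3 k x : R :=
  (n_ k)%:R * tail F (c_ k)
  / (count (fun i => c_ k <= x i) (index_iota 1 (n_ k).+1))%:R
  * \1_(window mu b r k `&` (~` evA mu b r k `&` ~` evB mu b r k)) x.

(* F( . | X >= c) *)
Definition cond_law (c : R) (A : set R) : \bar R :=
  (F (A `&` `[c, +oo[) * ((fine (F `[c, +oo[%classic))^-1)%:E)%E.

(* The exponentially tilted truncated law F_k. *)
Definition tilted_law k (A : set R) : \bar R :=
  (\int[F]_(x in A `&` `]-oo, c_ k[)
     (expR (theta k * x - Lambda k (theta k)))%:E)%E.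

(* F_k is only considered for theta_k >= 0. The weights of the procedure use
   F(]c, +oo[) where the conditioning and the counts use [c, +oo[, which is
   consistent only when F has no atom at the levels c = b + n mu. Both
   conditions hold for every large b, but may fail for small b. *)
Definition admissible : Prop :=
  (forall k, (1 <= k)%N -> 0 <= theta k) /\
  (forall n : nat, F [set b + n%:R * mu] = 0%E).

(* The trajectory following [x] up to its first passage time, then [y]. *)
Definition splice x y : nat -> R :=
  fun i => if (i%:R%:E <= tau mu b x)%E then x i else y i.

(* The random inputs of one run of the procedure: the index K; for the first
   estimator, the twisted position J and the increments; for the second, the
   increments used up to the passage time and those used afterwards; for the
   third, the twisted position and the increments. Only increments with
   indices 1, ..., n_K are generated, see [follows] and [nu]. *)
Record run d (T : measurableType d) (Q : probability T R) := Run {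
  run_K : {RV Q >-> nat};
  run_J1 : {RV Q >-> nat};
  run_inc1 : nat -> {RV Q >-> R};
  run_pre2 : nat -> {RV Q >-> R};
  run_post2 : nat -> {RV Q >-> R};
  run_J3 : {RV Q >-> nat};
  run_inc3 : nat -> {RV Q >-> R} }.

Section run.
Context d (T : measurableType d) (Q : probability T R) (W : run Q).
Context (p : nat -> R).

(* The joint law of the inputs, given on boxes: K has mass function p; given
   K = k, everything is independent but for the dependence of the increments
   on the twisted positions. The values of the increments with index greater
   than n_k are left unspecified, and never matter. *)
Definition follows : Prop :=
  forall k j1 j3 (A1 A2 A2' A3 : nat -> set R),
    (1 <= k)%N -> (n_ k.-1 < j1 <= n_ k)%N -> (1 <= j3 <= n_ k)%N ->
    (forall i, [/\ measurable (A1 i), measurable (A2 i),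
                   measurable (A2' i) & measurable (A3 i)]) ->
    Q [set w | [/\ run_K W w = k, run_J1 W w = j1, run_J3 W w = j3 &
         forall i, (1 <= i <= n_ k)%N ->
           [/\ A1 i (run_inc1 W i w), A2 i (run_pre2 W i w),
               A2' i (run_post2 W i w) & A3 i (run_inc3 W i w)]]]
    = ((p k)%:E
       * ((tail F (b + j1%:R * mu) / q_ k)%:E
          * \prod_(1 <= i < (n_ k).+1)
              (if i == j1 then cond_law (b + i%:R * mu) (A1 i) else F (A1 i)))
       * (\prod_(1 <= i < (n_ k).+1) tilted_law k (A2 i)
          * \prod_(1 <= i < (n_ k).+1) F (A2' i))
       * (((n_ k)%:R^-1)%:E
          * \prod_(1 <= i < (n_ k).+1)
              (if i == j3 then cond_law (c_ k) (A3 i) else F (A3 i))))%E.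

Definition Zk k (w : T) : R :=
  Z1 k (run_inc1 W ^~ w)
  + Z2 k (splice (run_pre2 W ^~ w) (run_post2 W ^~ w))
  + Z3 k (run_inc3 W ^~ w).

Definition Zrun (w : T) : R := Zk (run_K W w) w / p (run_K W w).

(* Largest index of a generated increment. *)
Definition nu (w : T) : R := (n_ (run_K W w))%:R.

End run.

Definition Gbar (alpha beta x : R) : R := tail F x / x `^ (beta - alpha).

Definition GbarI (alpha beta x : R) : R :=
  \int[lebesgue_measure]_(u in `[x, +oo[) Gbar alpha beta u.

Definition pK (alpha beta : R) k : R :=
  (GbarI alpha beta (b + (n_ k.-1)%:R * mu) - GbarI alpha beta (b + (n_ k)%:R * mu))
  / GbarI alpha beta b.

End estimators.

(* Main.v *)
(* Unbiasedness is a change of measure on each event {K = k, J1 = j1, J3 = j3}: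
   summed over the twisted positions, the densities of P_(k,1) and P_(k,3) are
   the counts by which Z_(k,1) and Z_(k,3) divide, and the three estimators
   recover the parts of {n_(k-1) < tau_b <= n_k} on A_k, on B_k and on neither.

   For strong efficiency, Z_k is at most a constant times n_k Fbar(c_k), where
   c_k = b + n_(k-1) mu: for Z_(k,1) and Z_(k,3) this is clear, and for Z_(k,2)
   it holds because S_tau >= c_k and n_k Lambda_k(theta_k) is bounded above,
   X being centered with a finite moment of order 3/2 < alpha.  By Potter's
   bounds the series of (n_k Fbar(c_k))^2 / p_k is O((b Fbar(b))^2) as soon as
   beta < 2 alpha - 1, while P(tau_b < oo) is at least of order b Fbar(b), since
   a single jump above 3b within about b steps is enough.

   The mean length is the sum of p_k n_k <= p_k (r n_(k-1) + r), which is
   compared with the mean excess over b of the law with density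
   Gbar / Gbar_I(b) on [b, oo), asymptotic to b / (beta - 2) by Karamata's
   theorem. *)

Require Import Defs.
From HB Require Import structures.
From mathcomp Require Import all_boot all_order all_algebra.
From mathcomp Require Import all_classical all_reals all_analysis.
From mathcomp Require Import measurable_realfun zify ring lra.

Set Implicit Arguments.
Unset Strict Implicit.
Unset Printing Implicit Defensive.

Import Order.TTheory GRing.Theory Num.Theory.
Import numFieldNormedType.Exports.
Import HBNNSimple.

Local Open Scope classical_set_scope.
Local Open Scope ring_scope.

(** * Transferring laws of trajectories *)

(** The law of a run is prescribed on boxes only, given K, J1 and J3, and for indices up to n_K.
    Expectations are therefore computed on each event {K = k, J1 = j1, J3 = j3}: a density checked
    on boxes extends to all nonnegative functions of n_k coordinates, because boxes are stable under
    intersection. The stopping in the second estimator does not fit boxes, so it is split along the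
    value m of the passage time, for which exactly the first m increments are tilted. With alpha <=
    2 the variance may be infinite, so the truncated moment generating function cannot be expanded
    to second order. Order 3/2 is enough: n_k is at most a constant times c_k and theta_k is at most
    of order log(c_k) / c_k, so that n_k theta_k^(3/2) stays bounded. When the variance is infinite,
    the moment of order 3/2 comes from the comparison of the two tails in the first assumption. All
    bounds on one block are functions of c_k >= b, so a threshold on b serves every k at once. The
    second moment then involves only the law of K, as Z is dominated by a deterministic function of
    K. *)

Section weighted_pushforward.
Local Open Scope ereal_scope.
Context d d' (T : measurableType d) (S : measurableType d') (R : realType).
Variables (m : {measure set T -> \bar R}) (V : T -> S) (H : T -> R).
Hypotheses (mV : measurable_fun setT V) (mH : measurable_fun setT H)
  (H0 : forall x, (0 <= H x)%R).

(** The image by [V] of the measure with density [H] with respect to [m]. The hypotheses are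
    arguments so that the measure structure can be attached to the definition. *)
Definition wpush & measurable_fun setT V & measurable_fun setT H
  & (forall x, 0 <= H x)%R : set S -> \bar R :=
  fun A => \int[m]_(x in V @^-1` A) (H x)%:E.

Let W := wpush mV mH H0.

Let W0 : W set0 = 0.
Proof. by rewrite /W /wpush preimage_set0 integral_set0. Qed.

Let W_ge0 A : 0 <= W A.
Proof. by apply: integral_ge0 => x _; rewrite lee_fin. Qed.

Let W_additive : semi_sigma_additive W.
Proof.
move=> F mF tF mUF; rewrite /W /wpush preimage_bigcup.
have mVF A : measurable A -> measurable (V @^-1` A).
  by move=> mA; rewrite -[_ @^-1` _]setTI; exact: mV.
apply: (@semi_sigma_additive_nng_induced _ _ _ m (EFin \o H) _ _
  (fun i => V @^-1` F i)) => //.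
- exact/measurable_EFinP.
- by move=> i; exact: mVF.
- apply/trivIsetP => i j _ _ ij; rewrite -preimage_setI.
  by move/trivIsetP : tF => ->//; rewrite preimage_set0.
- by rewrite -preimage_bigcup; exact: mVF.
Qed.

HB.instance Definition _ :=
  isMeasure.Build _ _ _ (wpush mV mH H0) W0 W_ge0 W_additive.

Definition wpush_measure : {measure set S -> \bar R} := wpush mV mH H0.

Lemma wpushE A : measurable A ->
  wpush_measure A = \int[m]_x ((H x)%:E * (\1_A (V x))%:E).
Proof.
move=> mA; rewrite /wpush_measure /= /wpush integral_mkcond.
apply: eq_integral => x _; rewrite patchE indicE.
have -> : (x \in V @^-1` A) = (V x \in A) by apply/idP/idP; rewrite !inE.
by case: ifPn => xA; rewrite ?mule1 ?mule0.
Qed.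

End weighted_pushforward.

Section density.
Local Open Scope ereal_scope.
Context d d' (T : measurableType d) (S : measurableType d') (R : realType).
Variables (m : {measure set T -> \bar R}) (V : T -> S) (H : T -> R).
Hypotheses (mV : measurable_fun setT V) (mH : measurable_fun setT H)
  (H0 : forall x, (0 <= H x)%R).

(** Simple functions, then monotone convergence. Only the values of [N] on measurable sets are
    assumed, so the formula applies to a multiple of a law as well as to [wpush_measure]. *)
Lemma ge0_integral_density (N : {measure set S -> \bar R}) :
  (forall A, measurable A -> N A = \int[m]_x ((H x)%:E * (\1_A (V x))%:E)) ->
  forall f : S -> \bar R, measurable_fun setT f -> (forall y, 0 <= f y) ->
  \int[N]_y f y = \int[m]_x ((H x)%:E * f (V x)).
Proof.
move=> NE f mf f0.
pose f_ := nnsfun_approx measurableT mf.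
have mHf g : measurable_fun setT g -> measurable_fun setT (fun x => (H x)%:E * g (V x)).
  move=> mg; apply: emeasurable_funM => //; first exact/measurable_EFinP.
  exact: measurableT_comp.
transitivity (\int[N]_z (lim ((f_ n z)%:E @[n --> \oo]))).
  by apply/eq_integral => z _; apply/esym/cvg_lim => //=; exact: cvg_nnsfun_approx.
rewrite monotone_convergence//; last 3 first.
  by move=> n; exact/measurable_EFinP.
  by move=> n z _; rewrite lee_fin.
  by move=> z _ a b ab; rewrite lee_fin; exact/lefP/nd_nnsfun_approx.
transitivity (\int[m]_x (lim ((H x)%:E * (f_ n (V x))%:E @[n --> \oo]))).
  rewrite monotone_convergence//; last 3 first.
  - by move=> n; apply: (mHf (EFin \o f_ n)); exact/measurable_EFinP.
  - by move=> n z _; rewrite mule_ge0// lee_fin.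
  - move=> z _ a b ab; apply: lee_wpmul2l; first by rewrite lee_fin.
    by rewrite lee_fin; exact/lefP/nd_nnsfun_approx.
  apply: congr_lim; apply/funext => n /=.
  rewrite integralT_nnsfun sintegralE.
  under [RHS]eq_integral.
    move=> y _; rewrite fimfunE -fsumEFin//.
    rewrite ge0_mule_fsumr; last first.
      by move=> r; rewrite EFinM nnfun_muleindic_ge0.
    over.
  rewrite /= ge0_integral_fsum//; last 2 first.
  - move=> r; apply: (mHf (fun y => (r * \1_(f_ n @^-1` [set r]) y)%:E)).
    by apply/measurable_EFinP; exact: measurable_funM.
  - move=> r x _; apply: mule_ge0; first by rewrite lee_fin.
    by rewrite EFinM nnfun_muleindic_ge0.
  apply: eq_fsbigr => r _.
  have [r0|r0] := leP 0%R r; last first.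
    rewrite preimage_nnfun0// measure0 mule0 integral0_eq// => x _.
    by rewrite indic0 mulr0 mule0.
  rewrite NE// -ge0_integralZl//=.
  - by apply: eq_integral => x _; rewrite EFinM muleCA.
  - apply: (mHf (fun y => (\1_(f_ n @^-1` [set r]) y)%:E)).
    by apply/measurable_EFinP.
  - by move=> x _; rewrite mule_ge0// lee_fin.
apply: eq_integral => x _; apply/cvg_lim => //.
by apply: cvgeZl => //; exact: (@cvg_nnsfun_approx _ _ _ _ measurableT f mf).
Qed.
End density.

Section sequence_space.
Context {R : realType}.

Definition box n (A : nat -> set R) : set (nat -> R) :=
  [set x | forall i, (1 <= i <= n)%N -> A i (x i)].

Definition boxes n : set (set (nat -> R)) :=
  [set box n A | A in [set A | forall i, measurable (A i)]].

(* Only the coordinates 1, ..., n are observable: the law of a run does not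
   specify the others. *)
Definition seq_space n := g_sigma_algebraType (boxes n).

Lemma boxT n : box n (fun=> setT) = setT.
Proof. by apply/seteqP; split. Qed.

Lemma boxI n (A B : nat -> set R) :
  box n A `&` box n B = box n (fun i => A i `&` B i).
Proof.
apply/seteqP; split=> x /=.
  by move=> [xA xB] i ni; split; [exact: xA|exact: xB].
by move=> xAB; split=> i /xAB[].
Qed.

Lemma boxes_setI n : setI_closed (boxes n).
Proof.
move=> _ _ [A mA <-] [B mB <-]; rewrite boxI; exists (fun i => A i `&` B i) => //.
by move=> i; exact: measurableI.
Qed.

Lemma measurable_box n (A : nat -> set R) : (forall i, measurable (A i)) ->
  measurable (box n A : set (seq_space n)).
Proof. by move=> mA; apply: sub_sigma_algebra; exists A. Qed.

Lemma measurable_coord n i : (1 <= i <= n)%N ->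
  measurable_fun setT (fun x : seq_space n => x i).
Proof.
move=> ni _ A mA; rewrite setTI.
rewrite [_ @^-1` _](_ : _ = box n (fun j => if j == i then A else setT)).
  by apply: measurable_box => j; case: ifP.
apply/seteqP; split=> x /= xA.
  by move=> j _; case: eqVneq => // ->.
by have := xA i ni; rewrite eqxx.
Qed.

Lemma measurable_seq_of d (T : measurableType d) n (V : nat -> T -> R) :
  (forall i, (1 <= i <= n)%N -> measurable_fun setT (V i)) ->
  measurable_fun setT (fun w => (V ^~ w) : seq_space n).
Proof.
move=> mV; apply: (@measurability _ _ T (seq_space n) _ _ (boxes n)) => //.
move=> _ [_ [A mA <-] <-]; rewrite setTI.
rewrite [X in measurable X](_ : _ =
    \bigcap_(i in [set i | (1 <= i <= n)%N]) (V i @^-1` A i)); last first.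
  by apply/seteqP; split.
apply: bigcap_measurableType => // i ni.
by rewrite -[_ @^-1` _]setTI; exact: mV.
Qed.

(** The two weighted image measures agree on boxes, a generating class stable under intersection.
    The finite integral of [H1] lets the whole space serve as the cover of finite mass in the
    uniqueness theorem for measures. *)
Lemma seq_space_transfer d1 d2 (T1 : measurableType d1) (T2 : measurableType d2)
    (m1 : {measure set T1 -> \bar R}) (m2 : {measure set T2 -> \bar R}) n
    (V1 : nat -> T1 -> R) (V2 : nat -> T2 -> R) (H1 : T1 -> R) (H2 : T2 -> R) :
  (forall i, (1 <= i <= n)%N -> measurable_fun setT (V1 i)) ->
  (forall i, (1 <= i <= n)%N -> measurable_fun setT (V2 i)) ->
  measurable_fun setT H1 -> measurable_fun setT H2 ->
  (forall x, 0 <= H1 x) -> (forall x, 0 <= H2 x) ->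
  (\int[m1]_x (H1 x)%:E < +oo)%E ->
  (forall A, (forall i, measurable (A i)) ->
     (\int[m1]_x ((H1 x)%:E * (\1_(box n A) (V1 ^~ x))%:E) =
      \int[m2]_x ((H2 x)%:E * (\1_(box n A) (V2 ^~ x))%:E))%E) ->
  forall f : (nat -> R) -> \bar R,
    measurable_fun setT (f : seq_space n -> \bar R) ->
    (forall x, 0 <= f x)%E ->
    (\int[m1]_x ((H1 x)%:E * f (V1 ^~ x)) =
     \int[m2]_x ((H2 x)%:E * f (V2 ^~ x)))%E.
Proof.
move=> /measurable_seq_of mV1 /measurable_seq_of mV2 mH1 mH2 H10 H20 foo E f mf f0.
pose N1 := wpush_measure m1 mV1 mH1 H10.
pose N2 := wpush_measure m2 mV2 mH2 H20.
have N12 A : measurable A -> N1 A = N2 A.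
  move=> mA; apply: (@g_sigma_algebra_measure_unique _ R (seq_space n) (boxes n)
    _ (fun=> setT)) => //.
  - by move=> B GB; exact: sub_sigma_algebra.
  - by move=> _; rewrite -(boxT n); exists (fun=> setT) => //.
  - by rewrite bigcup_const.
  - exact: boxes_setI.
  - move=> _ [B mB <-]; rewrite /N1 /N2 !wpushE ?E//; exact: measurable_box.
have <- : (\int[N1]_y f y = \int[m1]_x ((H1 x)%:E * f (V1 ^~ x)))%E.
  by apply: (ge0_integral_density mV1) => // A mA; rewrite /N1 wpushE.
apply: (ge0_integral_density mV2) => // A mA.
by rewrite N12// /N2 wpushE.
Qed.

End sequence_space.

(** * Expectations of products of functions of independent variables *)

Section independent_products.
Local Open Scope ereal_scope.
Context d (T : measurableType d) (R : realType) (P : probability T R)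
  (X : nat -> {RV P >-> R}).
Hypothesis iidX : iid X.
Let F : probability R R := distribution P (X 0%N).

Let PX i A : measurable A -> P (X i @^-1` A) = F A.
Proof. by move=> mA; exact: (iidX.2 i A mA). Qed.

(** Independence is given for events, so functions are traded for indicators one at a time, and the
    induction carries a product of indicators along. For a new index [j], weighting [P] by the other
    factors turns the law of [X j] into a multiple of [F]: on a set [B] this is the induction
    hypothesis with [j] moved to the side of the indicators. *)
Lemma iid_integral_prod_indic (h : nat -> R -> R) (s t : seq nat)
    (A : nat -> set R) :
  (forall i, measurable_fun setT (h i)) -> (forall i x, (0 <= h i x)%R) ->
  (forall i, \int[F]_x (h i x)%:E < +oo) ->
  (forall i, measurable (A i)) -> uniq (s ++ t) ->
  \int[P]_w (\prod_(i <- s) h i (X i w) * \prod_(i <- t) \1_(A i) (X i w))%:E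
  = (\prod_(i <- s) \int[F]_x (h i x)%:E) * \prod_(i <- t) F (A i).
Proof.
move=> mh h0 hoo mA; elim: s t A mA => [|j s IH] t A mA.
  move=> ut; rewrite big_nil mul1e.
  under eq_integral do rewrite big_nil mul1r.
  transitivity (P (\bigcap_(i in [set` t]) X i @^-1` A i)); last first.
    rewrite iidX.1//; apply: eq_bigr => i _; exact: PX.
  rewrite -[in RHS](setIT (\bigcap_(i in _) _)) -integral_indic//; last first.
    apply: bigcap_measurableType => i _.
    by rewrite -[_ @^-1` _]setTI; exact: measurable_funP.
  apply: eq_integral => w _; congr EFin.
  elim: t {ut} => [|i t IHt]; first by rewrite big_nil set_nil bigcap_set0 indicT.
  rewrite big_cons IHt (_ : \bigcap_(k in [set` i :: t]) X k @^-1` A k =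
    X i @^-1` A i `&` \bigcap_(k in [set` t]) X k @^-1` A k); last first.
    apply/seteqP; split=> [x xA|x [xi xt] k /=]; last first.
      by rewrite inE => /predU1P[->//|]; exact: xt.
    split; first by apply: xA; rewrite /= mem_head.
    by move=> k kt; apply: xA; rewrite /= inE kt orbT.
  rewrite indicI /=.
  rewrite !indicE; suff -> : (X i w \in A i) = (w \in X i @^-1` A i) by [].
  by apply/idP/idP; rewrite !inE.
move=> /= /andP[jst ust].
pose c := (\prod_(i <- s) \int[F]_x (h i x)%:E) * \prod_(i <- t) F (A i).
have h_ge0 i : 0 <= \int[F]_x (h i x)%:E.
  by apply: integral_ge0 => x _; rewrite lee_fin.
have cfin : c \is a fin_num.
  apply: fin_numM; apply: prode_fin_num => i _; last exact: fin_num_measure.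
  by rewrite ge0_fin_numE.
have c0 : 0 <= c.
  by apply: mule_ge0; apply: prode_ge0.
pose cN := NngNum (fine_ge0 c0).
pose H w := (\prod_(i <- s) h i (X i w) * \prod_(i <- t) \1_(A i) (X i w))%R.
have mX i : measurable_fun setT (X i) by exact: measurable_funP.
have mH : measurable_fun setT H.
  apply: measurable_funM; apply: measurable_prod => i _.
    exact: measurableT_comp.
  exact: (measurableT_comp (measurable_indic (mA i))).
have H0 w : (0 <= H w)%R by apply: mulr_ge0; apply: prodr_ge0.
transitivity (\int[P]_w ((H w)%:E * (h j (X j w))%:E)).
  by apply: eq_integral => w _; rewrite big_cons /H; congr EFin; ring.
transitivity (\int[mscale cN F]_x (h j x)%:E); last first.
  rewrite ge0_integral_mscale//; last 2 first.
  - exact/measurable_EFinP.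
  - by move=> x _; rewrite lee_fin.
  by rewrite /= fineK// big_cons /c muleC muleA.
apply/esym; apply: (ge0_integral_density (mX j)) => //; last 2 first.
- exact/measurable_EFinP.
- by move=> x; rewrite lee_fin.
move=> B mB; transitivity ((fine c)%:E * F B); first by [].
rewrite fineK//.
pose A' i := if i == j then B else A i.
have A'E i : i \in t -> A' i = A i.
  by rewrite /A'; case: eqVneq => // -> jt; move: jst; rewrite mem_cat jt orbT.
transitivity (\int[P]_w (\prod_(i <- s) h i (X i w) *
     \prod_(i <- j :: t) \1_(A' i) (X i w))%:E).
  rewrite (IH (j :: t) A').
  - rewrite big_cons {1}/A' eqxx /c -!muleA [F B * _]muleC; congr (_ * (_ * _)).
    by apply: eq_big_seq => i /A'E ->.
  - by rewrite /A' => i; case: ifP.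
  - rewrite cat_uniq /= ; move: jst ust; rewrite cat_uniq mem_cat negb_or.
    by move=> /andP[/negbTE js /negbTE jt] /and3P[-> st ->]; rewrite js jt orFb st.
apply: eq_integral => w _; rewrite -EFinM big_cons {1}/A' eqxx /H.
have -> : (\prod_(i <- t) \1_(A' i) (X i w) = \prod_(i <- t) \1_(A i) (X i w) :> R)%R.
  by apply: eq_big_seq => i it; rewrite A'E.
by congr EFin; ring.
Qed.

Lemma iid_integral_prod (h : nat -> R -> R) (s : seq nat) :
  (forall i, measurable_fun setT (h i)) -> (forall i x, (0 <= h i x)%R) ->
  (forall i, \int[F]_x (h i x)%:E < +oo) -> uniq s ->
  \int[P]_w (\prod_(i <- s) h i (X i w))%:E = \prod_(i <- s) \int[F]_x (h i x)%:E.
Proof.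
move=> mh h0 hoo us.
have := @iid_integral_prod_indic h s [::] (fun=> setT) mh h0 hoo.
rewrite cats0 big_nil mule1 => <- //.
by apply: eq_integral => w _; rewrite big_nil mulr1.
Qed.

End independent_products.

(** * First passage *)

Section first_passage_theory.
Context {R : realType}.
Implicit Types (mu b : R) (x y : nat -> R).

Definition above mu b x (m : nat) : bool := b < partial_sum x m - m%:R * mu.

(** The event that [tau] equals m, as a boolean of the coordinates 1, ..., m: measurability on
    finitely many coordinates and splitting along m become elementary. *)
Definition first_hit mu b x (m : nat) : bool :=
  above mu b x m && all (fun j => ~~ above mu b x j) (iota 0 m).

Lemma tau_first_hit mu b x m : first_hit mu b x m -> tau mu b x = m%:R%:E.
Proof.
move=> /andP[am /allP nm]; apply/eqP; rewrite eq_le; apply/andP; split.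
  by apply: ereal_inf_lbound; exists m.
apply: le_ereal_inf_tmp => _ [n an <-]; rewrite lee_fin ler_nat leqNgt.
by apply/negP => nm'; have := nm n; rewrite mem_iota add0n nm' => /(_ isT)/negP; apply.
Qed.

Lemma ex_first_hit mu b x n : above mu b x n ->
  exists2 m, (m <= n)%N & first_hit mu b x m.
Proof.
move=> an; have ex : exists n, above mu b x n by exists n.
exists (ex_minn ex); case: ex_minnP => m am mm; first exact: mm.
rewrite /first_hit am; apply/allP => j; rewrite mem_iota add0n /= => jm.
by apply/negP => /mm; rewrite leqNgt jm.
Qed.

Lemma tau_lty_ex mu b x : (tau mu b x < +oo)%E -> exists m, first_hit mu b x m.
Proof.
move=> t; have [n an] : exists n, above mu b x n.
  apply: contrapT => /forallNP na; move: t.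
  suff -> : tau mu b x = +oo%E by rewrite ltxx.
  rewrite /tau; set A := (X in ereal_inf X); suff -> : A = set0 by rewrite ereal_inf0.
  by apply/seteqP; split => // z [n /na].
by have [m _ hm] := ex_first_hit an; exists m.
Qed.

Lemma first_hit_inj mu b x m n : first_hit mu b x m -> first_hit mu b x n -> m = n.
Proof.
by move=> /tau_first_hit + /tau_first_hit => -> -[] /eqP; rewrite eqr_nat => /eqP.
Qed.

Lemma first_hit0 mu b x : 0 < b -> first_hit mu b x 0 = false.
Proof.
move=> b0; rewrite /first_hit /above /partial_sum big_geq// mul0r subr0.
by rewrite ltNge (ltW b0).
Qed.

Lemma eq_partial_sum x y m :
  (forall i, (1 <= i <= m)%N -> x i = y i) -> partial_sum x m = partial_sum y m.
Proof. by move=> xy; apply: eq_big_nat => i; rewrite ltnS; exact: xy. Qed.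

Lemma eq_first_hit mu b x y m :
  (forall i, (1 <= i <= m)%N -> x i = y i) -> first_hit mu b x m = first_hit mu b y m.
Proof.
move=> xy; rewrite /first_hit /above (eq_partial_sum xy); congr (_ && _).
apply: eq_in_all => j; rewrite mem_iota add0n => /andP[_ jm].
rewrite (@eq_partial_sum x y)// => i /andP[i0 ij]; apply: xy.
by rewrite i0 (leq_trans ij) 1?ltnW.
Qed.

Lemma tau_nat_first_hit mu b x m : first_hit mu b x m -> tau_nat mu b x = m.
Proof. by move=> /tau_first_hit; rewrite /tau_nat => -> /=; rewrite natrK. Qed.

Definition win mu b r k x : bool :=
  has (first_hit mu b x) (index_iota (blk r k.-1).+1 (blk r k).+1).

Lemma windowE mu b r k x : window mu b r k x <-> win mu b r k x.
Proof.
split.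
  rewrite /window /= => /andP[t1 t2].
  have [m hm] := @tau_lty_ex mu b x (le_lt_trans t2 (ltry _)).
  apply/hasP; exists m => //; rewrite mem_index_iota ltnS.
  by move: t1 t2; rewrite (tau_first_hit hm) lte_fin lee_fin ltr_nat ler_nat => -> ->.
move=> /hasP[m]; rewrite mem_index_iota ltnS /window /= => /andP[m1 m2] /tau_first_hit ->.
by rewrite lte_fin lee_fin ltr_nat ler_nat m1 m2.
Qed.

Definition hasA mu b r k x : bool :=
  has (fun i => b + i%:R * mu < x i) (index_iota (blk r k.-1).+1 (blk r k).+1).

Lemma evAE mu b r k x : evA mu b r k x <-> hasA mu b r k x.
Proof.
split.
  by move=> [i /= ik xi]; apply/hasP; exists i; rewrite ?mem_index_iota ?ltnS.
by move=> /hasP[i]; rewrite mem_index_iota ltnS => ik xi; exists i.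
Qed.

Definition allB mu b r k x : bool :=
  all (fun i => x i < barrier mu b r k) (index_iota 1 (blk r k).+1).

Lemma evBE mu b r k x : evB mu b r k x <-> allB mu b r k x.
Proof.
split.
  by move=> h; apply/allP => i; rewrite mem_index_iota ltnS => ik; exact: h.
by move=> /allP h i /= ik; apply: h; rewrite mem_index_iota ltnS.
Qed.

Lemma indicI_bool (A B : set (nat -> R)) (a b' : bool) x :
  (A x <-> a) -> (B x <-> b') -> \1_(A `&` B) x = (a && b')%:R :> R.
Proof.
move=> Aa Bb; rewrite indicE; congr (nat_of_bool _)%:R.
apply/idP/idP; rewrite inE; first by move=> [/Aa -> /Bb ->].
by move=> /andP[/Aa ? /Bb].
Qed.

End first_passage_theory.

(** * Measurability in finitely many coordinates *)

Section measurability.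
Context {R : realType}.
Implicit Types (mu b : R).

Lemma measurable_has d (T : measurableType d) (B : nat -> T -> bool) (s : seq nat) :
  (forall i, i \in s -> measurable_fun setT (B i)) ->
  measurable_fun setT (fun x => has (B ^~ x) s).
Proof.
elim: s => [|i s IH] mB //=.
apply: measurable_or; first by apply: mB; rewrite mem_head.
by apply: IH => j js; apply: mB; rewrite inE js orbT.
Qed.

Lemma measurable_all d (T : measurableType d) (B : nat -> T -> bool) (s : seq nat) :
  (forall i, i \in s -> measurable_fun setT (B i)) ->
  measurable_fun setT (fun x => all (B ^~ x) s).
Proof.
elim: s => [|i s IH] mB //=.
apply: measurable_and; first by apply: mB; rewrite mem_head.
by apply: IH => j js; apply: mB; rewrite inE js orbT.
Qed.

(** An arbitrary [phi] lets the induction absorb the successor, and covers division by the count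
    without any measurability of division. *)
Lemma measurable_count d d' (T : measurableType d) (S : measurableType d')
    (phi : nat -> S) (B : nat -> T -> bool) (s : seq nat) :
  (forall i, i \in s -> measurable_fun setT (B i)) ->
  measurable_fun setT (fun x => phi (count (B ^~ x) s)).
Proof.
elim: s phi => [|i s IH] phi mB //=.
rewrite (_ : (fun _ => _) = fun x => if B i x then phi (count (B ^~ x) s).+1
  else phi (count (B ^~ x) s)); last by apply/funext => x; case: (B i x).
have mB' j : j \in s -> measurable_fun setT (B j).
  by move=> js; apply: mB; rewrite inE js orbT.
apply: measurable_fun_ifT; first by apply: mB; rewrite mem_head.
  exact: (IH (phi \o succn)).
exact: IH.
Qed.

Lemma measurable_partial_sum n m : (m <= n)%N ->
  measurable_fun setT (fun x : @seq_space R n => partial_sum x m).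
Proof.
(* The rule for sums asks for measurability at every index, but coordinates beyond n are not
   measurable on [seq_space n]; the guard replaces the terms outside the range by 0. *)
move=> mn; rewrite (_ : (fun _ => _) = fun x : seq_space n =>
  \sum_(i <- index_iota 1 m.+1) (if i \in index_iota 1 m.+1 then x i else 0)); last first.
  by apply/funext => x; rewrite /partial_sum big_seq big_mkcond.
apply: (@measurable_sum _ (seq_space n) R setT nat _ (fun i (x : seq_space n) =>
  if i \in index_iota 1 m.+1 then x i else 0)) => i.
rewrite mem_index_iota ltnS; case: (1 <= i <= m)%N / boolP => [/andP[i0 im]|_]; last exact: measurable_cst.
by apply: measurable_coord; rewrite i0 (leq_trans im).
Qed.

Lemma measurable_above mu b n m : (m <= n)%N ->
  measurable_fun setT (fun x : @seq_space R n => above mu b x m).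
Proof.
move=> mn; apply: measurable_fun_ltr; first exact: measurable_cst.
by apply: measurable_funB; [exact: measurable_partial_sum|exact: measurable_cst].
Qed.

Lemma measurable_first_hit mu b n m : (m <= n)%N ->
  measurable_fun setT (fun x : @seq_space R n => first_hit mu b x m).
Proof.
move=> mn; apply: measurable_and; first exact: measurable_above.
apply: (@measurable_all _ _ (fun j (x : @seq_space R n) => ~~ above mu b x j)) => j.
rewrite mem_iota add0n => /andP[_ jm]; apply: measurable_neg.
by apply: measurable_above; rewrite (leq_trans _ mn)// ltnW.
Qed.

Lemma measurable_win mu b r k :
  measurable_fun setT (fun x : @seq_space R (blk r k) => win mu b r k x).
Proof.
apply: (@measurable_has _ _ (fun m (x : @seq_space R _) => first_hit mu b x m)) => m.
by rewrite mem_index_iota ltnS => /andP[_ mk]; exact: measurable_first_hit.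
Qed.

Lemma measurable_hasA mu b r k :
  measurable_fun setT (fun x : @seq_space R (blk r k) => hasA mu b r k x).
Proof.
apply: (@measurable_has _ _
  (fun i (x : @seq_space R (blk r k)) => b + i%:R * mu < x i)) => i.
rewrite mem_index_iota ltnS => /andP[i0 ik]; apply: measurable_fun_ltr => //.
by apply: measurable_coord; rewrite ik (leq_ltn_trans _ i0).
Qed.

Lemma measurable_allB mu b r k :
  measurable_fun setT (fun x : @seq_space R (blk r k) => allB mu b r k x).
Proof.
apply: (@measurable_all _ _
  (fun i (x : @seq_space R (blk r k)) => x i < barrier mu b r k)) => i.
rewrite mem_index_iota ltnS => ik; apply: measurable_fun_ltr => //.
exact: measurable_coord.
Qed.

Lemma measurable_count_level d (S : measurableType d) (phi : nat -> S) n
    (lo hi : nat) (c : nat -> R) : (1 <= lo)%N -> (hi <= n.+1)%N ->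
  measurable_fun setT (fun x : @seq_space R n =>
    phi (count (fun i => c i <= x i) (index_iota lo hi))).
Proof.
move=> lo1 hin.
apply: (@measurable_count _ _ _ _ _ (fun i (x : @seq_space R n) => c i <= x i)) => i.
rewrite mem_index_iota => /andP[loi ihi]; apply: measurable_fun_ler => //.
by apply: measurable_coord; rewrite (leq_trans lo1)//= -ltnS (leq_trans ihi).
Qed.

Lemma measurable_bool_real d (T : measurableType d) (B : T -> bool) :
  measurable_fun setT B -> measurable_fun setT (fun x => (B x)%:R : R).
Proof.
move=> mB; rewrite (_ : (fun _ => _) = fun x => if B x then 1 else 0 : R).
  exact: measurable_fun_ifT.
by apply/funext => x; case: (B x).
Qed.

End measurability.

Section estimators_theory.
Context {R : realType} (F : probability R R) (mu : R) (r : nat) (b : R).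
Implicit Types (k : nat) (x : nat -> R).

Lemma Z1E k x : Z1 F mu r b k x =
  q_ F mu r b k / (count (fun i => b + i%:R * mu <= x i)
     (index_iota (blk r k.-1).+1 (blk r k).+1))%:R
  * (win mu b r k x && hasA mu b r k x)%:R.
Proof. by rewrite /Z1 (indicI_bool (windowE _ _ _ _ _) (evAE _ _ _ _ _)). Qed.

(* Splitting along the value m of the passage time replaces the stopped
   weight by a function of a fixed number of coordinates. *)
Definition Z2_at k m x : R :=
  expR (- theta F mu r b k * partial_sum x m
        + m%:R * Lambda F mu r b k (theta F mu r b k))
  * (first_hit mu b x m && allB mu b r k x)%:R.

Lemma Z2E k x : Z2 F mu r b k x =
  \sum_((blk r k.-1).+1 <= m < (blk r k).+1) Z2_at k m x.
Proof.
rewrite /Z2 (indicI_bool (windowE _ _ _ _ _) (evBE _ _ _ _ _)).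
have [/hasP[m mk hm]|/hasPn nh] := boolP (win mu b r k x).
  rewrite (bigD1_seq m)// ?iota_uniq//= big1 ?addr0.
    by rewrite /Z2_at hm (tau_nat_first_hit hm).
  move=> n /negbTE nm; rewrite /Z2_at; case: (boolP (first_hit mu b x n)).
    by move=> /(first_hit_inj hm) mn; rewrite mn eqxx in nm.
  by rewrite mulr0.
rewrite andFb mulr0 big_seq big1// => m /nh /negbTE hm.
by rewrite /Z2_at hm mulr0.
Qed.

Lemma Z3E k x : Z3 F mu r b k x =
  (blk r k)%:R * tail F (barrier mu b r k)
  / (count (fun i => barrier mu b r k <= x i) (index_iota 1 (blk r k).+1))%:R
  * (win mu b r k x && (~~ hasA mu b r k x && ~~ allB mu b r k x))%:R.
Proof.
rewrite /Z3 (indicI_bool (windowE _ _ _ _ _)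
  (b' := ~~ hasA mu b r k x && ~~ allB mu b r k x))//; split.
  by move=> [A B]; apply/andP; split; apply/negP; [move/evAE|move/evBE].
by move=> /andP[/negP A /negP B]; split; [move/evAE|move/evBE].
Qed.

Lemma measurable_Z1 k :
  measurable_fun setT (Z1 F mu r b k : seq_space (blk r k) -> R).
Proof.
rewrite (funext (Z1E k)).
apply: measurable_funM.
  by apply: (measurable_count_level (fun c => q_ F mu r b k / c%:R)).
apply: measurable_bool_real; apply: measurable_and.
  exact: measurable_win.
exact: measurable_hasA.
Qed.

Lemma measurable_Z2_at k m : (m <= blk r k)%N ->
  measurable_fun setT (Z2_at k m : seq_space (blk r k) -> R).
Proof.
move=> mk; apply: measurable_funM.
  apply: measurableT_comp; first exact: measurable_expR.
  apply: measurable_funD; last exact: measurable_cst.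
  by apply: measurable_funM; [exact: measurable_cst|exact: measurable_partial_sum].
apply: measurable_bool_real; apply: measurable_and.
  exact: measurable_first_hit.
exact: measurable_allB.
Qed.

Lemma measurable_Z3 k :
  measurable_fun setT (Z3 F mu r b k : seq_space (blk r k) -> R).
Proof.
rewrite (funext (Z3E k)).
apply: measurable_funM.
  by apply: (measurable_count_level
    (fun c => (blk r k)%:R * tail F (barrier mu b r k) / c%:R)).
apply: measurable_bool_real; apply: measurable_and; first exact: measurable_win.
by apply: measurable_and; apply: measurable_neg;
  [exact: measurable_hasA|exact: measurable_allB].
Qed.

Lemma tail_ge0 (t : R) : 0 <= tail F t. Proof. exact: fine_ge0. Qed.

End estimators_theory.

Lemma indic_box {R : realType} n (A : nat -> set R) x :
  \prod_(1 <= i < n.+1) \1_(A i) (x i) = \1_(box n A) x :> R.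
Proof.
have [xA|xA] := pselect (box n A x).
  rewrite [RHS]indicE mem_set// big_seq big1// => i.
  by rewrite mem_index_iota ltnS indicE => /xA /mem_set ->.
rewrite [RHS]indicE memNset//; apply/eqP; rewrite prodf_seq_eq0.
apply: contrapT => /negP/hasPn no; apply: xA => i ni.
have := no i; rewrite mem_index_iota ltnS => /(_ ni) /=.
by rewrite indicE; case: (boolP (x i \in A i)) => [|_]; rewrite ?inE ?eqxx.
Qed.

(** * Densities read off on boxes *)

Section change_of_law.
Local Open Scope ereal_scope.
Context d (T : measurableType d) (R : realType) (P : probability T R)
  (X : nat -> {RV P >-> R}).
Hypothesis iidX : iid X.
Let F : probability R R := distribution P (X 0%N).

(** The form in which [follows] is exploited: the indicator of [D] is the weight on the side of [Q],
    and [C] times the product density is the weight on the side of the i.i.d. sequence. Agreement on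
    boxes is exactly what [follows] supplies. *)
Lemma box_change_of_law d1 (T1 : measurableType d1)
    (Q : {measure set T1 -> \bar R}) (D : set T1) n (V : nat -> T1 -> R)
    (g : nat -> R -> R) (C : R) :
  measurable D -> Q D < +oo ->
  (forall i, measurable_fun setT (V i)) ->
  (forall i, measurable_fun setT (g i)) -> (forall i x, (0 <= g i x)%R) ->
  (forall i, \int[F]_x (g i x)%:E < +oo) -> (0 <= C)%R ->
  (forall A : nat -> set R, (forall i, measurable (A i)) ->
     Q (D `&` [set w | box n A (V ^~ w)]) =
     C%:E * \prod_(1 <= i < n.+1) \int[F]_(x in A i) (g i x)%:E) ->
  forall f : (nat -> R) -> R,
    measurable_fun setT (f : seq_space n -> R) -> (forall x, (0 <= f x)%R) ->
    \int[Q]_(w in D) (f (V ^~ w))%:E =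
    C%:E * \int[P]_w ((\prod_(1 <= i < n.+1) g i (X i w)) * f (X ^~ w))%:E.
Proof.
move=> mD Doo mV mg g0 goo C0 QE f mf f0.
have mG : measurable_fun setT (fun w => \prod_(1 <= i < n.+1) g i (X i w))%R.
  by apply: measurable_prod => i _; exact: measurableT_comp.
have G0 w : (0 <= \prod_(1 <= i < n.+1) g i (X i w))%R by exact: prodr_ge0.
have mXs : measurable_fun setT (fun w => (X ^~ w : nat -> R) : seq_space n).
  by apply: (measurable_seq_of (V := fun i w => X i w)) => i _.
have mVs : measurable_fun setT (fun w => (V ^~ w) : seq_space n).
  by apply: measurable_seq_of => i _.
have mfX : measurable_fun setT (fun w => f (X ^~ w)).
  exact: (measurableT_comp mf mXs).
have indE (S : Type) (B : set S) (h : S -> \bar R) :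
  (fun w => (\1_B w)%:E * h w) = (fun w => (h \_ B) w).
  by apply/funext => w; rewrite patchE indicE; case: ifP; rewrite ?mul1e ?mul0e.
rewrite -ge0_integralZl//; last 2 first.
- by apply/measurable_EFinP; exact: measurable_funM.
- by move=> w _; rewrite lee_fin mulr_ge0.
transitivity (\int[Q]_w ((\1_D w)%:E * (EFin \o f) (V ^~ w))).
  by rewrite integral_mkcond indE.
transitivity (\int[P]_w ((C * \prod_(1 <= i < n.+1) g i (X i w))%:E *
    (EFin \o f) (X ^~ w))); last first.
  by apply: eq_integral => w _ /=; rewrite -!EFinM mulrA.
apply: (seq_space_transfer (n := n) (V2 := fun i w => X i w)) => //.
- exact: measurable_funM.
- by move=> w; rewrite mulr_ge0.
- by rewrite integral_indic// setIT.
- move=> A mA.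
  transitivity (Q (D `&` [set w | box n A (V ^~ w)])).
    rewrite -[in RHS](setIT (_ `&` _)) -integral_indic//; last first.
      apply: measurableI => //; rewrite -[[set _ | _]]setTI.
      exact: (mVs measurableT _ (measurable_box mA)).
    by apply: eq_integral => w _; rewrite indicI EFinM.
  rewrite QE//.
  pose h i x := (g i x * \1_(A i) x)%R.
  transitivity (C%:E * \int[P]_w (\prod_(1 <= i < n.+1) h i (X i w))%:E).
    rewrite (iid_integral_prod iidX (h := h)) ?iota_uniq//.
    + congr (_ * _); apply: eq_bigr => i _; rewrite integral_mkcond.
      apply: eq_integral => x _; rewrite /h patchE indicE.
      by case: ifP; rewrite ?mulr1 ?mulr0.
    + by move=> i; apply: measurable_funM.
    + by move=> i x; rewrite mulr_ge0.
    + move=> i; apply: le_lt_trans (goo i); apply: ge0_le_integral => //.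
      * by move=> x _; rewrite lee_fin mulr_ge0.
      * by apply/measurable_EFinP/measurable_funM.
      * exact/measurable_EFinP.
      * move=> x _; rewrite lee_fin ler_piMr//.
  rewrite -ge0_integralZl//; last 2 first.
  + apply/measurable_EFinP/measurable_prod => i _.
    by apply: measurableT_comp => //; apply: measurable_funM.
  + by move=> w _; rewrite lee_fin prodr_ge0// => i _; rewrite mulr_ge0.
  apply: eq_integral => w _; rewrite -!EFinM /h big_split/= mulrA; congr (_ * _)%:E.
  exact: indic_box.
- exact/measurable_EFinP.
Qed.
End change_of_law.

(** * Unbiasedness *)

Section one_run.
Context {R : realType} (F : probability R R) (mu : R) (r : nat) (b : R).
Hypotheses (mu0 : 0 < mu) (b0 : 0 < b) (r1 : (1 < r)%N).
Hypothesis adm : admissible F mu r b.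
Hypothesis tail_gt0 : forall x, 0 < x -> 0 < tail F x.
Hypothesis Fneg : forall c : R, 0 < c -> F `]-oo, c[%classic != 0%E.

Local Notation n_ := (blk r).
Local Notation c_ := (barrier mu b r).

Lemma blk_gt0 k : (1 <= k)%N -> (0 < n_ k)%N.
Proof. by case: k => // k _; rewrite /= expn_gt0 ltnW. Qed.

Lemma level_gt0 n : 0 < b + n%:R * mu.
Proof. by rewrite ltr_pwDl// mulr_ge0// ltW. Qed.

(** Here the absence of atoms at the levels b + n mu enters: it reconciles conditioning and counting
    on closed half-lines with weights that use open ones. *)
Lemma tail_closed n : F `[b + n%:R * mu, +oo[%classic = (tail F (b + n%:R * mu))%:E.
Proof.
rewrite /tail fineK ?fin_num_measure// -(@setU1itv _ _ _ _ false)//= measureU//=; last first.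
  by apply/seteqP; split => // x [] /= -> ; rewrite in_itv/= ltxx.
by rewrite adm.2 add0e.
Qed.

Definition cond_density (c x : R) : R := (c <= x)%R%:R / tail F c.

Lemma cond_density_ge0 c x : 0 <= cond_density c x.
Proof. by rewrite divr_ge0// tail_ge0. Qed.

Lemma measurable_cond_density c : measurable_fun setT (cond_density c).
Proof.
apply: measurable_funM => //; apply: measurable_bool_real.
exact: measurable_fun_ler.
Qed.

Lemma cond_lawE n (A : set R) : measurable A ->
  cond_law F (b + n%:R * mu) A =
  (\int[F]_(x in A) (cond_density (b + n%:R * mu) x)%:E)%E.
Proof.
move=> mA; rewrite /cond_law tail_closed /=.
set c := b + _.
rewrite (eq_integral (fun x => ((tail F c)^-1)%:E * (\1_(`[c, +oo[%classic) x)%:E)%E).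
  rewrite ge0_integralZl//=; last 2 first.
  - by apply/measurable_EFinP; exact: measurable_indic.
  - by rewrite lee_fin invr_ge0 tail_ge0.
  by rewrite integral_indic// muleC setIC.
move=> x _; rewrite -EFinM /cond_density mulrC indicE; congr ((_ * (nat_of_bool _)%:R)%:E).
by apply/idP/idP; rewrite inE /= in_itv/= andbT.
Qed.

Lemma cond_lawT n : cond_law F (b + n%:R * mu) setT = 1%E.
Proof.
rewrite /cond_law setTI tail_closed /= -EFinM divff//.
by rewrite gt_eqF// tail_gt0// level_gt0.
Qed.

Definition tilt_density k (x : R) : R :=
  expR (theta F mu r b k * x - Lambda F mu r b k (theta F mu r b k))
  * (x < c_ k)%R%:R.

Lemma tilt_density_ge0 k x : 0 <= tilt_density k x.
Proof. by rewrite mulr_ge0 ?expR_ge0. Qed.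

Lemma measurable_affine_exp (s t : R) : measurable_fun setT (fun x => expR (s * x - t)).
Proof.
apply: measurableT_comp; first exact: measurable_expR.
by apply: measurable_funB => //; apply: measurable_funM.
Qed.

Lemma measurable_exp_lin (s : R) : measurable_fun setT (fun x => expR (s * x)).
Proof.
apply: measurableT_comp; first exact: measurable_expR.
exact: measurable_funM.
Qed.

Lemma measurable_tilt_density k : measurable_fun setT (tilt_density k).
Proof.
apply: measurable_funM; first exact: measurable_affine_exp.
by apply: measurable_bool_real; exact: measurable_fun_ltr.
Qed.

Lemma tilted_lawE k (A : set R) : measurable A ->
  tilted_law F mu r b k A = (\int[F]_(x in A) (tilt_density k x)%:E)%E.
Proof.
move=> mA; rewrite /tilted_law integral_mkcondr; apply: eq_integral => x _.
rewrite patchE /tilt_density.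
have -> : (x \in `]-oo, c_ k[%classic) = (x < c_ k).
  by apply/idP/idP; rewrite inE /= in_itv.
by case: ltP; rewrite ?mulr1 ?mulr0.
Qed.

Lemma truncated_mgf_lty (c t : R) : 0 <= t ->
  (\int[F]_(x in `]-oo, c[) (expR (t * x))%:E < +oo)%E.
Proof.
move=> t0; apply: (@le_lt_trans _ _ (\int[F]_(x in `]-oo, c[) (expR (t * c))%:E)%E).
  apply: ge0_le_integral => //.
  - apply/measurable_EFinP; apply: measurable_funTS.
    exact: measurable_exp_lin.
  - move=> x /=; rewrite in_itv/= => xc; rewrite lee_fin ler_expR.
    by rewrite ler_wpM2l// ltW.
rewrite integral_cst//= lte_mul_pinfty ?lee_fin ?expR_ge0//.
by rewrite -ge0_fin_numE// fin_num_measure.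
Qed.

(** [Lambda] is the logarithm of this integral, so positivity is what makes the tilted law have mass
    one. The integrand is positive: a zero integral would make the half-line null, against
    [Fneg]. *)
Lemma truncated_mgf_gt0 (c t : R) : 0 < c -> 0 <= t ->
  0 < \int[F]_(x in `]-oo, c[) expR (t * x).
Proof.
move=> c0 t0; rewrite lt_neqAle Rintegral_ge0 ?andbT; last first.
  by move=> x _; exact: expR_ge0.
apply/eqP => /esym int0.
have : (\int[F]_(x in `]-oo, c[) `|(expR (t * x))%:E| = 0)%E.
  under eq_integral do rewrite gee0_abs ?lee_fin ?expR_ge0//.
  move: int0; rewrite /Rintegral => int0.
  rewrite -[LHS]fineK ?int0// ge0_fin_numE ?truncated_mgf_lty//.
  by apply: integral_ge0 => x _; rewrite lee_fin expR_ge0.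
have mf : measurable_fun `]-oo, c[%classic (fun x => (expR (t * x))%:E).
  apply/measurable_EFinP; apply: measurable_funTS.
  exact: measurable_exp_lin.
move/(ae_eq_integral_abs F (measurable_itv _) mf) => [N [mN N0 sN]].
have /eqP := Fneg c0; apply.
apply/eqP; rewrite -measure_le0 -N0; apply: le_measure; rewrite ?inE//.
move=> x xc; apply: sN => /= /(_ xc) [] /eqP.
by rewrite gt_eqF ?expR_gt0.
Qed.

Lemma tilted_lawT k : (1 <= k)%N -> tilted_law F mu r b k setT = 1%E.
Proof.
move=> k1; have t0 := adm.1 k k1.
have M0 := truncated_mgf_gt0 (level_gt0 _) t0.
rewrite /tilted_law setTI.
under eq_integral do rewrite expRD mulrC EFinM.
rewrite ge0_integralZl//; last first.
  by apply/measurable_EFinP; apply: measurable_funTS; exact: measurable_exp_lin.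
rewrite expRN /Lambda lnK; last by rewrite posrE; exact: M0.
rewrite -[X in (_ * X)%E]fineK; last first.
  rewrite ge0_fin_numE ?truncated_mgf_lty//.
  by apply: integral_ge0 => x _; rewrite lee_fin expR_ge0.
by rewrite -EFinM mulVf// gt_eqF//; exact: M0.
Qed.

End one_run.

(** * Integration over the runs of the procedure *)

Section runs.
Context d (T : measurableType d) {R : realType} (P : probability T R)
  (X : nat -> {RV P >-> R}) (mu : R) (r : nat) (b : R).
Hypothesis iidX : iid X.
Let F : probability R R := distribution P (X 0%N).
Hypotheses (mu0 : 0 < mu) (b0 : 0 < b) (r1 : (1 < r)%N).
Hypothesis adm : admissible F mu r b.
Hypothesis tail_gt0 : forall x, 0 < x -> 0 < tail F x.
Hypothesis Fneg : forall c : R, 0 < c -> F `]-oo, c[%classic != 0%E.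
Context d' (T' : measurableType d') (Q : probability T' R) (W : run Q)
  (p : nat -> R).
Hypothesis p_gt0 : forall k, (1 <= k)%N -> 0 < p k.
Hypothesis psum : (\sum_(1 <= k <oo) (p k)%:E = 1)%E.
Hypothesis Hfol : follows F mu r b W p.

Local Notation n_ := (blk r).
Local Notation c_ := (barrier mu b r).
Local Notation q := (q_ F mu r b).

Definition cell k j1 j3 : set T' :=
  [set w | [/\ run_K W w = k, run_J1 W w = j1 & run_J3 W w = j3]].

Lemma measurable_cell k j1 j3 : measurable (cell k j1 j3).
Proof.
have mN (Y : {RV Q >-> nat}) j : measurable (Y @^-1` [set j]).
  by rewrite -[_ @^-1` _]setTI; exact: measurable_funP.
rewrite (_ : cell _ _ _ = run_K W @^-1` [set k] `&` run_J1 W @^-1` [set j1]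
  `&` run_J3 W @^-1` [set j3]).
  by apply: measurableI => //; apply: measurableI.
by apply/seteqP; split=> w /=; [move=> []|move=> [[]]].
Qed.

(** The [Q]-mass of [cell k j1 j3], the same for all [j3] because the third position is uniform. *)
Definition weight k j1 : R := p k * (tail F (b + j1%:R * mu) / q k) / (n_ k)%:R.

Lemma q_gt0 k j1 : (n_ k.-1 < j1 <= n_ k)%N -> 0 < q k.
Proof.
move=> /andP[j1l j1u]; rewrite /q_ big_ltn ?ltnS ?(leq_trans j1l)//.
rewrite ltr_pwDl ?tail_gt0 ?level_gt0// sumr_ge0// => i _; exact: tail_ge0.
Qed.

Lemma weight_ge0 k j1 : (1 <= k)%N -> (n_ k.-1 < j1 <= n_ k)%N -> 0 <= weight k j1.
Proof.
move=> k1 jk; rewrite /weight divr_ge0// mulr_ge0 ?divr_ge0 ?tail_ge0//.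
  by rewrite ltW// p_gt0.
by rewrite ltW// (q_gt0 jk).
Qed.

Lemma prod1E (I : Type) (s : seq I) (f : I -> \bar R) :
  (forall i, f i = 1%E) -> (\prod_(i <- s) f i = 1)%E.
Proof. by move=> f1; rewrite big1. Qed.

Lemma Z1_ge0 k x : 0 <= Z1 F mu r b k x.
Proof.
rewrite Z1E mulr_ge0// divr_ge0// /q_ sumr_ge0// => i _; exact: tail_ge0.
Qed.

Lemma Z2_at_ge0 k m x : 0 <= Z2_at F mu r b k m x.
Proof. by rewrite /Z2_at mulr_ge0 ?expR_ge0. Qed.

Lemma Z2_ge0 k x : 0 <= Z2 F mu r b k x.
Proof. by rewrite Z2E sumr_ge0// => m _; exact: Z2_at_ge0. Qed.

Lemma Z3_ge0 k x : 0 <= Z3 F mu r b k x.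
Proof. by rewrite Z3E mulr_ge0// divr_ge0// mulr_ge0// tail_ge0. Qed.

Section one_cell.
Variables k j1 j3 : nat.
Hypotheses (k1 : (1 <= k)%N) (j1k : (n_ k.-1 < j1 <= n_ k)%N)
  (j3k : (1 <= j3 <= n_ k)%N).

Let prod_condT (c : nat -> nat) (s : seq nat) j :
  (\prod_(i <- s) (if i == j then cond_law F (b + (c i)%:R * mu) setT
                  else F setT) = 1)%E.
Proof.
apply: prod1E => i; case: eqP => _; last exact: probability_setT.
exact: (cond_lawT mu0 b0 adm tail_gt0).
Qed.

Let prod_tiltedT (s : seq nat) : (\prod_(i <- s) tilted_law F mu r b k setT = 1)%E.
Proof. by apply: prod1E => _; exact: (tilted_lawT mu0 b0 adm Fneg). Qed.

Let prod_FT (s : seq nat) : (\prod_(i <- s) F setT = 1)%E.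
Proof. by apply: prod1E => _; exact: probability_setT. Qed.

Lemma cell_boxes (A1 A2 A2' A3 : nat -> set R) :
  (forall i, measurable (A1 i)) -> (forall i, measurable (A2 i)) ->
  (forall i, measurable (A2' i)) -> (forall i, measurable (A3 i)) ->
  Q (cell k j1 j3 `&` [set w | [/\ box (n_ k) A1 (run_inc1 W ^~ w),
       box (n_ k) A2 (run_pre2 W ^~ w), box (n_ k) A2' (run_post2 W ^~ w)
       & box (n_ k) A3 (run_inc3 W ^~ w)]]) =
  ((weight k j1)%:E *
   ((\prod_(1 <= i < (n_ k).+1)
       (if i == j1 then cond_law F (b + i%:R * mu) (A1 i) else F (A1 i)))
    * (\prod_(1 <= i < (n_ k).+1) tilted_law F mu r b k (A2 i)
          * \prod_(1 <= i < (n_ k).+1) F (A2' i))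
    * (\prod_(1 <= i < (n_ k).+1)
       (if i == j3 then cond_law F (c_ k) (A3 i) else F (A3 i)))))%E.
Proof.
move=> m1 m2 m2' m3.
rewrite (_ : _ `&` _ = [set w | [/\ run_K W w = k, run_J1 W w = j1, run_J3 W w = j3 &
         forall i, (1 <= i <= n_ k)%N ->
           [/\ A1 i (run_inc1 W i w), A2 i (run_pre2 W i w),
               A2' i (run_post2 W i w) & A3 i (run_inc3 W i w)]]]); last first.
  apply/seteqP; split=> w /=.
    move=> [[? ? ?] [h1 h2 h2' h3]]; split => // i ni.
    by split; [exact: h1|exact: h2|exact: h2'|exact: h3].
  move=> [? ? ? h]; split; first by split.
  by split=> i /h[].
rewrite Hfol//.
have ac (x a y1 y2 z y3 : \bar R) :
    (x * (a * y1) * y2 * (z * y3) = x * a * z * (y1 * y2 * y3))%E.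
  by rewrite !muleA (muleAC _ y2 z) (muleAC _ y1 z).
by rewrite ac /weight !EFinM.
Qed.

Lemma cell_measure : Q (cell k j1 j3) = (weight k j1)%:E.
Proof.
have := @cell_boxes (fun=> setT) (fun=> setT) (fun=> setT) (fun=> setT).
rewrite (prod_condT id) (prod_condT (fun=> n_ k.-1)) prod_tiltedT prod_FT !mule1.
move=> <- //; congr (Q _); apply/seteqP; split => w /=; last by case.
by move=> h; split => //; split.
Qed.

Let weight0 : 0 <= weight k j1. Proof. exact: weight_ge0. Qed.

Let mX i : measurable_fun setT (X i).
Proof. exact: measurable_funP. Qed.

Let mXs n : measurable_fun setT (fun w => (X ^~ w : nat -> R) : seq_space n).
Proof. by apply: (measurable_seq_of (V := fun i w => X i w)) => i _. Qed.

Definition twisted (c : nat -> R) j i : R -> R :=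
  if i == j then cond_density F (c i) else cst 1.

Let twisted_ge0 c j i x : 0 <= twisted c j i x.
Proof. by rewrite /twisted; case: ifP => _; rewrite ?cond_density_ge0. Qed.

Let measurable_twisted c j i : measurable_fun setT (twisted c j i).
Proof. by rewrite /twisted; case: ifP => _ //; exact: measurable_cond_density. Qed.

Let twisted_law (c : nat -> nat) j i (A : set R) : measurable A ->
  ((if i == j then cond_law F (b + (c i)%:R * mu) A else F A) =
   \int[F]_(x in A) (twisted (fun i => b + (c i)%:R * mu) j i x)%:E)%E.
Proof.
move=> mA; rewrite /twisted; case: ifP => _; first exact: (cond_lawE adm).
by rewrite [RHS](integral_cst F mA 1%:E) mul1e.
Qed.

Let twisted_lty (c : nat -> nat) j i :
  (\int[F]_x (twisted (fun i => b + (c i)%:R * mu) j i x)%:E < +oo)%E.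
Proof.
rewrite -twisted_law//; case: ifP => _; last first.
  by rewrite probability_setT ltry.
by rewrite (cond_lawT mu0 b0 adm tail_gt0) ltry.
Qed.

Let prod_twisted c j n (x : nat -> R) : (1 <= j <= n)%N ->
  \prod_(1 <= i < n.+1) twisted c j i (x i) = cond_density F (c j) (x j).
Proof.
move=> jn; rewrite (bigD1_seq j) ?iota_uniq ?mem_index_iota//= {1}/twisted eqxx.
by rewrite big1 ?mulr1// => i /negbTE ij; rewrite /twisted ij.
Qed.

(** Common to the first and third estimators. The level at index i is written b + (c i) mu with
    [c i] natural, because the atoms are excluded at such levels only: [c] is the identity for the
    first estimator and constantly n_(k-1) for the third. *)
Lemma cell_twisted (V : nat -> {RV Q >-> R}) (c : nat -> nat) j (f : (nat -> R) -> R) :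
  (1 <= j <= n_ k)%N ->
  measurable_fun setT (f : seq_space (n_ k) -> R) -> (forall x, 0 <= f x) ->
  (forall A : nat -> set R, (forall i, measurable (A i)) ->
     (Q (cell k j1 j3 `&` [set w | box (n_ k) A (V ^~ w)]) = (weight k j1)%:E *
      \prod_(1 <= i < (n_ k).+1)
        (if i == j then cond_law F (b + (c i)%:R * mu) (A i) else F (A i)))%E) ->
  (\int[Q]_(w in cell k j1 j3) (f (V ^~ w))%:E =
   \int[P]_w (weight k j1 * cond_density F (b + (c j)%:R * mu) (X j w) * f (X ^~ w))%:E)%E.
Proof.
move=> jn mf f0 QE.
have mfX : measurable_fun setT (fun w => f (X ^~ w)).
  exact: (measurableT_comp mf (@mXs _)).
rewrite (box_change_of_law iidX (n := n_ k) (V := fun i w => V i w)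
  (g := twisted (fun i => b + (c i)%:R * mu) j) (C := weight k j1)) //.
- under eq_integral do rewrite prod_twisted//.
  rewrite -ge0_integralZl//.
  + by apply: eq_integral => w _; rewrite -EFinM mulrA.
  + apply/measurable_EFinP/measurable_funM => //.
    by apply: measurableT_comp => //; exact: measurable_cond_density.
  + by move=> w _; rewrite lee_fin mulr_ge0// cond_density_ge0.
- exact: measurable_cell.
- by rewrite [ltLHS]cell_measure ltry.
- by move=> i; exact: twisted_lty.
- move=> A mA; apply: (etrans (QE A mA)); congr (_ * _)%E; apply: eq_bigr => i _.
  exact: twisted_law.
Qed.

Lemma cell_Z1 :
  (\int[Q]_(w in cell k j1 j3) (Z1 F mu r b k (run_inc1 W ^~ w))%:E =
   \int[P]_w (weight k j1 * cond_density F (b + j1%:R * mu) (X j1 w)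
              * Z1 F mu r b k (X ^~ w))%:E)%E.
Proof.
apply: (cell_twisted (c := id)).
- by move: j1k => /andP[j1l ->]; rewrite (leq_ltn_trans _ j1l).
- exact: measurable_Z1.
- exact: Z1_ge0.
- move=> A mA; have := @cell_boxes A (fun=> setT) (fun=> setT) (fun=> setT).
  rewrite (prod_condT (fun=> n_ k.-1)) prod_tiltedT prod_FT !mule1.
  move=> <- //; congr (Q (_ `&` _)); apply/seteqP; split => w /=; last by case.
  by split => //; split.
Qed.

Lemma cell_Z3 :
  (\int[Q]_(w in cell k j1 j3) (Z3 F mu r b k (run_inc3 W ^~ w))%:E =
   \int[P]_w (weight k j1 * cond_density F (c_ k) (X j3 w)
              * Z3 F mu r b k (X ^~ w))%:E)%E.
Proof.
apply: (cell_twisted (c := fun=> n_ k.-1)) => //.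
- exact: measurable_Z3.
- exact: Z3_ge0.
- move=> A mA; have := @cell_boxes (fun=> setT) (fun=> setT) (fun=> setT) A.
  rewrite (prod_condT id) prod_tiltedT prod_FT !mule1 mul1e.
  move=> <- //; congr (Q (_ `&` _)); apply/seteqP; split => w /=; last by case.
  by split => //; split.
Qed.

(** [splice] with a fixed time m instead of the passage time: each coordinate now depends on a
    single input, so the preimage of a box is a pair of boxes. *)
Definition spliced m (x y : nat -> R) i : R := if (i <= m)%N then x i else y i.

Let tilt_lty : (\int[F]_x (tilt_density F mu r b k x)%:E < +oo)%E.
Proof. by rewrite -tilted_lawE// (tilted_lawT mu0 b0 adm Fneg) ?ltry. Qed.

(** On passage at time m the exponential in [Z2_at] is the inverse of the likelihood ratio of the
    first m increments; the truncation indicators in that ratio equal 1 on [allB], and the later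
    increments already have law [F]. *)
Lemma cell_Z2_at m : (m <= n_ k)%N ->
  (\int[Q]_(w in cell k j1 j3)
     (Z2_at F mu r b k m (spliced m (run_pre2 W ^~ w) (run_post2 W ^~ w)))%:E =
   (weight k j1)%:E *
   P [set w | first_hit mu b (X ^~ w) m && allB mu b r k (X ^~ w)])%E.
Proof.
move=> mk.
pose g i := if (i <= m)%N then tilt_density F mu r b k else cst 1.
have mf := @measurable_Z2_at R F mu r b k m mk.
have mg i : measurable_fun setT (g i).
  by rewrite /g; case: ifP => _ //; exact: measurable_tilt_density.
transitivity ((weight k j1)%:E * \int[P]_w
    ((\prod_(1 <= i < (n_ k).+1) g i (X i w)) * Z2_at F mu r b k m (X ^~ w))%:E)%E.
  apply: (box_change_of_law iidX (n := n_ k)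
    (V := fun i w => spliced m (run_pre2 W ^~ w) (run_post2 W ^~ w) i)) => //.
  - exact: measurable_cell.
  - by rewrite [ltLHS]cell_measure ltry.
  - by move=> i; rewrite /spliced; case: (i <= m)%N.
  - by move=> i x; rewrite /g; case: ifP => _ //; exact: tilt_density_ge0.
  - move=> i; rewrite /g; case: ifP => _ //.
    by rewrite [ltLHS](integral_cst F measurableT 1%:E) mul1e [ltLHS](probability_setT F) ltry.
  (* A box for the spliced trajectory constrains the tilted inputs up to m and the untilted ones
     after m; the unconstrained factors are total masses, equal to 1. *)
  - move=> A mA; have := @cell_boxes (fun=> setT)
      (fun i => if (i <= m)%N then A i else setT)
      (fun i => if (i <= m)%N then setT else A i) (fun=> setT).
    rewrite (prod_condT id) (prod_condT (fun=> n_ k.-1)) mul1e mule1.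
    rewrite -big_split/= => QE.
    transitivity ((weight k j1)%:E * \prod_(1 <= i < (n_ k).+1)
      (tilted_law F mu r b k (if (i <= m)%N then A i else [set: R]) *
       F (if (i <= m)%N then [set: R] else A i)))%E; last first.
      congr (_ * _)%E; apply: eq_bigr => i _; rewrite /g; case: ifP => _.
        by rewrite probability_setT mule1 tilted_lawE.
      rewrite (tilted_lawT mu0 b0 adm Fneg)// mul1e.
      by rewrite [RHS](integral_cst F (mA i) 1%:E) mul1e.
    rewrite -QE//; last 2 first.
    + by move=> i; case: ifP.
    + by move=> i; case: ifP.
    congr (Q (_ `&` _)); apply/seteqP; split => w /=.
      move=> h; split=> // i ni; have := h i ni; rewrite /spliced.
        by case: ifP.
      by case: ifP.
    by move=> [_ h h' _] i ni; have := h i ni; have := h' i ni; rewrite /spliced; case: ifP.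
  - by move=> x; rewrite /Z2_at mulr_ge0 ?expR_ge0.
congr (_ * _)%E.
set E := [set w | first_hit mu b (X ^~ w) m && allB mu b r k (X ^~ w)].
have mE : measurable E.
  rewrite -[E]setTI.
  have mfb := measurableT_comp (measurable_and (measurable_first_hit mu b mk)
    (@measurable_allB R mu b r k)) (@mXs (n_ k)).
  exact: (mfb measurableT [set true]).
rewrite -[RHS](congr1 P (setIT E)) -integral_indic//.
apply: eq_integral => w _; congr EFin; rewrite indicE /Z2_at.
set x := (X ^~ w : nat -> R).
have -> : (w \in E) = first_hit mu b x m && allB mu b r k x by apply/idP/idP; rewrite inE.
case: (boolP (allB mu b r k x)) => xB; last by rewrite andbF !mulr0.
rewrite andbT.
have -> : \prod_(1 <= i < (n_ k).+1) g i (X i w) =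
    expR (theta F mu r b k * partial_sum x m
        - m%:R * Lambda F mu r b k (theta F mu r b k)).
  rewrite (big_cat_nat _ (n := m.+1))//= [X in _ * X]big_nat [X in _ * X]big1 ?mulr1; last first.
    by move=> i /andP[mi _]; rewrite /g leqNgt mi.
  transitivity (\prod_(1 <= i < m.+1) expR (theta F mu r b k * x i
      - Lambda F mu r b k (theta F mu r b k))).
    apply: eq_big_nat => i /andP[i1 im]; rewrite /g -ltnS im /tilt_density.
    move/allP : xB => /(_ i); rewrite mem_index_iota i1 ltnS (leq_trans _ mk)//.
    by move=> /(_ isT) ->; rewrite mulr1.
  rewrite -expR_sum /partial_sum mulr_sumr sumrB; congr (expR (_ - _)).
  by rewrite big_const_nat subn1 iter_addr_0 mulr_natl.
by rewrite mulrA -expRD (_ : _ + _ = 0) ?expR0 ?mul1r//; ring.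
Qed.

End one_cell.

Lemma sum_bool_count (s : seq nat) (B : nat -> bool) :
  \sum_(i <- s) (B i)%:R = (count B s)%:R :> R.
Proof. by rewrite -sum1_count natr_sum [RHS]big_mkcond; apply: eq_bigr => i _; case: (B i). Qed.

Lemma integral_bool (B : T -> bool) : measurable_fun setT B ->
  (\int[P]_w ((B w)%:R : R)%:E = P [set w | B w])%E.
Proof.
move=> mB; have mE : measurable [set w | B w].
  by rewrite -[[set _ | _]]setTI; exact: (mB measurableT [set true]).
rewrite -[RHS](congr1 P (setIT _)) -integral_indic//.
apply: eq_integral => w _; rewrite indicE; congr ((nat_of_bool _)%:R)%:E.
by apply/idP/idP; rewrite inE.
Qed.

Let mXS n : measurable_fun setT (fun w => (X ^~ w : nat -> R) : seq_space n).
Proof.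
by apply: (measurable_seq_of (V := fun i w => X i w)) => i _; exact: measurable_funP.
Qed.

Definition J1s k := index_iota (n_ k.-1).+1 (n_ k).+1.
Definition J3s k := index_iota 1 (n_ k).+1.

Lemma sum_cells_expectation k (f : T' -> \bar R) (h : nat -> nat -> T -> R) :
  (forall j1 j3, measurable_fun setT (h j1 j3)) -> (forall j1 j3 w, 0 <= h j1 j3 w) ->
  (forall j1 j3, (n_ k.-1 < j1 <= n_ k)%N -> (1 <= j3 <= n_ k)%N ->
     \int[Q]_(w in cell k j1 j3) f w = \int[P]_w (h j1 j3 w)%:E)%E ->
  (\sum_(j1 <- J1s k) \sum_(j3 <- J3s k) \int[Q]_(w in cell k j1 j3) f w =
   \int[P]_w (\sum_(j1 <- J1s k) \sum_(j3 <- J3s k) h j1 j3 w)%:E)%E.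
Proof.
move=> mh h0 fh.
transitivity (\int[P]_w (\sum_(j1 <- J1s k) \sum_(j3 <- J3s k) (h j1 j3 w)%:E))%E; last first.
  apply: eq_integral => w _; rewrite -sumEFin; apply: eq_bigr => j1 _.
  by rewrite -sumEFin.
rewrite ge0_integral_sum//; last 2 first.
- move=> j1; apply: emeasurable_sum => j3; exact/measurable_EFinP.
- by move=> j1 w _; apply: sume_ge0 => j3 _; rewrite lee_fin.
apply: eq_big_seq => j1; rewrite mem_index_iota ltnS => j1k.
rewrite ge0_integral_sum//; last 2 first.
- move=> j3; exact/measurable_EFinP.
- by move=> j3 w _; rewrite lee_fin.
by apply: eq_big_seq => j3; rewrite mem_index_iota ltnS => j3k; exact: fh.
Qed.

(** For i > n_(k-1) the level b + i mu is at least the barrier. This keeps the parts recovered by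
    the first two estimators disjoint. *)
Lemma hasA_allB k x : hasA mu b r k x -> ~~ allB mu b r k x.
Proof.
move=> /hasP[i]; rewrite mem_index_iota ltnS => /andP[ik in_] xi.
apply/allPn; exists i; first by rewrite mem_index_iota ltnS in_ (leq_ltn_trans _ ik).
rewrite -leNgt (le_trans _ (ltW xi))// lerD2l ler_wpM2r ?(ltW mu0)//.
by rewrite ler_nat ltnW.
Qed.

Lemma sum_weight k : (1 <= k)%N ->
  \sum_(j1 <- J1s k) weight k j1 = p k / (n_ k)%:R.
Proof.
move=> k1; rewrite /weight -mulr_suml -mulr_sumr -mulr_suml.
rewrite -/(q_ F mu r b k) divff ?mulr1// gt_eqF//.
apply: (@q_gt0 k (n_ k)); rewrite leqnn andbT.
by case: k k1 => [|[|k]] _ //=; [rewrite expn1 ltnW|rewrite ltn_exp2l].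
Qed.

Lemma size_J3s k : size (J3s k) = n_ k. Proof. by rewrite size_iota subn1. Qed.

(** The tail in the weight of [j1] cancels the one in the conditional density, q_k cancels the
    numerator of [Z1], and the sum over [j3] cancels 1 / n_k. The count is nonzero on [hasA]; where
    it vanishes the indicator is 0. *)
Lemma run_sum_Z1 k x : (1 <= k)%N ->
  \sum_(j1 <- J1s k) \sum_(j3 <- J3s k)
     (weight k j1 * cond_density F (b + j1%:R * mu) (x j1) * Z1 F mu r b k x)
  = p k * (win mu b r k x && hasA mu b r k x)%:R.
Proof.
move=> k1.
have n0 : (n_ k)%:R != 0 :> R by rewrite pnatr_eq0 -lt0n (blk_gt0 r1).
under eq_bigr do rewrite big_const_seq count_predT size_J3s iter_addr_0 -(mulr_natr _ (n_ k)).
rewrite Z1E; set N := count _ _; set I := (_ && _).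
have [hI|hI] := boolP I; last by rewrite !mulr0 big1// => j _; rewrite !mulr0 mul0r.
have N0 : N%:R != 0 :> R.
  rewrite pnatr_eq0 -lt0n -has_count; move: hI => /andP[_ /hasP[i ik xi]].
  by apply/hasP; exists i => //; exact: ltW.
have [j0 j0k] : exists j, (n_ k.-1 < j <= n_ k)%N.
  move: hI => /andP[_ /hasP[i]]; rewrite mem_index_iota ltnS => ik _.
  by exists i.
have q0 : q k != 0 by rewrite gt_eqF// (q_gt0 j0k).
rewrite !mulr1 (eq_bigr (fun j => p k / N%:R * (b + j%:R * mu <= x j)%R%:R)).
  by rewrite -mulr_sumr sum_bool_count -/N divfK.
move=> j _; rewrite /weight /cond_density.
have t0 : tail F (b + j%:R * mu) != 0 by rewrite gt_eqF// tail_gt0 ?level_gt0.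
by field; rewrite ?n0 ?N0 ?q0 ?t0.
Qed.

Lemma run_sum_Z3 k x : (1 <= k)%N ->
  \sum_(j1 <- J1s k) \sum_(j3 <- J3s k)
     (weight k j1 * cond_density F (c_ k) (x j3) * Z3 F mu r b k x)
  = p k * (win mu b r k x && (~~ hasA mu b r k x && ~~ allB mu b r k x))%:R.
Proof.
move=> k1.
have n0 : (n_ k)%:R != 0 :> R by rewrite pnatr_eq0 -lt0n (blk_gt0 r1).
transitivity ((\sum_(j1 <- J1s k) weight k j1) *
    ((\sum_(j3 <- J3s k) cond_density F (c_ k) (x j3)) * Z3 F mu r b k x)).
  rewrite !mulr_suml; apply: eq_bigr => j1 _.
  by rewrite mulr_sumr; apply: eq_bigr => j3 _; rewrite mulrA.
rewrite sum_weight// Z3E; set N := count _ _; set I := (_ && _).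
have [hI|hI] := boolP I; last by rewrite !mulr0.
have N0 : N%:R != 0 :> R.
  rewrite pnatr_eq0 -lt0n -has_count; move: hI => /andP[_ /andP[_ /allPn[i ik xi]]].
  by apply/hasP; exists i => //; rewrite leNgt.
have t0 : tail F (c_ k) != 0 by rewrite gt_eqF// tail_gt0 ?level_gt0.
rewrite /cond_density -mulr_suml sum_bool_count -/N.
by field; rewrite ?n0 ?N0 ?t0.
Qed.

(** Splicing at the passage time of [x] does not move the first passage: up to that time the spliced
    path is [x], and if [x] never passes it is [x] altogether. So only the term where m is the
    passage time of [x] can be nonzero, and there [splice] and [spliced m] coincide. *)
Lemma Z2_splice k x y :
  Z2 F mu r b k (splice mu b x y) =
  \sum_((n_ k.-1).+1 <= m < (n_ k).+1) Z2_at F mu r b k m (spliced m x y).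
Proof.
rewrite Z2E; apply: eq_bigr => m _.
have [hm|hm] := boolP (first_hit mu b x m).
  rewrite (_ : splice mu b x y = spliced m x y)//; apply/funext => i.
  by rewrite /splice /spliced (tau_first_hit hm) lee_fin ler_nat.
have -> : Z2_at F mu r b k m (spliced m x y) = 0.
  rewrite /Z2_at (_ : first_hit mu b (spliced m x y) m = false) ?mulr0//.
  rewrite -(negbTE hm); apply: eq_first_hit => i /andP[_ im].
  by rewrite /spliced im.
rewrite /Z2_at; case: (boolP (first_hit mu b (splice mu b x y) m)) => [hs|]; last by rewrite mulr0.
exfalso; have [t|t] := eqVneq (tau mu b x) +oo%E.
  have sx : splice mu b x y = x by apply/funext => i; rewrite /splice t leey.
  by move: hs hm; rewrite sx => ->.
have [|m' hm'] := @tau_lty_ex _ mu b x; first by rewrite ltey.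
have hs' : first_hit mu b (splice mu b x y) m'.
  rewrite (@eq_first_hit _ mu b _ x)// => i /andP[_ im'].
  by rewrite /splice (tau_first_hit hm') lee_fin ler_nat im'.
by move: hm; rewrite (first_hit_inj hs hs') hm'.
Qed.

Lemma weight_nneg k j1 : (1 <= k)%N -> 0 <= weight k j1.
Proof.
move=> k1; rewrite /weight divr_ge0// mulr_ge0 ?divr_ge0 ?tail_ge0//.
  by rewrite ltW// p_gt0.
by rewrite /q_ sumr_ge0// => i _; exact: tail_ge0.
Qed.

Let mTs n (V : nat -> {RV Q >-> R}) :
  measurable_fun setT (fun w => (V ^~ w : nat -> R) : seq_space n).
Proof.
by apply: (measurable_seq_of (V := fun i w => V i w)) => i _; exact: measurable_funP.
Qed.

Let mspliced n m :
  measurable_fun setT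
    (fun w => spliced m (run_pre2 W ^~ w) (run_post2 W ^~ w) : seq_space n).
Proof.
apply: (measurable_seq_of (V := fun i w =>
  spliced m (run_pre2 W ^~ w) (run_post2 W ^~ w) i)) => i _.
by rewrite /spliced; case: (i <= m)%N; exact: measurable_funP.
Qed.

Let measurable_run_Z1 k :
  measurable_fun setT (fun w => Z1 F mu r b k (run_inc1 W ^~ w)).
Proof. exact: (measurableT_comp (@measurable_Z1 R F mu r b k) (@mTs (n_ k) _)). Qed.

Let measurable_run_Z3 k :
  measurable_fun setT (fun w => Z3 F mu r b k (run_inc3 W ^~ w)).
Proof. exact: (measurableT_comp (@measurable_Z3 R F mu r b k) (@mTs (n_ k) _)). Qed.

Let measurable_run_Z2_at k m : (m <= n_ k)%N ->
  measurable_fun setT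
    (fun w => Z2_at F mu r b k m (spliced m (run_pre2 W ^~ w) (run_post2 W ^~ w))).
Proof.
move=> mk.
exact: (measurableT_comp (@measurable_Z2_at R F mu r b k m mk) (@mspliced (n_ k) m)).
Qed.

Let measurable_run_Z2_at' k m :
  measurable_fun setT (fun w => if m \in J1s k then
    Z2_at F mu r b k m (spliced m (run_pre2 W ^~ w) (run_post2 W ^~ w)) else 0).
Proof.
rewrite mem_index_iota ltnS; case: (_ < m <= _)%N / boolP => [/andP[_ mk]|_] //.
exact: measurable_run_Z2_at.
Qed.

Let Z2_spliceE k w :
  Z2 F mu r b k (splice mu b (run_pre2 W ^~ w) (run_post2 W ^~ w)) =
  \sum_(m <- J1s k) (if m \in J1s k then
    Z2_at F mu r b k m (spliced m (run_pre2 W ^~ w) (run_post2 W ^~ w)) else 0).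
Proof. by rewrite Z2_splice big_seq big_mkcond. Qed.

Let measurable_run_Z2 k : measurable_fun setT (fun w =>
  Z2 F mu r b k (splice mu b (run_pre2 W ^~ w) (run_post2 W ^~ w))).
Proof. by rewrite (funext (Z2_spliceE k)); exact: measurable_sum. Qed.

Lemma measurable_Zk k : measurable_fun setT (Zk F mu r b W k).
Proof. by apply: measurable_funD => //; apply: measurable_funD. Qed.

Lemma Zk_ge0 k w : 0 <= Zk F mu r b W k w.
Proof. by rewrite /Zk !addr_ge0 ?Z1_ge0 ?Z2_ge0 ?Z3_ge0. Qed.

Let mwin k : measurable_fun setT (fun w => win mu b r k (X ^~ w)).
Proof. exact: (measurableT_comp (@measurable_win R mu b r k) (@mXS (n_ k))). Qed.

Let mallB k : measurable_fun setT (fun w => allB mu b r k (X ^~ w)).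
Proof. exact: (measurableT_comp (@measurable_allB R mu b r k) (@mXS (n_ k))). Qed.

Lemma cell_Z2 k j1 j3 : (1 <= k)%N -> (n_ k.-1 < j1 <= n_ k)%N -> (1 <= j3 <= n_ k)%N ->
  (\int[Q]_(w in cell k j1 j3)
     (Z2 F mu r b k (splice mu b (run_pre2 W ^~ w) (run_post2 W ^~ w)))%:E =
   \int[P]_w (weight k j1 * (win mu b r k (X ^~ w) && allB mu b r k (X ^~ w))%:R)%:E)%E.
Proof.
move=> k1 j1k j3k.
under eq_integral do rewrite Z2_spliceE -sumEFin.
rewrite ge0_integral_sum//; last 3 first.
- exact: measurable_cell.
- by move=> m; apply/measurable_EFinP/measurable_funTS/measurable_run_Z2_at'.
- by move=> m w _; rewrite lee_fin; case: ifP => // _; exact: Z2_at_ge0.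
transitivity (\sum_(m <- J1s k) \int[P]_w
  (weight k j1 * (first_hit mu b (X ^~ w) m && allB mu b r k (X ^~ w))%:R)%:E)%E.
  apply: eq_big_seq => m mk.
  rewrite mk; move: mk; rewrite mem_index_iota ltnS => /andP[_ mk].
  rewrite (cell_Z2_at k1 j1k j3k mk) -integral_bool; last first.
    apply: measurable_and => //.
    exact: (measurableT_comp (measurable_first_hit mu b mk) (@mXS (n_ k))).
  rewrite -ge0_integralZl//.
  - apply/measurable_EFinP; apply: measurable_bool_real; apply: measurable_and => //.
    exact: (measurableT_comp (measurable_first_hit mu b mk) (@mXS (n_ k))).
  - by rewrite lee_fin weight_nneg.
rewrite -ge0_integral_sum//; last 2 first.
- move=> m; apply/measurable_EFinP/measurable_funM => //.
  apply: measurable_bool_real; apply: measurable_and => //.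
  exact: (measurableT_comp (measurable_first_hit mu b (leqnn m)) (@mXS m)).
- by move=> m w _; rewrite lee_fin mulr_ge0// weight_nneg.
apply: eq_integral => w _; rewrite sumEFin -mulr_sumr; congr (_ * _)%:E.
set x := (X ^~ w : nat -> R).
case: (boolP (allB _ _ _ _ _)) => _; last by rewrite !andbF big1// => m _; rewrite andbF.
under eq_bigr do rewrite andbT.
rewrite andbT; have [/hasP[m mk hm]|/hasPn nh] := boolP (win mu b r k x).
  rewrite (bigD1_seq m)// ?iota_uniq//= hm big1 ?addr0// => n /negbTE nm.
  by case: (boolP (first_hit mu b x n)) => // /(first_hit_inj hm) mn; rewrite mn eqxx in nm.
by rewrite big_seq big1// => m /nh /negbTE ->.
Qed.

Lemma sum_cells_Zk k : (1 <= k)%N ->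
  (\sum_(j1 <- J1s k) \sum_(j3 <- J3s k)
     \int[Q]_(w in cell k j1 j3) (Zk F mu r b W k w)%:E =
   (p k)%:E * P [set w | win mu b r k (X ^~ w)])%E.
Proof.
move=> k1.
have mc c : measurable_fun setT (cond_density F c) by exact: measurable_cond_density.
pose h1 j1 (w : T) := weight k j1 * cond_density F (b + j1%:R * mu) (X j1 w)
  * Z1 F mu r b k (X ^~ w).
pose h2 j1 w := weight k j1 * (win mu b r k (X ^~ w) && allB mu b r k (X ^~ w))%:R.
pose h3 j1 j3 w := weight k j1 * cond_density F (c_ k) (X j3 w) * Z3 F mu r b k (X ^~ w).
have mh1 j1 : measurable_fun setT (h1 j1).
  apply: measurable_funM; last exact: (measurableT_comp (@measurable_Z1 R F mu r b k) (@mXS _)).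
  by apply: measurable_funM => //; exact: measurableT_comp.
have mh2 j1 : measurable_fun setT (h2 j1).
  by apply: measurable_funM => //; apply: measurable_bool_real; exact: measurable_and.
have mh3 j1 j3 : measurable_fun setT (h3 j1 j3).
  apply: measurable_funM; last exact: (measurableT_comp (@measurable_Z3 R F mu r b k) (@mXS _)).
  by apply: measurable_funM => //; exact: measurableT_comp.
have w0 j := weight_nneg j k1.
have h10 j w : 0 <= h1 j w by rewrite /h1 mulr_ge0 ?Z1_ge0// mulr_ge0 ?cond_density_ge0.
have h20 j w : 0 <= h2 j w by rewrite /h2 mulr_ge0.
have h30 j j3 w : 0 <= h3 j j3 w by rewrite /h3 mulr_ge0 ?Z3_ge0// mulr_ge0 ?cond_density_ge0.
rewrite (@sum_cells_expectation k _ (fun j1 j3 w => h1 j1 w + h2 j1 w + h3 j1 j3 w)); last 3 first.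
- by move=> j1 j3; apply: measurable_funD => //; exact: measurable_funD.
- by move=> j1 j3 w; rewrite !addr_ge0.
- move=> j1 j3 j1k j3k.
  have mQ f : measurable_fun setT f -> measurable_fun (cell k j1 j3) (EFin \o f).
    by move=> mf; apply/measurable_EFinP/measurable_funTS.
  transitivity (\int[Q]_(w in cell k j1 j3) (Z1 F mu r b k (run_inc1 W ^~ w))%:E +
    \int[Q]_(w in cell k j1 j3) (Z2 F mu r b k (splice mu b (run_pre2 W ^~ w) (run_post2 W ^~ w)))%:E +
    \int[Q]_(w in cell k j1 j3) (Z3 F mu r b k (run_inc3 W ^~ w))%:E)%E.
    have mC := measurable_cell k j1 j3.
    rewrite -ge0_integralD//; last 4 first.
    + by move=> w _; rewrite lee_fin Z1_ge0.
    + exact: mQ.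
    + by move=> w _; rewrite lee_fin Z2_ge0.
    + exact: mQ.
    rewrite -ge0_integralD//.
    + by move=> w _; rewrite -EFinD lee_fin addr_ge0 ?Z1_ge0 ?Z2_ge0.
    + by apply: emeasurable_funD; exact: mQ.
    + by move=> w _; rewrite lee_fin Z3_ge0.
    + exact: mQ.
  rewrite cell_Z1// cell_Z2// cell_Z3//.
  rewrite -ge0_integralD//; last 4 first.
  + by move=> w _; rewrite lee_fin; exact: h10.
  + by apply/measurable_EFinP; exact: mh1.
  + by move=> w _; rewrite lee_fin; exact: h20.
  + by apply/measurable_EFinP; exact: mh2.
  rewrite -ge0_integralD//.
  + by move=> w _; rewrite -EFinD lee_fin addr_ge0 ?h10 ?h20.
  + apply: emeasurable_funD; apply/measurable_EFinP; [exact: mh1|exact: mh2].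
  + by move=> w _; rewrite lee_fin; exact: h30.
  + by apply/measurable_EFinP; exact: mh3.
rewrite -integral_bool// -ge0_integralZl//; last 2 first.
- by apply/measurable_EFinP; exact: measurable_bool_real.
- by rewrite lee_fin ltW// p_gt0.
apply: eq_integral => w _; rewrite -EFinM; congr EFin.
under eq_bigr do rewrite !big_split.
rewrite !big_split /= run_sum_Z1// run_sum_Z3//.
have -> : \sum_(j1 <- J1s k) \sum_(j3 <- J3s k) h2 j1 w =
    p k * (win mu b r k (X ^~ w) && allB mu b r k (X ^~ w))%:R.
  under eq_bigr do rewrite big_const_seq count_predT size_J3s iter_addr_0 -(mulr_natr _ (n_ k)).
  rewrite -mulr_suml -mulr_suml sum_weight// mulrAC divfK//.
  by rewrite pnatr_eq0 -lt0n (blk_gt0 r1).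
(* The three indicators add up to that of the window: [hasA] excludes [allB], and the third event is
   the remaining case. *)
rewrite -!mulrDr; congr (_ * _); set x := (X ^~ w : nat -> R).
case: (win _ _ _ _ _) => /=; last by rewrite !addr0.
case: (boolP (hasA _ _ _ _ _)) => [/hasA_allB/negbTE ->|_] /=; first by rewrite !addr0.
by case: (allB _ _ _ _ _); rewrite /= ?add0r ?addr0.
Qed.

Lemma sum_cell_measure k : (1 <= k)%N ->
  (\sum_(j1 <- J1s k) \sum_(j3 <- J3s k) Q (cell k j1 j3) = (p k)%:E)%E.
Proof.
move=> k1.
transitivity (\sum_(j1 <- J1s k) \sum_(j3 <- J3s k) (weight k j1)%:E)%E.
  apply: eq_big_seq => j1; rewrite mem_index_iota ltnS => j1k.
  by apply: eq_big_seq => j3; rewrite mem_index_iota ltnS => j3k; exact: cell_measure.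
under eq_bigr do rewrite sumEFin big_const_seq count_predT size_J3s iter_addr_0
  -(mulr_natr _ (n_ k)).
rewrite sumEFin -mulr_suml sum_weight// divfK//.
by rewrite pnatr_eq0 -lt0n (blk_gt0 r1).
Qed.

(* K = k with J1 and J3 in range; [follows] does not mention the complement
   of the union of these events, which is null as they have total mass 1. *)
Definition block k : set T' :=
  \big[setU/set0]_(j <- [seq (j1, j3) | j1 <- J1s k, j3 <- J3s k]) cell k j.1 j.2.

Lemma blockP k w : block k w -> run_K W w = k.
Proof. by rewrite /block -bigcup_seq => -[j _ []]. Qed.

Lemma measurable_block k : measurable (block k).
Proof. by apply: bigsetU_measurable => j _; exact: measurable_cell. Qed.

Lemma integral_block k (f : T' -> \bar R) :
  measurable_fun setT f -> (forall w, 0 <= f w)%E ->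
  (\int[Q]_(w in block k) f w =
   \sum_(j1 <- J1s k) \sum_(j3 <- J3s k) \int[Q]_(w in cell k j1 j3) f w)%E.
Proof.
move=> mf f0; rewrite ge0_integral_bigsetU//.
- by rewrite big_allpairs.
- by move=> j; exact: measurable_cell.
- by apply: allpairs_uniq; rewrite ?iota_uniq// => -[? ?] [? ?] _ _ [-> ->].
- apply/trivIsetP => -[a b'] [a' b''] _ _ /eqP ne; apply/seteqP; split => // w /=.
  by move=> [[_ e1 e2] [_ e3 e4]]; apply: ne; rewrite -e1 -e2 -e3 -e4.
- exact: measurable_funTS.
Qed.

Lemma trivIset_block : trivIset setT block.
Proof.
apply/trivIsetP => i j _ _ /eqP ij; apply/seteqP; split => // w /= [/blockP wi /blockP wj].
by apply: ij; rewrite -wi -wj.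
Qed.

Lemma nneseries_from1 (f : nat -> \bar R) : f 0%N = 0%E ->
  (\sum_(0 <= k <oo) f k = \sum_(1 <= k <oo) f k)%E.
Proof.
move=> f0; apply: congr_lim; apply/funext => -[|n]; first by rewrite !big_geq.
by rewrite big_ltn// f0 add0e.
Qed.

Lemma integral_blocks (f : T' -> \bar R) :
  measurable_fun setT f -> (forall w, 0 <= f w)%E ->
  (\int[Q]_(w in \bigcup_k block k) f w =
   \sum_(1 <= k <oo) \sum_(j1 <- J1s k) \sum_(j3 <- J3s k) \int[Q]_(w in cell k j1 j3) f w)%E.
Proof.
move=> mf f0; rewrite ge0_integral_bigcup//; last 3 first.
- exact: measurable_block.
- exact: measurable_funTS.
- exact: trivIset_block.
(* For k = 0 the predecessor is again 0, so the range of J1 is empty and block 0 contributes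
   nothing. *)
rewrite nneseries_from1; last by rewrite integral_block// /J1s /index_iota subnn big_nil.
by apply: eq_eseriesr => k _; exact: integral_block.
Qed.

Lemma eq_nneseries_from1 (f g : nat -> \bar R) :
  (forall k, (1 <= k)%N -> f k = g k) ->
  (\sum_(1 <= k <oo) f k = \sum_(1 <= k <oo) g k)%E.
Proof.
move=> fg; apply: congr_lim; apply/funext => n.
by apply: eq_big_nat => k /andP[k1 _]; exact: fg.
Qed.

Lemma measure_blocks : Q (\bigcup_k block k) = 1%E.
Proof.
have mU : measurable (\bigcup_k block k).
  by apply: bigcup_measurable => k _; exact: measurable_block.
have -> : Q (\bigcup_k block k) = (\int[Q]_(w in \bigcup_k block k) (cst 1 w))%E.
  by rewrite integral_cst// mul1e.
rewrite integral_blocks//.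
rewrite -[RHS]psum; apply: eq_nneseries_from1 => k k1.
rewrite -[RHS]sum_cell_measure//; apply: eq_bigr => j1 _; apply: eq_bigr => j3 _.
by rewrite integral_cst ?mul1e//; exact: measurable_cell.
Qed.

Lemma integral_run (f : T' -> \bar R) :
  measurable_fun setT f -> (forall w, 0 <= f w)%E ->
  (\int[Q]_w f w =
   \sum_(1 <= k <oo) \sum_(j1 <- J1s k) \sum_(j3 <- J3s k) \int[Q]_(w in cell k j1 j3) f w)%E.
Proof.
move=> mf f0; rewrite -integral_blocks//.
have mU : measurable (\bigcup_k block k).
  by apply: bigcup_measurable => k _; exact: measurable_block.
rewrite -(setUv (\bigcup_k block k)) ge0_integral_setU//; last 3 first.
- exact: measurableC.
- by rewrite setUv.
- by apply/disj_setPS; rewrite setICr.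
rewrite [X in (_ + X)%E]null_set_integral ?adde0//.
- exact: measurableC.
- exact: measurable_funTS.
- by rewrite [LHS]probability_setC// [X in (_ - X)%E]measure_blocks subee.
Qed.

(** The law of [run_K] is all that the second moment bound and the mean length require of the
    procedure. *)
Lemma integral_run_K (f : nat -> R) : (forall k, 0 <= f k) ->
  (\int[Q]_w (f (run_K W w))%:E = \sum_(1 <= k <oo) (p k * f k)%:E)%E.
Proof.
move=> f0; rewrite integral_run; last 2 first.
- by apply/measurable_EFinP; apply: measurableT_comp => //; exact: measurable_funP.
- by move=> w; rewrite lee_fin.
apply: eq_nneseries_from1 => k k1.
rewrite mulrC EFinM -sum_cell_measure//.
rewrite ge0_sume_distrr; last first.
  by move=> j1 _; apply: sume_ge0 => j3 _.
apply: eq_bigr => j1 _; rewrite ge0_sume_distrr//; apply: eq_bigr => j3 _.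
rewrite -integral_cst; last exact: measurable_cell.
by apply: eq_integral => w /[!inE] -[-> _ _].
Qed.

Lemma measurable_Zrun : measurable_fun setT (Zrun F mu r b W p).
Proof.
move=> _ A mA; rewrite setTI.
rewrite (_ : _ @^-1` A = \bigcup_k (run_K W @^-1` [set k] `&`
    (fun w => Zk F mu r b W k w / p k) @^-1` A)); last first.
  apply/seteqP; split => w /=; first by move=> ?; exists (run_K W w).
  by move=> [k _ [<-]].
apply: bigcup_measurable => k _; apply: measurableI.
  by rewrite -[_ @^-1` _]setTI; exact: measurable_funP.
rewrite -[_ @^-1` _]setTI; apply: measurable_funM => //.
exact: measurable_Zk.
Qed.

Hypothesis p0 : p 0%N = 0.

(** The value K = 0 has probability zero but is not excluded pointwise; there p 0 = 0 and division
    by zero returns 0. *)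
Lemma Zrun_ge0 w : 0 <= Zrun F mu r b W p w.
Proof.
rewrite /Zrun divr_ge0 ?Zk_ge0//; have [->|/p_gt0/ltW//] := posnP (run_K W w).
by rewrite p0.
Qed.

Lemma leq_blk k k' : (k <= k')%N -> (n_ k <= n_ k')%N.
Proof.
by case: k k' => [//|k] [//|k'] kk'; rewrite /= leq_exp2l.
Qed.

Lemma win_inj k k' x : win mu b r k x -> win mu b r k' x -> k = k'.
Proof.
move=> /hasP[m mk hm] /hasP[m' mk' hm'].
move: mk mk'; rewrite -(first_hit_inj hm hm') !mem_index_iota !ltnS => /andP[k1 k2] /andP[k1' k2'].
apply/eqP; rewrite eqn_leq; apply/andP; split; rewrite leqNgt; apply/negP => kk.
  have : (n_ k' <= n_ k.-1)%N by apply: leq_blk; case: k kk {k1 k2 }.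
  by rewrite leqNgt (leq_trans k1 k2').
have : (n_ k <= n_ k'.-1)%N by apply: leq_blk; case: k' kk {k1' k2'}.
by rewrite leqNgt (leq_trans k1' k2).
Qed.

(** The windows partition the positive times, since n_k grows without bound, and b > 0 rules out
    passage at time 0. The window sought is that of the least k with m <= n_k. *)
Lemma tau_lty_win x : (tau mu b x < +oo)%E <-> exists k, win mu b r k x.
Proof.
split=> [/tau_lty_ex[m hm]|[k /hasP[m _ /tau_first_hit ->]]]; last by rewrite ltry.
have m0 : (0 < m)%N by case: m hm => //; rewrite first_hit0.
have ex : exists k, (m <= n_ k)%N.
  by exists m; case: m m0 {hm} => // m _; rewrite /= ltnW// ltn_expl.
exists (ex_minn ex); case: ex_minnP => k mk mink.
apply/hasP; exists m => //; rewrite mem_index_iota ltnS mk andbT ltnNge.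
apply/negP => /mink; case: k mk {mink} => [|k] /=; first by rewrite leqNgt m0.
by rewrite ltnn.
Qed.

Lemma passes_series :
  (P [set w | (tau mu b (X ^~ w) < +oo)%E] =
   \sum_(1 <= k <oo) P [set w | win mu b r k (X ^~ w)])%E.
Proof.
have mE k : measurable [set w | win mu b r k (X ^~ w)].
  by rewrite -[[set _ | _]]setTI; exact: (@mwin k measurableT [set true]).
rewrite -nneseries_from1; last first.
  by rewrite (_ : [set w | _] = set0) ?measure0//; apply/seteqP; split.
rewrite -measure_semi_bigcup//.
- congr (P _); apply/seteqP; split => w /=.
    by move=> /tau_lty_win[k hk]; exists k.
  by move=> [k _ hk]; apply/tau_lty_win; exists k.
- apply/trivIsetP => i j _ _ /eqP ij; apply/seteqP; split => // w /= [hi hj].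
  exact/ij/(win_inj hi hj).
- exact: bigcup_measurable.
Qed.

Lemma expectation_Zrun :
  'E_Q[Zrun F mu r b W p]%E = P [set w | (tau mu b (X ^~ w) < +oo)%E].
Proof.
rewrite unlock integral_run; last 2 first.
- by apply/measurable_EFinP; exact: measurable_Zrun.
- by move=> w; rewrite lee_fin Zrun_ge0.
rewrite passes_series; apply: eq_nneseries_from1 => k k1.
have pk := p_gt0 k1.
transitivity (((p k)^-1)%:E * ((p k)%:E * P [set w | win mu b r k (X ^~ w)]))%E; last first.
  by rewrite muleA -EFinM mulVf ?mul1e// gt_eqF.
rewrite -sum_cells_Zk// ge0_sume_distrr; last first.
  move=> j1 _; apply: sume_ge0 => j3 _; apply: integral_ge0 => w _.
  by rewrite lee_fin Zk_ge0.
apply: eq_bigr => j1 _; rewrite ge0_sume_distrr; last first.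
  by move=> j3 _; apply: integral_ge0 => w _; rewrite lee_fin Zk_ge0.
apply: eq_bigr => j3 _; rewrite -ge0_integralZl//.
- by apply: eq_integral => w /[!inE] -[wk _ _]; rewrite -EFinM /Zrun wk mulrC.
- exact: measurable_cell.
- by apply/measurable_EFinP/measurable_funTS/measurable_Zk.
- by move=> w _; rewrite lee_fin Zk_ge0.
- by rewrite lee_fin invr_ge0 ltW.
Qed.

End runs.

(** * Regular variation *)

Section regular_variation_theory.
Context {R : realType}.

Lemma powR_divf (x y s : R) : 0 < x -> 0 < y -> (y / x) `^ s = y `^ s / x `^ s.
Proof.
move=> x0 y0; rewrite powRM ?invr_ge0 ?ltW//; congr (_ * _).
by rewrite -(powR_inv1 (ltW x0)) -powRrM mulN1r powRN.
Qed.

Lemma near_pinfty_exP (S : R -> Prop) :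
  (\forall x \near +oo, S x) <-> exists2 A : R, 0 < A & forall x, A <= x -> S x.
Proof.
split.
  move=> [M [_ MS]]; exists (Num.max (M + 1) 1); first by rewrite lt_max ltr01 orbT.
  by move=> x; rewrite ge_max => /andP[Mx _]; apply: MS; rewrite (lt_le_trans _ Mx)// ltrDl.
by move=> [A A0 AS]; exists A; split; [exact: num_real|move=> x /ltW; exact: AS].
Qed.

Variables (F : probability R R) (alpha : R) (L : R -> R).
Hypothesis slowL : slowly_varying L.
Hypothesis tailE : forall x, 0 < x -> tail F x = x `^ (- alpha) * L x.
Hypothesis smoothL : assumption2 L.

Lemma tail_nincr x y : x <= y -> tail F y <= tail F x.
Proof.
move=> xy; rewrite /tail fine_le ?fin_num_measure// le_measure// ?inE//.
by move=> z /=; rewrite !in_itv/= !andbT; exact: le_lt_trans.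
Qed.

(** [L] inherits nonnegativity from the tail, and at a zero of [L] the ratio [L (2 * x) / L x] would
    be 0 by the convention on division, too far from its limit 1. *)
Lemma slowly_varying_gt0 : exists2 A : R, 0 < A & forall x, A <= x -> 0 < L x.
Proof.
apply/near_pinfty_exP; have /cvgr_dist_lt /(_ 1 ltr01) h := slowL (@ltr0Sn R 1).
near=> x; have x0 : 0 < x by near: x; exact: nbhs_pinfty_gt.
rewrite lt_neqAle eq_sym; apply/andP; split.
  have : `|1 - L (2 * x) / L x| < 1 by near: x.
  by apply: contraTneq => ->; rewrite invr0 mulr0 subr0 normr1 ltxx.
have := tail_ge0 F x; rewrite tailE// pmulr_rge0//; exact: powR_gt0.
Unshelve. all: by end_near. Qed.

Lemma tail_gt0 x : 0 < tail F x.
Proof.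
have [A A0 AL] := slowly_varying_gt0.
apply: (@lt_le_trans _ _ (tail F (Num.max A x))); last first.
  by apply: tail_nincr; rewrite le_max lexx orbT.
have Am : A <= Num.max A x by rewrite le_max lexx.
have m0 := lt_le_trans A0 Am.
by rewrite tailE// mulr_gt0 ?powR_gt0 ?AL.
Qed.

Lemma is_derive_mul_powR s x : 0 < x -> derivable L x 1 ->
  is_derive x 1 (fun y => L y * y `^ s) (x `^ (s - 1) * (x * derive1 L x + s * L x)).
Proof.
move=> x0 dL.
have dL' : is_derive x 1 L (derive1 L x) by rewrite derive1E; exact: DeriveDef.
have dP := is_derive1_powR s x0.
apply: (is_derive_eq (is_deriveM dL' dP)).
rewrite /GRing.scale /=.
have -> : x `^ s = x `^ (s - 1) * x.
  by rewrite -[X in _ * X]powRr1 ?ltW// -powRD ?subrK// (gt_eqF x0) implybT.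
by ring.
Qed.

(* y^e L(y) eventually increases and y^-e L(y) eventually decreases, because
   |L'(y)| <= e |L(y) / y| gives their derivatives a sign. *)
Lemma potter e : 0 < e -> exists2 A : R, 0 < A & forall x y, A <= x -> x <= y ->
  [/\ 0 < L x, L y <= L x * (y / x) `^ e & L x * (y / x) `^ (- e) <= L y].
Proof.
move=> e0; have [A1 A10 L0] := slowly_varying_gt0.
have [t0 t00 [dL /(_ e e0)/near_pinfty_exP[A2 A20 bL]]] := smoothL.
exists (Num.max t0 (Num.max A1 A2)); first by rewrite lt_max t00.
move=> x y; rewrite !ge_max => /andP[tx /andP[A1x A2x]] xy.
have x0 : 0 < x by exact: lt_le_trans tx.
have y0 : 0 < y by exact: lt_le_trans xy.
have key s : exists2 c, x <= c & L y * y `^ s - L x * x `^ s =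
    c `^ (s - 1) * (c * derive1 L c + s * L c) * (y - x).
  have [||c cxy eq] := @MVT_segment R (fun y => L y * y `^ s)
      (fun c => c `^ (s - 1) * (c * derive1 L c + s * L c)) x y xy.
  - move=> c; rewrite in_itv/= => /andP[xc _].
    apply: is_derive_mul_powR; first exact: lt_trans xc.
    by apply: (dL c _).1; rewrite (le_trans tx)// ltW.
  - apply: derivable_within_continuous => c; rewrite in_itv/= => /andP[xc _].
    have c0 : 0 < c by exact: lt_le_trans xc.
    have dc : derivable L c 1 by apply: (dL c _).1; exact: le_trans xc.
    by have [] := is_derive_mul_powR s c0 dc.
  - by exists c => //; move: cxy; rewrite in_itv/= => /andP[].
have bnd c : x <= c -> `|c * derive1 L c| <= e * L c.
  move=> xc; have c0 : 0 < c by exact: lt_le_trans xc.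
  have := bL c (le_trans A2x xc); have Lc := L0 c (le_trans A1x xc).
  rewrite (gtr0_norm (divr_gt0 Lc c0)) mulrA ler_pdivlMr// normrM (gtr0_norm c0).
  by rewrite mulrC.
split; first exact: L0.
- have [c xc eq] := key (- e).
  have /ler_normlP[_ h] := bnd c xc.
  have c0 : 0 < c by exact: lt_le_trans xc.
  have : L y * y `^ (- e) <= L x * x `^ (- e).
    rewrite -subr_le0 eq -mulrA mulr_ge0_le0 ?powR_ge0//.
    by rewrite mulr_le0_ge0 ?subr_ge0//; lra.
  rewrite powR_divf// !powRN ler_pdivrMr ?powR_gt0// => le; apply: (le_trans le).
  by rewrite mulrA (mulrAC (L x)).
- have [c xc eq] := key e.
  have /ler_normlP[h _] := bnd c xc.
  have c0 : 0 < c by exact: lt_le_trans xc.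
  have : L x * x `^ e <= L y * y `^ e.
    rewrite -subr_ge0 eq -mulrA mulr_ge0 ?powR_ge0//.
    by rewrite mulr_ge0 ?subr_ge0//; lra.
  by rewrite powR_divf// !powRN invrK mulrA mulrAC ler_pdivrMr ?powR_gt0.
Qed.

End regular_variation_theory.

(** * Integrals over half-lines *)

Section tail_integrals.
Context {R : realType}.
Let leb := @lebesgue_measure R.

Lemma cvg_powRN_pinfty (s : R) : 0 < s -> x `^ (- s) @[x --> +oo] --> (0 : R).
Proof.
move=> s0; apply/cvgr0Pnorm_lt => e e0.
near=> x; have x0 : 0 < x by near: x; exact: nbhs_pinfty_gt.
rewrite ger0_norm ?powR_ge0// powRN -[ltRHS]invrK ltf_pV2 ?posrE ?powR_gt0 ?invr_gt0//.
have -> : e^-1 = ((e^-1) `^ (s^-1)) `^ s.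
  by rewrite -powRrM mulVf ?gt_eqF// powRr1// invr_ge0 ltW.
rewrite gt0_ltr_powR ?nnegrE ?powR_ge0 ?(ltW x0)//.
Unshelve. all: by end_near. Qed.

Lemma integral_powR_tail (b s : R) : 0 < b -> 1 < s ->
  (\int[leb]_(u in `[b, +oo[) (u `^ (- s))%:E = (b `^ (1 - s) / (s - 1))%:E)%E.
Proof.
move=> b0 s1; have s10 : 0 < s - 1 by rewrite subr_gt0.
pose f (u : R) := u `^ (- s).
pose G (u : R) := (1 - s)^-1 * u `^ (1 - s).
have sn0 : 1 - s != 0 by rewrite lt_eqF// subr_lt0.
have dG (x : R) : 0 < x -> is_derive x 1 G (f x).
  move=> x0; have dP := is_derive1_powR (1 - s) x0.
  have -> : f x = (1 - s)^-1 *: ((1 - s) * x `^ (1 - s - 1)).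
    by rewrite /GRing.scale /= mulKf// /f; congr (_ `^ _); ring.
  exact: is_deriveZ.
have dg (x : R) : 0 < x -> derivable G x 1 by move=> /dG[].
rewrite (@ge0_continuous_FTC2y R f G b 0).
- rewrite -EFinB sub0r /G; congr EFin; by rewrite -mulNr -invrN opprB mulrC.
- by move=> x _; exact: powR_ge0.
- apply: derivable_within_continuous => x; rewrite in_itv/= andbT => bx.
  by apply: derivable_powR; rewrite in_itv/= andbT (lt_le_trans b0).
- rewrite -[X in _ --> X](mulr0 (1 - s)^-1); apply: cvgM; first exact: cvg_cst.
  by rewrite -(opprB s 1); exact: cvg_powRN_pinfty.
- by move=> x bx; apply: dg; exact: lt_trans bx.
- apply: cvg_at_right_filter; apply/differentiable_continuous/derivable1_diffP.
  exact: dg.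
- by move=> x; rewrite in_itv/= andbT => bx; rewrite derive1E;
    have [_ ->] := dG x (lt_trans b0 bx).
Qed.

Definition tail_int (h : R -> R) (x : R) : R := \int[leb]_(u in `[x, +oo[) h u.

Variables (h : R -> R) (b : R).
Hypotheses (h0 : forall u, 0 <= h u) (mh : measurable_fun setT h).
Hypothesis hoo : (\int[leb]_(u in `[b, +oo[) (h u)%:E < +oo)%E.

Lemma tail_int_lty x : b <= x -> (\int[leb]_(u in `[x, +oo[) (h u)%:E < +oo)%E.
Proof.
move=> bx; apply: le_lt_trans hoo; apply: ge0_subset_integral => //.
- by apply/measurable_EFinP/measurable_funTS.
- by move=> u _; rewrite lee_fin.
- by move=> u /=; rewrite !in_itv/= !andbT; exact: le_trans.
Qed.

Lemma tail_intE x : b <= x ->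
  (tail_int h x)%:E = (\int[leb]_(u in `[x, +oo[) (h u)%:E)%E.
Proof.
move=> bx; rewrite /tail_int /Rintegral fineK// ge0_fin_numE ?tail_int_lty//.
by apply: integral_ge0 => u _; rewrite lee_fin.
Qed.

Lemma tail_int_ge0 x : 0 <= tail_int h x.
Proof. exact: Rintegral_ge0. Qed.

Lemma tail_int_split x y : b <= x -> x <= y ->
  ((tail_int h x)%:E = \int[leb]_(u in `[x, y[) (h u)%:E + (tail_int h y)%:E)%E.
Proof.
move=> bx xy; rewrite !tail_intE// ?(le_trans bx)//.
rewrite -ge0_integral_setU//.
- by congr (integral _ _ _); rewrite -itv_bndbnd_setU// bnd_simp.
- by apply/measurable_EFinP/measurable_funTS.
- by move=> u _; rewrite lee_fin.
- apply/disj_setPS => u /= []; rewrite !in_itv/= andbT => /andP[_ uy] yu.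
  by move: (lt_le_trans uy yu); rewrite ltxx.
Qed.

Lemma tail_int_diff x y : b <= x -> x <= y ->
  ((tail_int h x - tail_int h y)%:E = \int[leb]_(u in `[x, y[) (h u)%:E)%E.
Proof.
by move=> bx xy; rewrite EFinB (tail_int_split bx xy) addeK.
Qed.

Lemma tail_int_diff_ge x y (m : R) : b <= x -> x <= y -> 0 <= m ->
  (forall u, x <= u -> u < y -> m <= h u) ->
  m * (y - x) <= tail_int h x - tail_int h y.
Proof.
move=> bx xy m0 mhu; rewrite -lee_fin tail_int_diff//.
apply: (@le_trans _ _ (\int[leb]_(u in `[x, y[) (cst m%:E u))%E).
  rewrite integral_cst//= lebesgue_measure_itv/= lte_fin; case: ltP => [_|yx].
    by rewrite -EFinB -EFinM.
  by rewrite mule0 lee_fin (_ : y - x = 0) ?mulr0//; apply/eqP; rewrite subr_eq0 eq_le yx.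
apply: ge0_le_integral => //.
- by apply/measurable_EFinP/measurable_funTS.
- by move=> u /=; rewrite in_itv/= lee_fin => /andP[xu uy]; exact: mhu.
Qed.

End tail_integrals.

Section tail_integral_compare.
Context {R : realType}.
Let leb := @lebesgue_measure R.
Variables (h : R -> R).
Hypotheses (h0 : forall u, 0 <= h u) (mh : measurable_fun setT h).

Lemma tail_int_diff_le (h2 : R -> R) (b c x y : R) : 0 <= c ->
  (forall u, 0 <= h2 u) -> measurable_fun setT h2 ->
  (\int[leb]_(u in `[b, +oo[) (h u)%:E < +oo)%E ->
  (\int[leb]_(u in `[b, +oo[) (h2 u)%:E < +oo)%E ->
  b <= x -> x <= y -> (forall u, x <= u -> c * h u <= h2 u) ->
  c * (tail_int h x - tail_int h y) <= tail_int h2 x - tail_int h2 y.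
Proof.
move=> c0 h20 mh2 hoo h2oo bx xy hh2; rewrite -lee_fin EFinM.
rewrite (tail_int_diff h0 mh hoo)// (tail_int_diff h20 mh2 h2oo)//.
rewrite -ge0_integralZl//.
- apply: ge0_le_integral => //.
  + by move=> u _; rewrite -EFinM lee_fin mulr_ge0.
  + by apply/measurable_EFinP/measurable_funTS/measurable_funM.
  + by apply/measurable_EFinP/measurable_funTS.
  + by move=> u /=; rewrite in_itv/= -EFinM lee_fin => /andP[xu _]; exact: hh2.
- by apply/measurable_EFinP/measurable_funTS.
- by move=> u _; rewrite lee_fin.
Qed.

Lemma integral_tail_le (b C s : R) : 0 < b -> 1 < s -> 0 <= C ->
  (forall u, b <= u -> h u <= C * u `^ (- s)) ->
  (\int[leb]_(u in `[b, +oo[) (h u)%:E <= (C * (b `^ (1 - s) / (s - 1)))%:E)%E.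
Proof.
move=> b0 s1 C0 hC; rewrite EFinM -integral_powR_tail//.
have mp : measurable_fun `[b, +oo[%classic (fun u : R => (u `^ (- s))%:E).
  by apply/measurable_EFinP/measurable_funTS; exact: measurable_powR.
rewrite -ge0_integralZl//.
- apply: ge0_le_integral => //.
  + by move=> u _; rewrite lee_fin.
  + by apply/measurable_EFinP/measurable_funTS.
  + exact: measurable_funeM.
  + by move=> u /=; rewrite in_itv/= andbT -EFinM lee_fin; exact: hC.
- by move=> u _; rewrite lee_fin powR_ge0.
Qed.

Lemma integral_tail_ge (b C s : R) : 0 < b -> 1 < s -> 0 <= C ->
  (forall u, b <= u -> C * u `^ (- s) <= h u) ->
  ((C * (b `^ (1 - s) / (s - 1)))%:E <= \int[leb]_(u in `[b, +oo[) (h u)%:E)%E.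
Proof.
move=> b0 s1 C0 hC; rewrite EFinM -integral_powR_tail//.
have mp : measurable_fun `[b, +oo[%classic (fun u : R => (u `^ (- s))%:E).
  by apply/measurable_EFinP/measurable_funTS; exact: measurable_powR.
rewrite -ge0_integralZl//.
- apply: ge0_le_integral => //.
  + by move=> u _; rewrite -EFinM lee_fin mulr_ge0// powR_ge0.
  + exact: measurable_funeM.
  + by apply/measurable_EFinP/measurable_funTS.
  + by move=> u /=; rewrite in_itv/= andbT -EFinM lee_fin; exact: hC.
- by move=> u _; rewrite lee_fin powR_ge0.
Qed.

End tail_integral_compare.

(** * Karamata's theorem with explicit errors *)

Section karamata.
Context {R : realType}.
Let leb := @lebesgue_measure R.
Variables (F : probability R R) (alpha beta : R) (L : R -> R).
Hypothesis slowL : slowly_varying L.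
Hypothesis tailE : forall x, 0 < x -> tail F x = x `^ (- alpha) * L x.
Hypothesis smoothL : assumption2 L.
Hypotheses (alpha_le : alpha <= 2) (beta_gt : 2 < beta).

Lemma tail_potter (e : R) : 0 < e -> exists2 A : R, 0 < A & forall x y : R, A <= x -> x <= y ->
  tail F y <= tail F x * (y / x) `^ (e - alpha) /\
  tail F x * (y / x) `^ (- e - alpha) <= tail F y.
Proof.
move=> e0; have [A A0 h] := potter slowL tailE smoothL e0.
exists A => // x y Ax xy; have [Lx h1 h2] := h x y Ax xy.
have x0 : 0 < x by exact: lt_le_trans Ax.
have y0 : 0 < y by exact: lt_le_trans xy.
have yx0 : y / x != 0 by rewrite gt_eqF// divr_gt0.
have yxD a : (y / x) `^ (a - alpha) = (y / x) `^ a * (y `^ (- alpha) / x `^ (- alpha)).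
  by rewrite powRD ?yx0 ?implybT// -powR_divf.
have xa := powR_gt0 (- alpha) x0.
rewrite !yxD !tailE//; split.
  rewrite (_ : _ * _ * _ = y `^ (- alpha) * (L x * (y / x) `^ e)); last by field; rewrite gt_eqF.
  by rewrite ler_wpM2l ?powR_ge0.
rewrite (_ : _ * _ * _ = y `^ (- alpha) * (L x * (y / x) `^ (- e))); last by field; rewrite gt_eqF.
by rewrite ler_wpM2l ?powR_ge0.
Qed.

Local Notation G := (Gbar F alpha beta).
Local Notation GI := (GbarI F alpha beta).

Lemma GbarE u : G u = tail F u * u `^ (alpha - beta).
Proof. by rewrite /Gbar -powRN opprB. Qed.

Lemma Gbar_ge0 u : 0 <= G u.
Proof. by rewrite GbarE mulr_ge0 ?powR_ge0 ?tail_ge0. Qed.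

Lemma Gbar_gt0 (u : R) : 0 < u -> 0 < G u.
Proof. by move=> u0; rewrite GbarE mulr_gt0 ?powR_gt0 ?(tail_gt0 slowL tailE). Qed.

Lemma Gbar_nincr (u v : R) : 0 < u -> u <= v -> G v <= G u.
Proof.
move=> u0 uv; have v0 := lt_le_trans u0 uv; rewrite !GbarE ler_pM ?powR_ge0 ?tail_ge0 ?tail_nincr//.
rewrite -[alpha - beta]opprB !powRN lef_pV2 ?posrE ?powR_gt0//.
rewrite ge0_ler_powR ?nnegrE ?(ltW u0) ?(ltW v0)//; move: alpha_le beta_gt; lra.
Qed.

Lemma measurable_tail : measurable_fun setT (tail F).
Proof. by apply: nonincreasing_measurable => // x y; exact: tail_nincr. Qed.

Lemma measurable_Gbar : measurable_fun setT G.
Proof.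
rewrite (funext GbarE); apply: measurable_funM; first exact: measurable_tail.
exact: measurable_powR.
Qed.

(** Potter's bounds arranged as multiples of a pure power of [u], ready to be integrated over a
    half-line. *)
Lemma Gbar_potter (e : R) : 0 < e -> exists2 A : R, 0 < A & forall x u : R, A <= x -> x <= u ->
  G u <= G x * x `^ (beta - e) * u `^ (- (beta - e)) /\
  G x * x `^ (beta + e) * u `^ (- (beta + e)) <= G u.
Proof.
move=> e0; have [A A0 h] := tail_potter e0.
exists A => // x u Ax xu; have [h1 h2] := h x u Ax xu.
have x0 : 0 < x by exact: lt_le_trans Ax.
have u0 : 0 < u by exact: lt_le_trans xu.
have key a : u `^ (alpha - beta) * (u / x) `^ (a - alpha) =
    x `^ (alpha - beta) * x `^ (beta - a) * u `^ (- (beta - a)).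
  rewrite powR_divf// mulrA -powRD ?(gt_eqF u0) ?implybT// -powRN.
  rewrite -powRD ?(gt_eqF x0) ?implybT// mulrC.
  by congr (_ `^ _ * _ `^ _); ring.
rewrite !GbarE; split.
  rewrite mulrC; apply: le_trans (ler_wpM2l (powR_ge0 _ _) h1) _.
  by rewrite mulrCA key !mulrA.
rewrite [leRHS]mulrC; apply: le_trans (ler_wpM2l (powR_ge0 _ _) h2).
by rewrite mulrCA key opprK !mulrA.
Qed.

Lemma GbarI_lty (b : R) : 0 < b -> (\int[leb]_(u in `[b, +oo[) (G u)%:E < +oo)%E.
Proof.
move=> b0; have [A A0 h] := @Gbar_potter (1 / 2) (divr_gt0 ltr01 (ltr0Sn R 1)).
pose s := beta - 1 / 2.
have s0 : 1 < s by rewrite /s; move: alpha_le beta_gt; lra.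
(* The first summand dominates on [b, A), where [G] is at most [G b] and (A / u)^s exceeds 1; the
   second dominates on [A, oo) by Potter's bound. *)
pose C := G b * A `^ s + G A * A `^ s.
have C0 : 0 <= C by rewrite addr_ge0// mulr_ge0 ?Gbar_ge0 ?powR_ge0.
apply: (@le_lt_trans _ _ (C * (b `^ (1 - s) / (s - 1)))%:E); last exact: ltry.
apply: integral_tail_le => //; [exact: Gbar_ge0|exact: measurable_Gbar|].
move=> u bu; have u0 : 0 < u by exact: lt_le_trans bu.
have [Au|uA] := leP A u.
  apply: le_trans (h A u (lexx _) Au).1 _.
  by rewrite ler_wpM2r ?powR_ge0// lerDr mulr_ge0 ?Gbar_ge0 ?powR_ge0.
apply: (@le_trans _ _ (G b * A `^ s * u `^ (- s))).
  rewrite powRN -mulrA; apply: le_trans (Gbar_nincr b0 bu) _.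
  rewrite ler_peMr ?Gbar_ge0// ler_pdivlMr ?powR_gt0// mul1r.
  rewrite ge0_ler_powR ?nnegrE ?(ltW u0) ?(ltW A0) ?(ltW uA)//; move: alpha_le beta_gt; lra.
by rewrite ler_wpM2r ?powR_ge0// lerDl mulr_ge0 ?Gbar_ge0 ?powR_ge0.
Qed.

Let powR_cancel (x s : R) (n : nat) : 0 < x -> x `^ s * x `^ (n%:R - s) = x ^+ n.
Proof.
by move=> x0; rewrite -powRD ?(gt_eqF x0) ?implybT// addrC subrK powR_mulrn// ltW.
Qed.

(** The absolute value makes the integrand nonnegative on the whole line, as the lemmas on
    [tail_int] require; it is harmless on [x, oo) with x > 0. *)
Definition first_moment_tail : R -> R := tail_int (fun u => `|u| * G u).
Local Notation M := first_moment_tail.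

(** Integrate Potter's bounds. As e tends to 0 they bound M x / GI x by x (beta - 1) / (beta - 2) up
    to a factor tending to 1, which is where the mean excess b / (beta - 2) comes from. The
    condition e < beta - 2 keeps u^(1 - beta + e) integrable. *)
Lemma karamata_bounds (e : R) : 0 < e -> e < beta - 2 -> exists2 A : R, 0 < A &
  forall x : R, A <= x ->
  [/\ GI x <= G x * x / (beta - e - 1), G x * x / (beta + e - 1) <= GI x,
      (\int[leb]_(u in `[x, +oo[) (`|u| * G u)%:E < +oo)%E &
      M x <= G x * x ^+ 2 / (beta - e - 2)].
Proof.
move=> e0 eb; have [A A0 h] := Gbar_potter e0.
exists A => // x Ax; have x0 : 0 < x by exact: lt_le_trans Ax.
have Gx := Gbar_gt0 x0.
have Goo := GbarI_lty x0.
have mG := measurable_Gbar.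
have GIE : (GI x)%:E = (\int[leb]_(u in `[x, +oo[) (G u)%:E)%E.
  exact: (tail_intE Gbar_ge0 mG Goo).
have mUG : measurable_fun setT (fun u : R => `|u| * G u).
  by apply: measurable_funM => //; exact: measurableT_comp.
have UG0 (u : R) : 0 <= `|u| * G u by rewrite mulr_ge0 ?Gbar_ge0.
have Moo : (\int[leb]_(u in `[x, +oo[) (`|u| * G u)%:E <=
    (G x * x ^+ 2 / (beta - e - 2))%:E)%E.
  have -> : G x * x ^+ 2 / (beta - e - 2) =
      G x * x `^ (beta - e) * (x `^ (1 - (beta - e - 1)) / (beta - e - 1 - 1)).
    rewrite -(powR_cancel (beta - e) 2 x0) !mulrA; congr (_ * _ `^ _ / _); ring.
  apply: integral_tail_le => //; first by move: alpha_le beta_gt; lra.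
    by rewrite mulr_ge0 ?powR_ge0 ?Gbar_ge0.
  move=> u xu; have u0 : 0 < u by exact: lt_le_trans xu.
  rewrite gtr0_norm//; apply: le_trans (ler_wpM2l (ltW u0) (h x u Ax xu).1) _.
  rewrite mulrCA ler_wpM2l//; first by rewrite mulr_ge0 ?powR_ge0 ?Gbar_ge0.
  rewrite -[X in X * _](powRr1 (ltW u0)) -powRD ?(gt_eqF u0) ?implybT//.
  by rewrite (_ : 1 + _ = - (beta - e - 1))//; ring.
have MxE : (M x)%:E = (\int[leb]_(u in `[x, +oo[) (`|u| * G u)%:E)%E.
  by apply: (tail_intE UG0 mUG (b := x)) => //; exact: le_lt_trans Moo (ltry _).
split.
- rewrite -lee_fin GIE.
  have -> : G x * x / (beta - e - 1) =
      G x * x `^ (beta - e) * (x `^ (1 - (beta - e)) / (beta - e - 1)).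
    by rewrite -{2}(expr1 x) -(powR_cancel (beta - e) 1 x0) !mulrA.
  apply: integral_tail_le => //; first exact: Gbar_ge0.
  + by move: alpha_le beta_gt; lra.
  + by rewrite mulr_ge0 ?powR_ge0 ?Gbar_ge0.
  + by move=> u xu; exact: (h x u Ax xu).1.
- rewrite -lee_fin GIE.
  have -> : G x * x / (beta + e - 1) =
      G x * x `^ (beta + e) * (x `^ (1 - (beta + e)) / (beta + e - 1)).
    by rewrite -{2}(expr1 x) -(powR_cancel (beta + e) 1 x0) !mulrA.
  apply: integral_tail_ge => //.
  + by move: alpha_le beta_gt; lra.
  + by rewrite mulr_ge0 ?powR_ge0 ?Gbar_ge0.
  + by move=> u xu; exact: (h x u Ax xu).2.
- exact: le_lt_trans Moo (ltry _).
- by rewrite -lee_fin MxE.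
Qed.

End karamata.

(** * The randomization weights *)

Section block_lengths.
Variable r : nat.
Hypothesis r1 : (1 < r)%N.

Lemma blk_double k : (1 <= k)%N -> (2 * blk r k.-1 <= blk r k)%N.
Proof.
case: k => [//|[|k]] _; first by rewrite muln0.
by rewrite /= (expnS r k.+1) leq_mul2r r1 orbT.
Qed.

(** The additive r is for k = 1, where n_0 = 0 while n_1 = r. *)
Lemma blk_le k : (1 <= k)%N -> (blk r k <= r * blk r k.-1 + r)%N.
Proof.
case: k => [//|[|k]] _; first by rewrite /= muln0 expn1.
by rewrite /= (expnS r k.+1) leq_addr.
Qed.

Lemma leq_blk_id k : (k <= blk r k)%N.
Proof. by case: k => // k; rewrite /= ltnW// ltn_expl. Qed.

End block_lengths.

Section mixture_weights.
Context {R : realType}.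
Variables (F : probability R R) (alpha beta : R) (L : R -> R).
Hypothesis slowL : slowly_varying L.
Hypothesis tailE : forall x, 0 < x -> tail F x = x `^ (- alpha) * L x.
Hypothesis smoothL : assumption2 L.
Hypotheses (alpha_le : alpha <= 2) (beta_gt : 2 < beta).
Variables (mu : R) (r : nat).
Hypotheses (mu0 : 0 < mu) (r1 : (1 < r)%N).

Local Notation G := (Gbar F alpha beta).
Local Notation GI := (GbarI F alpha beta).
Local Notation M := (first_moment_tail F alpha beta).
Local Notation n_ := (blk r).
Let a (b : R) k : R := b + (n_ k)%:R * mu.
Let p (b : R) := pK F mu r b alpha beta.

Let mG : measurable_fun setT G. Proof. exact: measurable_Gbar. Qed.
Let Goo (b : R) : 0 < b -> (\int[lebesgue_measure]_(u in `[b, +oo[) (G u)%:E < +oo)%E.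
Proof. exact: (GbarI_lty slowL tailE smoothL alpha_le beta_gt). Qed.

Lemma GbarI_diff_ge (x y : R) : 0 < x -> x <= y -> G y * (y - x) <= GI x - GI y.
Proof.
move=> x0 xy.
apply: (tail_int_diff_ge (@Gbar_ge0 _ F alpha beta) mG (Goo x0) (lexx x) xy).
  exact: Gbar_ge0.
move=> u xu uy; apply: (Gbar_nincr F alpha_le beta_gt _ (ltW uy)).
exact: lt_le_trans xu.
Qed.

Lemma GbarI_gt0 (b : R) : 0 < b -> 0 < GI b.
Proof.
move=> b0; have b1 : b <= b + 1 by rewrite lerDl.
have := GbarI_diff_ge b0 b1.
have : 0 <= GI (b + 1) by apply: tail_int_ge0 => u; exact: Gbar_ge0.
have : 0 < G (b + 1) by apply: (Gbar_gt0 beta slowL tailE); rewrite addr_gt0.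
by move=> ? ? ?; lra.
Qed.

Lemma GbarI_ge0 (b : R) : 0 <= GI b.
Proof. by apply: tail_int_ge0 => u; exact: Gbar_ge0. Qed.

Lemma GbarI_nincr (x y : R) : 0 < x -> x <= y -> GI y <= GI x.
Proof.
move=> x0 xy; rewrite -subr_ge0; apply: le_trans (GbarI_diff_ge x0 xy).
by rewrite mulr_ge0 ?subr_ge0 ?Gbar_ge0.
Qed.

(** This limit gives total mass one to the telescoping weights. *)
Lemma GbarI_cvg0 : GI x @[x --> +oo] --> (0 : R).
Proof.
have [A A0 h] := Gbar_potter beta slowL tailE smoothL (divr_gt0 ltr01 (ltr0Sn R 1)).
pose s := beta - 1 / 2; have s1 : 1 < s by rewrite /s; move: beta_gt; lra.
pose C := G A * A `^ s / (s - 1).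
have C0 : 0 <= C.
  by rewrite /C divr_ge0 ?subr_ge0 ?(ltW s1)// mulr_ge0 ?Gbar_ge0 ?powR_ge0.
have hC x : A <= x -> GI x <= C * x `^ (- (s - 1)).
  move=> Ax; have x0 : 0 < x by exact: lt_le_trans Ax.
  rewrite -lee_fin.
  have -> : (GI x)%:E = (\int[lebesgue_measure]_(u in `[x, +oo[) (G u)%:E)%E.
    exact: (tail_intE (@Gbar_ge0 _ F alpha beta) mG (Goo x0) (lexx x)).
  have -> : C * x `^ (- (s - 1)) = G A * A `^ s * (x `^ (1 - s) / (s - 1)).
    by rewrite opprB /C mulrAC -!mulrA.
  apply: integral_tail_le => //; first exact: Gbar_ge0.
    by rewrite mulr_ge0 ?powR_ge0 ?Gbar_ge0.
  by move=> u xu; apply: (h A u (lexx _) (le_trans Ax xu)).1.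
apply: (@squeeze_cvgr _ _ _ _ (cst 0) (fun x => C * x `^ (- (s - 1)))).
- by near=> x; rewrite GbarI_ge0/= hC//; near: x; exact: nbhs_pinfty_ge.
- exact: cvg_cst.
- rewrite -[X in _ --> X](mulr0 C); apply: cvgM; first exact: cvg_cst.
  by apply: cvg_powRN_pinfty; rewrite subr_gt0.
Unshelve. all: by end_near. Qed.

Let a_gt0 b k : 0 < b -> 0 < a b k.
Proof. by move=> b0; rewrite ltr_pwDl// mulr_ge0// ltW. Qed.

Let pE b k : p b k = (GI (a b k.-1) - GI (a b k)) / GI b. Proof. by []. Qed.

Let a0 b : a b 0 = b. Proof. by rewrite /a mul0r addr0. Qed.

Let a_lt b k : (1 <= k)%N -> a b k.-1 < a b k.
Proof.
move=> k1; rewrite ltrD2l ltr_pM2r// ltr_nat.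
have := blk_double r1 k1; have := leq_blk_id r1 k; lia.
Qed.

Let a_cvg b : 0 < b -> GI (a b n) @[n --> \oo] --> (0 : R).
Proof.
move=> b0; apply: (cvg_comp _ _ _ GbarI_cvg0).
apply/cvgryPge => C; near=> n.
have : C / mu <= n%:R by near: n; exact: nbhs_infty_ger.
rewrite ler_pdivrMr// => h; apply: (le_trans h); rewrite /a.
apply: (@le_trans _ _ ((n_ n)%:R * mu)); last by rewrite lerDr ltW.
by rewrite ler_pM2r// ler_nat leq_blk_id.
Unshelve. all: by end_near. Qed.

Lemma pK_gt0 b k : 0 < b -> (1 <= k)%N -> 0 < p b k.
Proof.
move=> b0 k1; rewrite pE divr_gt0 ?GbarI_gt0//.
apply: lt_le_trans (GbarI_diff_ge (a_gt0 k.-1 b0) (ltW (a_lt b k1))).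
by rewrite mulr_gt0 ?subr_gt0 ?a_lt// (Gbar_gt0 beta slowL tailE)// a_gt0.
Qed.

Lemma pK0 b : p b 0%N = 0. Proof. by rewrite pE subrr mul0r. Qed.

Lemma telescope_from1 (f : nat -> R) n :
  \sum_(1 <= k < n.+1) (f k.-1 - f k) = f 0%N - f n.
Proof.
elim: n => [|n IH]; first by rewrite big_geq// subrr.
by rewrite big_nat_recr//= IH; ring.
Qed.

Lemma sum_pK b : 0 < b -> (\sum_(1 <= k <oo) (p b k)%:E = 1)%E.
Proof.
move=> b0; have g0 := GbarI_gt0 b0.
apply/cvg_lim => //; rewrite -(cvg_shiftS).
rewrite (_ : (fun n => _) = (fun n => (1 - GI (a b n) / GI b)%:E)); last first.
  apply/funext => n; rewrite sumEFin; congr EFin.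
  under eq_bigr do rewrite pE.
  rewrite -mulr_suml (telescope_from1 (fun k => GI (a b k))) a0 mulrBl divff//.
  by rewrite gt_eqF.
apply: cvg_EFin; first exact: nearW.
rewrite -[X in _ --> X](subr0 1); apply: cvgB; first exact: cvg_cst.
rewrite -[X in _ --> X](mul0r (GI b)^-1); apply: cvgM; last exact: cvg_cst.
exact: a_cvg.
Qed.

(* On the k-th block u - b >= n_(k-1) mu and n_k <= r n_(k-1) + r, which
   compares the sum with the integral of u - b against Gbar. *)
Lemma mean_length_le b : 0 < b ->
  (\int[lebesgue_measure]_(u in `[b, +oo[) (`|u| * G u)%:E < +oo)%E ->
  (\sum_(1 <= k <oo) (p b k * (n_ k)%:R)%:E <=
   (r%:R / mu * (M b / GI b - b) + r%:R)%:E)%E.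
Proof.
move=> b0 Moo; have g0 := GbarI_gt0 b0.
(* The telescoped bound on the n-th partial sum, after dropping the terms in [M (a b n)] and
   [r * GI (a b n)], which only lower it; its limit is the right-hand side because [GI (a b n)]
   tends to 0. *)
pose Y n := r%:R / mu * (M b / GI b) + r%:R - (r%:R * b / mu) * (1 - GI (a b n) / GI b).
have -> : r%:R / mu * (M b / GI b - b) + r%:R =
  r%:R / mu * (M b / GI b) + r%:R - (r%:R * b / mu) * (1 - 0 / GI b).
  by field; rewrite !gt_eqF.
have mUG : measurable_fun setT (fun u : R => `|u| * G u).
  by apply: measurable_funM => //; exact: measurableT_comp.
have UG0 (u : R) : 0 <= `|u| * G u by rewrite mulr_ge0 ?Gbar_ge0.
have M0 x : 0 <= M x by exact: tail_int_ge0.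
have Ycvg : (Y n)%:E @[n --> \oo] --> (r%:R / mu * (M b / GI b) + r%:R -
    (r%:R * b / mu) * (1 - 0 / GI b))%:E.
  apply: cvg_EFin; first exact: nearW.
  apply: cvgB; first exact: cvg_cst.
  apply: cvgM; first exact: cvg_cst.
  apply: cvgB; first exact: cvg_cst.
  by apply: cvgM; [exact: a_cvg|exact: cvg_cst].
have step k : (1 <= k)%N ->
    (n_ k)%:R * (GI (a b k.-1) - GI (a b k)) <=
    r%:R / mu * (M (a b k.-1) - M (a b k)) +
    (r%:R - r%:R * b / mu) * (GI (a b k.-1) - GI (a b k)).
  move=> k1; have ak := ltW (a_lt b k1).
  have bak : b <= a b k.-1 by rewrite lerDl mulr_ge0// ltW.
  have h := tail_int_diff_le (@Gbar_ge0 _ F alpha beta) mG (ltW (a_gt0 k.-1 b0))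
    UG0 mUG (Goo b0) Moo bak ak.
  have {}h : a b k.-1 * (GI (a b k.-1) - GI (a b k)) <= M (a b k.-1) - M (a b k).
    by apply: h => u au; rewrite ler_wpM2r ?Gbar_ge0// (le_trans au)// ler_norm.
  have d0 : 0 <= GI (a b k.-1) - GI (a b k).
    by rewrite subr_ge0 GbarI_nincr// a_gt0.
  have nk : (n_ k)%:R <= r%:R * (n_ k.-1)%:R + r%:R :> R.
    by rewrite -natrM -natrD ler_nat blk_le.
  apply: (@le_trans _ _ ((r%:R * (n_ k.-1)%:R + r%:R) *
    (GI (a b k.-1) - GI (a b k)))); first exact: ler_wpM2r.
  (* Expressed through the left end of the block, which is at most u under the integral defining
     [M]. *)
  have -> : r%:R * (n_ k.-1)%:R + r%:R = r%:R / mu * a b k.-1 + (r%:R - r%:R * b / mu).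
    by rewrite /a; field; rewrite gt_eqF.
  by rewrite mulrDl lerD2r -(mulrA (r%:R / mu)) ler_wpM2l// divr_ge0// ltW.
have pn0 k : 0 <= p b k * (n_ k)%:R.
  rewrite mulr_ge0//; case: k => [|k]; first by rewrite pK0.
  by rewrite ltW// pK_gt0.
have partial n : (\sum_(1 <= k < n.+1) p b k * (n_ k)%:R <= Y n).
  rewrite /Y; apply: (@le_trans _ _ (\sum_(1 <= k < n.+1)
    (r%:R / mu * (M (a b k.-1) - M (a b k)) +
    (r%:R - r%:R * b / mu) * (GI (a b k.-1) - GI (a b k))) / GI b)).
    rewrite !big_nat; apply: ler_sum => k /andP[k1 _].
    by rewrite pE mulrC mulrA ler_pM2r ?invr_gt0// step.
  rewrite -mulr_suml big_split/= -!mulr_sumr.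
  rewrite (telescope_from1 (fun k => GI (a b k))) (telescope_from1 (fun k => M (a b k))) a0.
  rewrite ler_pdivrMr//.
  have -> : (r%:R / mu * (M b / GI b) + r%:R - r%:R * b / mu * (1 - GI (a b n) / GI b)) * GI b =
    r%:R / mu * M b + r%:R * GI b - r%:R * b / mu * (GI b - GI (a b n)).
    by field; rewrite !gt_eqF.
  have := mulr_ge0 (divr_ge0 (ler0n R r) (ltW mu0)) (M0 (a b n)).
  have := mulr_ge0 (ler0n R r) (GbarI_ge0 (a b n)).
  by move=> h1 h2; lra.
apply: lime_le.
  by apply: is_cvg_nneseries => k k1 _; rewrite lee_fin.
apply: nearW => n; rewrite -(cvg_lim _ Ycvg)//; apply: lime_ge.
  by apply/cvg_ex; eexists; exact: Ycvg.
near=> m; rewrite sumEFin lee_fin; apply: le_trans (partial m).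
have nm : (n <= m.+1)%N by rewrite leqW//; near: m; exact: nbhs_infty_ge.
have [n0|n0] := posnP n; first by rewrite n0 [leLHS]big_geq// sumr_ge0.
by rewrite [leRHS](big_cat_nat _ (n := n))//= lerDl sumr_ge0.
Unshelve. all: by end_near. Qed.

Let Moo (b : R) := (\int[lebesgue_measure]_(u in `[b, +oo[) (`|u| * G u)%:E < +oo)%E.

Lemma mean_length_asymptotics : exists2 eps : R -> R,
  eps b @[b --> +oo] --> (0 : R) &
  \forall b \near +oo, (\sum_(1 <= k <oo) (p b k * (n_ k)%:R)%:E <=
    ((r%:R + eps b) / (mu * (beta - 2)) * b)%:E)%E.
Proof.
pose D := beta - 2; have D0 : 0 < D by rewrite subr_gt0.
pose Y b := r%:R / mu * (M b / GI b - b) + r%:R.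
(* The required inequality solved for eps and cut at 0: the bound then holds by construction, and
   for the convergence an upper bound on [Y b * (mu * D) / b] suffices. *)
pose eps b := Num.max 0 (Y b * (mu * D) / b - r%:R).
have r0 : 0 < r%:R :> R by rewrite ltr0n ltnW.
exists eps.
  apply/cvgr0Pnorm_lt => d d0; apply/near_pinfty_exP.
  (* The solution of r D (1 + 2 e) = (r + d / 2) (D - e): the main term of the ratio then exceeds r
     by d / 2 at most. The other half of d absorbs r mu D / b for large b. *)
  pose e := (d * D / 2) / (2 * r%:R * D + r%:R + d / 2).
  have den0 : 0 < 2 * r%:R * D + r%:R + d / 2.
    by rewrite !addr_gt0 ?mulr_gt0 ?divr_gt0.
  have e0 : 0 < e by rewrite divr_gt0 ?mulr_gt0.
  have ee : e * (2 * r%:R * D + r%:R + d / 2) = d * D / 2.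
    by rewrite /e divfK// gt_eqF.
  have eD : e < D.
    rewrite /e ltr_pdivrMr//; have := mulr_gt0 r0 D0; have := mulr_gt0 D0 D0.
    have := mulr_gt0 (mulr_gt0 r0 D0) D0; have := mulr_gt0 d0 D0.
    by move=> *; nra.
  have [A A0 h] := karamata_bounds slowL tailE smoothL alpha_le beta_gt e0 eD.
  pose B := Num.max A (2 * r%:R * mu * D / d + 1).
  have B0 : 0 < B by rewrite lt_max A0.
  exists B => // b; rewrite ge_max => /andP[Ab Bb].
  have b0 : 0 < b by exact: lt_le_trans Ab.
  have [_ h2 _ h3] := h b Ab.
  have Gb := Gbar_gt0 beta slowL tailE b0; have g0 := GbarI_gt0 b0.
  have De : 0 < D - e by rewrite subr_gt0.
  have D1 : 0 < D + 1 + e by rewrite ltr_wpDr ?(ltW e0)// ltr_wpDr.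
  have MG : M b / GI b <= b * (D + 1 + e) / (D - e).
    rewrite ler_pdivrMr//; apply: (le_trans h3).
    apply: (@le_trans _ _ (b * (D + 1 + e) / (D - e) * (G b * b / (beta + e - 1)))); last first.
      by rewrite ler_wpM2l// ltW// divr_gt0// mulr_gt0.
    rewrite le_eqVlt; apply/orP; left; apply/eqP.
    have -> : beta + e - 1 = D + 1 + e by rewrite /D; ring.
    have -> : beta - e - 2 = D - e by rewrite /D; ring.
    by field; rewrite !gt_eqF.
  have Yb : Y b * (mu * D) / b <= r%:R * D * (1 + 2 * e) / (D - e) + r%:R * mu * D / b.
    rewrite /Y ler_pdivrMr//.
    apply: (@le_trans _ _ ((r%:R / mu * (b * (D + 1 + e) / (D - e) - b) + r%:R) * (mu * D))).
      rewrite ler_wpM2r ?mulr_ge0 ?(ltW mu0) ?(ltW D0)// lerD2r ler_wpM2l ?lerD2r//.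
      by rewrite divr_ge0// ltW.
    rewrite le_eqVlt; apply/orP; left; apply/eqP.
    by field; rewrite !gt_eqF.
  have Y1 : r%:R * D * (1 + 2 * e) / (D - e) <= r%:R + d / 2.
    rewrite ler_pdivrMr//; move: ee; lra.
  have Y2 : r%:R * mu * D / b < d / 2.
    rewrite ltr_pdivrMr//.
    have : 2 * r%:R * mu * D / d < b by rewrite (lt_le_trans _ Bb)// ltrDl.
    by rewrite ltr_pdivrMr// => ?; lra.
  rewrite /eps ger0_norm ?le_max ?lexx// gt_max d0 /=; lra.
have e0 : 0 < D / 2 by rewrite divr_gt0.
have eD : D / 2 < beta - 2 by rewrite -/D; lra.
have [A A0 h] := karamata_bounds slowL tailE smoothL alpha_le beta_gt e0 eD.
apply/near_pinfty_exP; exists A => // b Ab; have b0 : 0 < b by exact: lt_le_trans Ab.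
have [_ _ Mb _] := h b Ab.
apply: (le_trans (mean_length_le b0 Mb)); rewrite lee_fin -/(Y b) -/D.
have muD : 0 < mu * D by rewrite mulr_gt0.
rewrite mulrAC ler_pdivlMr// -ler_pdivrMr// -lerBlDl /eps le_max lexx orbT//.
Qed.

(** The left-hand side is a left Riemann sum for the integral of u^(-1-de) over [c, c'], which
    equals (c^(-de) - c'^(-de)) / de; since u <= rho c there, freezing u at c costs at most
    rho^(1+de). The proof uses 1 + y <= exp y in place of the integral. *)
Lemma powR_increment_le (rho de c c' : R) : 0 < de -> 0 < c -> c <= c' -> c' <= rho * c ->
  (c' - c) * c `^ (- (1 + de)) <= rho `^ (1 + de) / de * (c `^ (- de) - c' `^ (- de)).
Proof.
move=> de0 c0 cc' c'rho; have c'0 : 0 < c' by exact: lt_le_trans cc'.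
have rho0 : 0 < rho by rewrite -(pmulr_lgt0 _ c0) (lt_le_trans c'0).
have ln_ge : 1 - c / c' <= ln (c' / c).
  have := expR_ge1Dx (ln (c / c')).
  rewrite lnK ?posrE ?divr_gt0//.
  have -> : ln (c' / c) = - ln (c / c').
    by rewrite -lnV ?posrE ?divr_gt0// invf_div.
  by move=> ?; lra.
have pow_ge : 1 + de * (1 - c / c') <= (c' / c) `^ de.
  rewrite /powR gt_eqF ?divr_gt0//; apply: le_trans (expR_ge1Dx _).
  by rewrite lerD2l ler_wpM2l// ltW.
have diff_ge : de * (c' - c) * c' `^ (- (1 + de)) <= c `^ (- de) - c' `^ (- de).
  have -> : c `^ (- de) = c' `^ (- de) * (c' / c) `^ de.
    rewrite powR_divf// mulrA -powRD ?(gt_eqF c'0) ?implybT//.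
    by rewrite addNr powRr0 mul1r powRN.
  have -> : c' `^ (- (1 + de)) = c' `^ (- de) / c'.
    rewrite -[X in _ / X](powRr1 (ltW c'0)) -powRN -powRD ?(gt_eqF c'0) ?implybT//.
    by congr (_ `^ _); ring.
  rewrite [leRHS](_ : _ = c' `^ (- de) * ((c' / c) `^ de - 1)); last by rewrite mulrBr mulr1.
  rewrite mulrCA ler_wpM2l ?powR_ge0//.
  have -> : de * (c' - c) / c' = de * (1 - c / c') by field; rewrite gt_eqF.
  by rewrite lerBrDl.
rewrite mulrAC ler_pdivlMr//.
apply: le_trans (ler_wpM2l (powR_ge0 rho _) diff_ge).
have pw : c `^ (- (1 + de)) <= rho `^ (1 + de) * c' `^ (- (1 + de)).
  rewrite !powRN ler_pdivlMr ?powR_gt0// mulrC ler_pdivrMr ?powR_gt0//.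
  rewrite -powRM ?(ltW rho0) ?(ltW c0)//.
  rewrite ge0_ler_powR ?nnegrE ?(ltW c'0)//; last by rewrite mulr_ge0 ?ltW.
  by rewrite addr_ge0// ltW.
rewrite [leRHS](_ : _ = de * (c' - c) * (rho `^ (1 + de) * c' `^ (- (1 + de)))); last by ring.
rewrite [leLHS](_ : _ = de * (c' - c) * c `^ (- (1 + de))); last by ring.
by rewrite ler_wpM2l// mulr_ge0 ?subr_ge0// ltW.
Qed.

(* Each term is at most a constant times the decrease of u^-de over the k-th
   block, so that the series telescopes; beta < 2 alpha - 1 makes de > 0. *)
Lemma squared_weights_series : beta < 2 * alpha - 1 ->
  exists K : R, exists2 A : R, 0 < A & forall b : R, A <= b ->
    (\sum_(1 <= k <oo) (((n_ k)%:R * tail F (a b k.-1)) ^+ 2 / p b k)%:E <=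
     (K * (b * tail F b) ^+ 2)%:E)%E.
Proof.
move=> beta_lt.
(* Half of the margin 2 alpha - 1 - beta: Potter's bound costs c^de, and the exponent (de - alpha) +
   (beta - alpha) = -(1 + de) remains below -1. *)
pose de := (2 * alpha - beta - 1) / 2; have de0 : 0 < de by rewrite divr_gt0//; lra.
(* Bounds the ratio of consecutive block ends: n_k <= r n_(k-1) + r, and r mu <= r b once b >=
   mu. *)
pose rho : R := r%:R + 1; have rho0 : 0 < rho by rewrite ltr_wpDl.
have [A1 A10 h1] := tail_potter slowL tailE smoothL de0.
have [A2 A20 h2] := Gbar_potter beta slowL tailE smoothL ltr01.
have e0 : 0 < (beta - 2) / 2 by rewrite divr_gt0// subr_gt0.
have eb : (beta - 2) / 2 < beta - 2 by rewrite ltr_pdivrMr// ltr_pMr ?subr_gt0//; lra.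
have [A3 A30 h3] := karamata_bounds slowL tailE smoothL alpha_le beta_gt e0 eb.
(* Lower bound for the ratio of [G] at the two ends of a block, by Potter's bound with loss 1. *)
pose kap := rho `^ (- (beta + 1)); have kap0 : 0 < kap by rewrite powR_gt0.
pose K1 := (2 / (kap * mu)) * (2 / mu) * (rho `^ (1 + de) / de).
have K10 : 0 <= K1.
  apply: mulr_ge0; first apply: mulr_ge0; apply: divr_ge0; rewrite ?powR_ge0 ?(ltW mu0) ?(ltW de0)//.
  by rewrite mulr_ge0 ?(ltW mu0) ?(ltW kap0).
pose K2 := (beta - (beta - 2) / 2 - 1)^-1.
exists (K1 * K2); exists (Num.max mu (Num.max A1 (Num.max A2 A3))); first by rewrite lt_max mu0.
move=> b; rewrite !ge_max => /andP[mub /andP[A1b /andP[A2b A3b]]].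
have b0 : 0 < b by exact: lt_le_trans mub.
have g0 := GbarI_gt0 b0.
pose w k := a b k `^ (- de).
have step k : (1 <= k)%N -> ((n_ k)%:R * tail F (a b k.-1)) ^+ 2 / p b k <=
    K1 * GI b * (tail F b * b `^ (alpha - de)) * (w k.-1 - w k).
  move=> k1; set c := a b k.-1; set c' := a b k.
  have c0 : 0 < c := a_gt0 k.-1 b0; have c'0 : 0 < c' := a_gt0 k b0.
  have cc' : c <= c' := ltW (a_lt b k1).
  have bc : b <= c by rewrite lerDl mulr_ge0// ltW.
  have c'rho : c' <= rho * c.
    rewrite /c' /c /rho /a.
    have : (n_ k)%:R <= r%:R * (n_ k.-1)%:R + r%:R :> R.
      by rewrite -natrM -natrD ler_nat blk_le.
    move=> /(ler_wpM2r (ltW mu0)) nk.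
    have : r%:R * mu <= r%:R * b by rewrite ler_wpM2l.
    have : 0 <= (n_ k.-1)%:R * mu by rewrite mulr_ge0// ltW.
    by move: nk; rewrite !mulrDl !mulrDr mulrA; lra.
  set n := (n_ k)%:R : R; have n0 : 0 < n.
    by rewrite ltr0n (leq_trans k1) ?leq_blk_id.
  have dn : n * mu / 2 <= c' - c.
    have : 2 * (n_ k.-1)%:R <= n by rewrite -natrM ler_nat blk_double.
    move=> /(ler_wpM2r (ltW mu0)) hn; rewrite /c' /c /a -/n; lra.
  have tc := tail_ge0 F c; have Gc := Gbar_gt0 beta slowL tailE c0.
  have Gc' : kap * G c <= G c'.
    have := (h2 c c' (le_trans A2b bc) cc').2; apply: le_trans.
    rewrite mulrC -mulrA ler_wpM2l ?Gbar_ge0//.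
    have : kap * c `^ (- (beta + 1)) <= c' `^ (- (beta + 1)).
      rewrite /kap !powRN -invfM lef_pV2 ?posrE ?mulr_gt0 ?powR_gt0//.
      rewrite -powRM ?(ltW rho0) ?(ltW c0)//.
      rewrite ge0_ler_powR ?nnegrE ?(ltW c'0) ?mulr_ge0 ?(ltW rho0) ?(ltW c0)//.
      by move: beta_gt; lra.
    rewrite powRN ler_pdivrMr ?powR_gt0// => /le_trans; apply.
    by rewrite mulrC.
  (* [G] decreases, so its integral over the block is at least the length times the value at the
     right end; the length is at least n mu / 2 because the n_k at least double. *)
  have pk : kap * G c * (n * mu / 2) / GI b <= p b k.
    rewrite pE ler_pM2r ?invr_gt0//.
    apply: le_trans (GbarI_diff_ge c0 cc').
    apply: ler_pM => //; first by rewrite mulr_ge0 ?(ltW kap0) ?(ltW Gc).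
    by rewrite divr_ge0// mulr_ge0 ?(ltW n0) ?(ltW mu0).
  have tpot : tail F c * c `^ (beta - alpha) <=
      tail F b * b `^ (alpha - de) * c `^ (- (1 + de)).
    apply: le_trans (ler_wpM2r (powR_ge0 _ _) (h1 b c A1b bc).1) _.
    rewrite -!mulrA ler_wpM2l ?tail_ge0// powR_divf//.
    have -> : c `^ (- (1 + de)) = c `^ (de - alpha) * c `^ (beta - alpha).
      rewrite -powRD ?(gt_eqF c0) ?implybT//; congr (_ `^ _).
      by rewrite /de; field.
    rewrite -(opprB de alpha) (powRN b) le_eqVlt; apply/orP; left; apply/eqP.
    by field; rewrite gt_eqF ?powR_gt0.
  have inc := powR_increment_le de0 c0 cc' c'rho.
  have nw : n * c `^ (- (1 + de)) <= (2 / mu) * (rho `^ (1 + de) / de) * (w k.-1 - w k).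
    rewrite -mulrA; apply: (@le_trans _ _ ((2 / mu) * ((c' - c) * c `^ (- (1 + de))))).
      rewrite mulrA ler_wpM2r ?powR_ge0//.
      rewrite mulrAC ler_pdivlMr// mulrC; lra.
    by apply: ler_wpM2l; [rewrite divr_ge0// ltW|exact: inc].
  have pk0 : 0 < kap * G c * (n * mu / 2) / GI b.
    apply: divr_gt0 => //; apply: mulr_gt0; first exact: mulr_gt0.
    by apply: divr_gt0 => //; exact: mulr_gt0.
  apply: (@le_trans _ _ ((n * tail F c) ^+ 2 / (kap * G c * (n * mu / 2) / GI b))).
    by rewrite ler_wpM2l ?sqr_ge0// lef_pV2 ?posrE// (lt_le_trans pk0).
  have -> : (n * tail F c) ^+ 2 / (kap * G c * (n * mu / 2) / GI b) =
      (2 / (kap * mu)) * GI b * (n * (tail F c * c `^ (beta - alpha))).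
    have tc0 : 0 < tail F c := tail_gt0 slowL tailE c.
    have cb0 : 0 < c `^ (beta - alpha) by rewrite powR_gt0.
    by rewrite /Gbar; field; rewrite !gt_eqF.
  apply: (@le_trans _ _ ((2 / (kap * mu)) * GI b *
     (tail F b * b `^ (alpha - de) * (n * c `^ (- (1 + de)))))).
    rewrite ler_wpM2l//; first by rewrite mulr_ge0 ?divr_ge0 ?mulr_ge0 ?ltW.
    by rewrite [leRHS]mulrCA; apply: ler_wpM2l => //; exact: ltW.
  rewrite [leRHS](_ : _ = (2 / (kap * mu)) * GI b * (tail F b * b `^ (alpha - de) *
    ((2 / mu) * (rho `^ (1 + de) / de) * (w k.-1 - w k)))); last first.
    by rewrite /K1; ring.
  rewrite ler_wpM2l//; first by rewrite mulr_ge0 ?divr_ge0 ?mulr_ge0 ?ltW.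
  by rewrite ler_wpM2l// mulr_ge0 ?powR_ge0 ?tail_ge0.
have term0 k : 0 <= ((n_ k)%:R * tail F (a b k.-1)) ^+ 2 / p b k.
  rewrite divr_ge0 ?sqr_ge0//; case: k => [|k]; first by rewrite pK0.
  by rewrite ltW// pK_gt0.
apply: lime_le.
  by apply: is_cvg_nneseries => k k1 _; rewrite lee_fin.
apply: nearW => -[|n].
  rewrite big_geq// lee_fin mulr_ge0 ?sqr_ge0// mulr_ge0// invr_ge0.
  by move: beta_gt; lra.
rewrite sumEFin lee_fin.
apply: (@le_trans _ _ (\sum_(1 <= k < n.+1)
    (K1 * GI b * (tail F b * b `^ (alpha - de)) * (w k.-1 - w k)))).
  by rewrite !big_nat; apply: ler_sum => k /andP[k1 _]; exact: step.
rewrite -mulr_sumr (telescope_from1 w).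
have [GIb _ _ _] := h3 b A3b.
apply: (@le_trans _ _ (K1 * (G b * b * K2) * (tail F b * b `^ (alpha - de)) * b `^ (- de))).
  have tb := tail_ge0 F b.
  apply: ler_pM.
  - apply: mulr_ge0; first by apply: mulr_ge0 => //; exact: GbarI_ge0.
    by rewrite mulr_ge0 ?powR_ge0.
  - rewrite subr_ge0 /w a0 !powRN lef_pV2 ?posrE ?powR_gt0 ?a_gt0//.
    rewrite ge0_ler_powR ?nnegrE ?(ltW de0) ?(ltW b0) ?(ltW (a_gt0 n b0))//.
    by rewrite lerDl mulr_ge0// ltW.
  - apply: ler_wpM2r; first by rewrite mulr_ge0 ?powR_ge0.
    exact: ler_wpM2l.
  - by rewrite /w a0 gerDl oppr_le0 powR_ge0.
rewrite le_eqVlt; apply/orP; left; apply/eqP.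
rewrite GbarE.
have e2 : b `^ (alpha - beta) * b * b `^ (alpha - de) * b `^ (- de) = b ^+ 2.
  rewrite -[X in _ * X * _ * _](powRr1 (ltW b0)) -!powRD ?(gt_eqF b0) ?implybT//.
  rewrite -powR_mulrn ?(ltW b0)//; congr (_ `^ _).
  by rewrite /de; field.
by rewrite exprMn -e2; ring.
Qed.

End mixture_weights.

(** * Lower bound on the passage probability *)

Section ruin_lower_bound.
Context d (T : measurableType d) {R : realType} (P : probability T R)
  (X : nat -> {RV P >-> R}).
Hypothesis iidX : iid X.
Let F : probability R R := distribution P (X 0%N).
Hypothesis intX : P.-integrable setT (EFin \o X 0%N).
Variables (alpha : R) (L : R -> R) (mu : R).
Hypothesis slowL : slowly_varying L.
Hypothesis tailE : forall x, 0 < x -> tail F x = x `^ (- alpha) * L x.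
Hypothesis smoothL : assumption2 L.
Hypothesis mu0 : 0 < mu.

Lemma tau_lty_above (b : R) x : (tau mu b x < +oo)%E <-> exists m, above mu b x m.
Proof.
split; first by move=> /tau_lty_ex[m /andP[am _]]; exists m.
by move=> [m /ex_first_hit[n _ /tau_first_hit ->]]; rewrite ltry.
Qed.

Lemma measurable_passage (b : R) :
  measurable [set w | (tau mu b (X ^~ w) < +oo)%E].
Proof.
rewrite (_ : [set w | _] = \bigcup_m [set w | above mu b (X ^~ w) m]).
  apply: bigcup_measurable => m _; rewrite -[[set _ | _]]setTI.
  have mXs : measurable_fun setT (fun w => (X ^~ w : nat -> R) : seq_space m).
    apply: (measurable_seq_of (V := fun i w => X i w)) => i _; exact: measurable_funP.
  have mf := measurableT_comp (measurable_above mu b (leqnn m)) mXs.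
  exact: (mf measurableT [set true]).
apply/seteqP; split => w /=; first by move=> /tau_lty_above[m hm]; exists m.
by move=> [m _ hm]; apply/tau_lty_above; exists m.
Qed.

Let jump (b x : R) : R := (3 * b < x)%R%:R.

(* If the n-th jump is the first one above 3b and b is not passed at time n,
   then the earlier increments add up to at most -b, as n mu <= b. *)
Lemma jump_count_le (b : R) (x : nat -> R) N : 0 < b -> N%:R * mu <= b ->
  \sum_(1 <= n < N.+1) jump b (x n) <=
  \1_[set y | (tau mu b y < +oo)%E] x +
  \sum_(1 <= n < N.+1) \sum_(1 <= i < n) jump b (x n) * (`|x i| / b + jump b (x i)).
Proof.
move=> b0 Nb; have j0 z : 0 <= jump b z by [].
have t0 i : 0 <= `|x i| / b + jump b (x i) by rewrite addr_ge0// divr_ge0// ltW.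
have in0 n : 0 <= \sum_(1 <= i < n) jump b (x n) * (`|x i| / b + jump b (x i)).
  by rewrite sumr_ge0// => i _; rewrite mulr_ge0.
have T0 : 0 <= \1_[set y | (tau mu b y < +oo)%E] x :> R by [].
elim: N Nb => [|N IH] Nb; first by rewrite !big_geq// addr0.
rewrite big_nat_recr//= [X in _ <= _ + X]big_nat_recr//=.
have {}IH : \sum_(1 <= n < N.+1) jump b (x n) <=
  \1_[set y | (tau mu b y < +oo)%E] x +
  \sum_(1 <= n < N.+1) \sum_(1 <= i < n) jump b (x n) * (`|x i| / b + jump b (x i)).
  by apply: IH; rewrite (le_trans _ Nb)// ler_pM2r// ler_nat.
have [xN|xN] := ltP (3 * b) (x N.+1); last first.
  have jN0 : jump b (x N.+1) = 0 by rewrite /jump ltNge xN.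
  rewrite {1}jN0 addr0 addrA; apply: (le_trans IH); rewrite lerDl; exact: in0.
have jN : jump b (x N.+1) = 1 by rewrite /jump xN.
(* When an earlier increment also exceeds 3b, the summand [jump b (x m)] of the correction pays for
   the new jump; this is why the correction contains it. *)
have [/hasP[m]|/hasPn no] := boolP (has (fun m => 3 * b < x m) (index_iota 1 N.+1)).
  move=> mN xm; rewrite addrA lerD// jN (bigD1_seq m) ?iota_uniq//=.
  have j1 : 1 <= `|x m| / b + jump b (x m).
    by rewrite /jump xm lerDr divr_ge0// ltW.
  rewrite mul1r; apply: (le_trans j1); rewrite lerDl.
  by rewrite sumr_ge0// => i _; rewrite mul1r.
rewrite big_nat big1 ?add0r => [|n /andP[n1 nN]]; last first.
  by rewrite /jump; have := no n; rewrite mem_index_iota n1 nN => /(_ isT)/negbTE ->.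
have S0 : 0 <= \sum_(1 <= n < N.+1) \sum_(1 <= i < n) jump b (x n) * (`|x i| / b + jump b (x i)).
  by rewrite sumr_ge0.
have [tx|tx] := pselect (tau mu b x < +oo)%E.
  by rewrite indicE mem_set// jN lerDl addr_ge0// sumr_ge0// => i _; rewrite mul1r.
rewrite indicE memNset// add0r jN -[leLHS]add0r lerD//.
have nab : ~~ above mu b x N.+1 by apply/negP => h; apply: tx; apply/tau_lty_above; exists N.+1.
have sN : partial_sum x N <= - b.
  move: nab; rewrite /above -leNgt /partial_sum big_nat_recr//=.
  by move: Nb xN => ? ? ?; lra.
have sS : b <= \sum_(1 <= i < N.+1) `|x i|.
  apply: le_trans (ler_norm_sum _ _ _); rewrite lerNr in sN.
  by apply: (le_trans sN); rewrite -normrN ler_norm.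
apply: (@le_trans _ _ ((\sum_(1 <= i < N.+1) `|x i|) / b)).
  by rewrite ler_pdivlMr// mul1r.
rewrite mulr_suml; apply: ler_sum => i _.
by rewrite mul1r lerDl.
Qed.

Let E1 : R := fine (\int[F]_x `|x|%:E).

Let F_abs_lty : (\int[F]_x `|x|%:E < +oo)%E.
Proof.
have mabs : measurable_fun setT (fun x : R => `|x|%:E).
  by apply/measurable_EFinP; exact: normr_measurable.
rewrite ge0_integral_distribution//.
by move/integrableP : intX => [_ h]; exact: h.
Qed.

Let E1E : (\int[F]_x `|x|%:E = E1%:E)%E.
Proof.
rewrite fineK// ge0_fin_numE//; apply: integral_ge0 => x _.
by rewrite lee_fin.
Qed.

Let E10 : 0 <= E1.
Proof. by rewrite fine_ge0//; apply: integral_ge0 => x _; rewrite lee_fin. Qed.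

Let measurable_jump b : measurable_fun setT (jump b).
Proof. by apply: measurable_bool_real; exact: measurable_fun_ltr. Qed.

Let jumpE b : (\int[F]_x (jump b x)%:E = (tail F (3 * b))%:E)%E.
Proof.
rewrite /tail fineK ?fin_num_measure// -[RHS](congr1 F (setIT _)) -integral_indic//.
apply: eq_integral => x _; rewrite indicE; congr ((nat_of_bool _)%:R)%:E.
by apply/idP/idP; rewrite inE/= in_itv/= andbT.
Qed.

Lemma tail_markov (b : R) : 0 < b -> 3 * b * tail F (3 * b) <= E1.
Proof.
move=> b0; rewrite -lee_fin -E1E EFinM -jumpE -ge0_integralZl//; last first.
- by rewrite lee_fin mulr_ge0// ltW.
- by move=> x _; rewrite lee_fin.
- by apply/measurable_EFinP.
apply: ge0_le_integral => //.
- by move=> x _; rewrite -EFinM lee_fin mulr_ge0// mulr_ge0// ltW.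
- by apply: measurable_funeM; apply/measurable_EFinP.
- by apply/measurable_EFinP; exact: normr_measurable.
- move=> x _; rewrite -EFinM lee_fin /jump; case: ltP => [bx|_].
    by rewrite mulr1 (le_trans (ltW bx))// ler_norm.
  by rewrite mulr0.
Qed.

Let pair_integral (f g : R -> R) i n : i != n ->
  measurable_fun setT f -> measurable_fun setT g ->
  (forall x, 0 <= f x) -> (forall x, 0 <= g x) ->
  (\int[F]_x (f x)%:E < +oo)%E -> (\int[F]_x (g x)%:E < +oo)%E ->
  (\int[P]_w (f (X n w) * g (X i w))%:E =
   \int[F]_x (f x)%:E * \int[F]_x (g x)%:E)%E.
Proof.
move=> ni mf mg f0 g0 foo goo.
have := iid_integral_prod iidX (h := fun j => if j == n then f else g) (s := [:: n; i]).
rewrite !big_cons !big_nil eqxx (negbTE ni) mule1 => <-.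
- by apply: eq_integral => w _; rewrite !big_cons big_nil eqxx (negbTE ni) mulr1.
- by move=> j; case: ifP.
- by move=> j x; case: ifP.
- by move=> j; case: ifP.
- by rewrite /= inE eq_sym ni.
Qed.

(* Among N ~ b / k0 steps the expected number of jumps above 3b is N t, with
   t = P(X > 3b); by independence the correction of [jump_count_le] has mean
   at most N^2 t (E|X| / b + t), and k0 makes it at most N t / 2. *)
Lemma passage_lower_bound : exists kap : R, exists2 A : R, 0 < kap /\ 0 < A &
  forall b : R, A <= b ->
    ((kap * (b * tail F b))%:E <= P [set w | (tau mu b (X ^~ w) < +oo)%E])%E.
Proof.
have [A1 A10 h1] := tail_potter slowL tailE smoothL ltr01.
(* The summand mu ensures N mu <= b, and 4 E|X| ensures N E|X| / b <= 1/4. *)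
pose k0 := mu + 4 * E1 + 1.
have k00 : 0 < k0 by rewrite /k0; move: mu0 E10; lra.
(* 3^(-1-alpha) compares the tails at 3b and b by Potter's bound with loss 1; 4 k0 collects N >= b /
   (2 k0), valid for b >= 2 k0, and the half of N t that survives the correction. *)
exists (3 `^ (- 1 - alpha) / (4 * k0)); exists (Num.max A1 (2 * k0)).
  by rewrite divr_gt0 ?powR_gt0 ?mulr_gt0// lt_max A10.
move=> b; rewrite ge_max => /andP[A1b kb].
have b0 : 0 < b by exact: lt_le_trans A1b.
pose N := Num.truncn (b / k0).
have /andP[Nb bN] : N%:R <= b / k0 < N.+1%:R.
  by apply: truncn_itv; rewrite divr_ge0// ltW.
have Nk : N%:R * k0 <= b by rewrite -ler_pdivlMr.
have bk : b < N.+1%:R * k0 by rewrite -ltr_pdivrMr.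
have N0 : 0 <= N%:R :> R by [].
have Nmu : N%:R * mu <= b.
  apply: le_trans Nk; rewrite ler_wpM2l// /k0; move: E10; lra.
have NE : N%:R * E1 <= b / 4.
  have : N%:R * (4 * E1) <= b.
    by apply: le_trans Nk; rewrite ler_wpM2l// /k0; move: mu0; lra.
  by move=> ?; lra.
have bN2 : b / (2 * k0) <= N%:R.
  rewrite ler_pdivrMr ?mulr_gt0//.
  have : b < (N%:R + 1) * k0 by rewrite natr1.
  move: kb; nra.
set t := tail F (3 * b); have t0 : 0 <= t by exact: tail_ge0.
(* Markov's inequality gives 3 b t <= E|X|, combined with N E|X| <= b / 4; then 1/4 + 1/12 is below
   the 1/2 allowed for the correction. *)
have Nt : N%:R * t <= 1 / 12.
  have := tail_markov b0; rewrite -/t => mk.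
  have : N%:R * (3 * b * t) <= N%:R * E1 by rewrite ler_wpM2l.
  move=> h; have : b * (N%:R * t) <= b * (1 / 12) by lra.
  by rewrite ler_pM2l.
pose p := fine (P [set w | (tau mu b (X ^~ w) < +oo)%E]).
have pE : P [set w | (tau mu b (X ^~ w) < +oo)%E] = p%:E.
  by rewrite /p fineK// fin_num_measure//; exact: measurable_passage.
have mX i : measurable_fun setT (X i) by exact: measurable_funP.
have mj i : measurable_fun setT (fun w => jump b (X i w)).
  exact: measurableT_comp.
pose g x := `|x| / b + jump b x.
have g0 x : 0 <= g x by rewrite addr_ge0// divr_ge0// ltW.
have mg : measurable_fun setT g.
  apply: measurable_funD; last exact: measurable_jump.
  by apply: measurable_funM; [exact: normr_measurable|exact: measurable_cst].
have mabs : measurable_fun setT (fun x : R => `|x|%:E).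
  by apply/measurable_EFinP; exact: normr_measurable.
have gE : (\int[F]_x (g x)%:E = (E1 / b + t)%:E)%E.
  transitivity (\int[F]_x ((b^-1)%:E * `|x|%:E + (jump b x)%:E))%E.
    by apply: eq_integral => x _; rewrite -EFinM -EFinD mulrC.
  rewrite ge0_integralD//.
  - rewrite ge0_integralZl//; last by rewrite lee_fin invr_ge0 ltW.
    by rewrite [X in (_ * X)%E]E1E [X in (_ + X)%E]jumpE -EFinM -EFinD mulrC.
  - by move=> x _; rewrite -EFinM lee_fin mulr_ge0// invr_ge0 ltW.
  - exact: measurable_funeM.
  - by move=> x _; rewrite lee_fin.
  - exact/measurable_EFinP.
have mgX i : measurable_fun setT (fun w => g (X i w)) by exact: measurableT_comp.
have pairE n i : i != n ->
    (\int[P]_w (jump b (X n w) * g (X i w))%:E = (t * (E1 / b + t))%:E)%E.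
  move=> ni; rewrite pair_integral//; first by rewrite jumpE gE EFinM.
  - by rewrite jumpE ltry.
  - by rewrite gE ltry.
have main : N%:R * t <= p + N%:R * (N%:R * (t * (E1 / b) + t * t)).
  rewrite -lee_fin.
  have -> : ((N%:R * t)%:E = \int[P]_w (\sum_(1 <= n < N.+1) jump b (X n w))%:E)%E.
    under eq_integral do rewrite -sumEFin.
    rewrite ge0_integral_sum//.
    - rewrite (eq_bigr (fun=> t%:E)).
        by rewrite sumEFin big_const_nat subn1 iter_addr_0 mulr_natl.
      move=> n _; rewrite -jumpE.
      have := iid_integral_prod iidX (h := fun=> jump b) (s := [:: n]).
      rewrite big_seq1 => <- //; last by move=> _; rewrite jumpE ltry.
      by apply: eq_integral => w _; rewrite big_seq1.
    - by move=> n; apply/measurable_EFinP.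
    - by move=> n w _; rewrite lee_fin.
  pose U w := \sum_(1 <= n < N.+1) \sum_(1 <= i < n) jump b (X n w) * g (X i w).
  have mU : measurable_fun setT U.
    apply: measurable_sum => n; apply: measurable_sum => i.
    exact: measurable_funM.
  have U0 w : 0 <= U w by rewrite !sumr_ge0// => n _; rewrite sumr_ge0// => i _; rewrite mulr_ge0.
  pose V w : R := \1_[set w | (tau mu b (X ^~ w) < +oo)%E] w.
  have mV : measurable_fun setT V by apply: measurable_indic; exact: measurable_passage.
  have V0 w : 0 <= V w by [].
  apply: (@le_trans _ _ (\int[P]_w ((V w)%:E + (U w)%:E))%E).
    apply: ge0_le_integral => //.
    - by move=> w _; rewrite lee_fin sumr_ge0.
    - by apply/measurable_EFinP; exact: measurable_sum.
    - by apply: emeasurable_funD; apply/measurable_EFinP.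
    - by move=> w _; rewrite -EFinD lee_fin; exact: (jump_count_le (X ^~ w) b0 Nmu).
  rewrite ge0_integralD//; last 4 first.
  - by move=> w _; rewrite lee_fin.
  - exact/measurable_EFinP.
  - by move=> w _; rewrite lee_fin.
  - exact/measurable_EFinP.
  rewrite EFinD leeD//.
    rewrite integral_indic//; last exact: measurable_passage.
    by rewrite setIT [leLHS]pE.
  have -> : (\int[P]_w (U w)%:E = \sum_(1 <= n < N.+1) \sum_(1 <= i < n) (t * (E1 / b + t))%:E)%E.
    transitivity (\int[P]_w (\sum_(1 <= n < N.+1) \sum_(1 <= i < n)
        (jump b (X n w) * g (X i w))%:E))%E.
      by apply: eq_integral => w _; rewrite -sumEFin; apply: eq_bigr => n _; rewrite -sumEFin.
    rewrite ge0_integral_sum//; last 2 first.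
    - move=> n; apply: emeasurable_sum => i; apply/measurable_EFinP.
      exact: measurable_funM.
    - by move=> n w _; apply: sume_ge0 => i _; rewrite lee_fin mulr_ge0.
    apply: eq_bigr => n _; rewrite ge0_integral_sum//; last 2 first.
    - by move=> i; apply/measurable_EFinP; exact: measurable_funM.
    - by move=> i w _; rewrite lee_fin mulr_ge0.
    apply: eq_big_nat => i /andP[_ ni]; apply: pairE.
    by rewrite ltn_eqF.
  have c0 : 0 <= t * (E1 / b + t) by rewrite mulr_ge0// addr_ge0// divr_ge0// ltW.
  under eq_bigr do rewrite sumEFin big_const_nat iter_addr_0.
  rewrite sumEFin lee_fin.
  apply: (@le_trans _ _ (\sum_(1 <= n < N.+1) (t * (E1 / b + t)) *+ N)).
    rewrite !big_nat; apply: ler_sum => n /andP[_ nN].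
    by apply: ler_wpMn2l => //; rewrite leq_subLR add1n ltnW.
  rewrite big_const_nat subn1 iter_addr_0 /= -[leLHS]mulr_natl.
  by rewrite -[X in _ * X <= _]mulr_natl mulrDr.
rewrite pE lee_fin.
have t3 : tail F b * 3 `^ (- 1 - alpha) <= t.
  have b3b : b <= 3 * b by move: b0; lra.
  have := (h1 b (3 * b) A1b b3b).2.
  by rewrite -mulrA divff ?mulr1// gt_eqF.
have Nt2 : N%:R * (N%:R * (t * (E1 / b) + t * t)) <= N%:R * t / 2.
  have e1 : N%:R * (E1 / b) <= 1 / 4.
    by rewrite mulrA ler_pdivrMr//; lra.
  have -> : N%:R * (N%:R * (t * (E1 / b) + t * t)) =
     N%:R * t * (N%:R * (E1 / b) + N%:R * t) by ring.
  rewrite ler_wpM2l ?mulr_ge0//; lra.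
have pN : N%:R * t / 2 <= p by lra.
apply: le_trans pN.
have -> : 3 `^ (- 1 - alpha) / (4 * k0) * (b * tail F b) =
   (b / (2 * k0)) * (tail F b * 3 `^ (- 1 - alpha)) / 2.
  by field; rewrite gt_eqF.
rewrite ler_pM2r ?invr_gt0//; apply: ler_pM => //.
- by rewrite divr_ge0 ?mulr_ge0 ?ltW.
- by rewrite mulr_ge0 ?powR_ge0 ?tail_ge0.
Qed.

End ruin_lower_bound.

(** * The tilted estimator *)

Section exponential_bounds.
Context {R : realType}.

(** From exp(-y/2) >= 1 - y/2 > 0 follows exp(y) <= (1 - y/2)^(-2), which leaves a rational
    inequality. *)
Lemma expR_le_quad (y : R) : `|y| <= 1 -> expR y <= 1 + y + 4 * y ^+ 2.
Proof.
move=> /ler_normlP[yl yu].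
have h : 1 - y / 2 <= expR (- (y / 2)) by exact: expR_ge1Dx.
have d0 : 0 < 1 - y / 2 by lra.
have -> : expR y = (expR (- (y / 2)))^-1 ^+ 2.
  by rewrite -expRN opprK -expRM_natl -[2]/(2%:R); congr expR; field.
apply: (@le_trans _ _ ((1 - y / 2)^-1 ^+ 2)).
  rewrite lerXn2r ?nnegrE ?invr_ge0 ?expR_ge0 ?(ltW d0)//.
  by rewrite lef_pV2 ?posrE ?expR_gt0.
rewrite exprVn -div1r ler_pdivrMr ?exprn_gt0// expr2.
nra.
Qed.

(** For |y| <= 1 the square is at most the power 3/2; for y < -1 the exponential is below 1, and the
    power 3/2 absorbs the negative linear term since it is at least |y|. *)
Lemma expR_le_pow32 (y : R) : y <= 1 -> expR y <= 1 + y + 4 * `|y| `^ (3 / 2).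
Proof.
move=> y1; have [yl|yl] := leP (- 1) y.
  have ny : `|y| <= 1 by apply/ler_normlP; split; lra.
  apply: (le_trans (expR_le_quad ny)); rewrite lerD2l ler_wpM2l//.
  have [->|y0] := eqVneq y 0; first by rewrite normr0 expr0n/= powR_ge0.
  rewrite -real_normK ?num_real// -powR_mulrn// ger_powR// ?normr_gt0 ?y0//; lra.
have yn : `|y| = - y by rewrite ltr0_norm//; lra.
have e1 : expR y <= 1 by rewrite -[leRHS]expR0 ler_expR; lra.
have p1 : `|y| <= `|y| `^ (3 / 2) by apply: le1r_powR; lra.
lra.
Qed.

End exponential_bounds.

Section truncated_mgf.
Context {R : realType} (F : probability R R).
Hypothesis intF : F.-integrable setT (EFin \o (@id R)).
Hypothesis meanF : (\int[F]_x x%:E = 0)%E.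
Let m32 := (\int[F]_x (`|x| `^ (3 / 2))%:E)%E.
Hypothesis m32_lty : (m32 < +oo)%E.

Let exceed (a x : R) : R := (a < x)%R%:R.

(* For t x <= 1 the exponential is at most 1 + t x + 4 |t x|^(3/2), and F is
   centered; the tails account for 1/t < x <= c/4 and c/4 < x < c. *)
Lemma truncated_mgf_le (c t : R) : 0 < t -> 0 < c ->
  \int[F]_(x in `]-oo, c[) expR (t * x) <=
  1 + 4 * (t `^ (3 / 2) * fine m32) + expR (t * c / 2) * tail F t^-1
  + expR (t * c) * tail F (c / 4).
Proof.
move=> t0 c0.
pose g x : R := 1 + t * x + 4 * (t `^ (3 / 2) * `|x| `^ (3 / 2))
  + expR (t * c / 2) * exceed t^-1 x + expR (t * c) * exceed (c / 4) x.
have m32E : m32 = (fine m32)%:E.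
  rewrite fineK// ge0_fin_numE//; apply: integral_ge0 => x _.
  by rewrite lee_fin powR_ge0.
have mp : measurable_fun setT (fun x : R => `|x| `^ (3 / 2)).
  apply: (measurableT_comp (measurable_powR (3 / 2))); exact: normr_measurable.
have intp : F.-integrable setT (fun x => (`|x| `^ (3 / 2))%:E).
  apply/integrableP; split; first exact/measurable_EFinP.
  by under eq_integral do rewrite gee0_abs ?lee_fin ?powR_ge0//.
have int1 (k : R) : F.-integrable setT (fun=> k%:E).
  by apply: finite_measure_integrable_cst.
have mex a : measurable_fun setT (exceed a).
  by apply: measurable_bool_real; exact: measurable_fun_ltr.
have exE a : (\int[F]_x (exceed a x)%:E = (tail F a)%:E)%E.
  rewrite /tail fineK ?fin_num_measure// -[RHS](congr1 F (setIT _)) -integral_indic//.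
  apply: eq_integral => x _; rewrite indicE; congr ((nat_of_bool _)%:R)%:E.
  by apply/idP/idP; rewrite inE/= in_itv/= andbT.
have intex a : F.-integrable setT (fun x => (exceed a x)%:E).
  apply/integrableP; split; first exact/measurable_EFinP.
  under eq_integral do rewrite gee0_abs ?lee_fin//.
  by rewrite exE ltry.
have gE x : (g x)%:E = (1%:E + t%:E * x%:E + (4 * t `^ (3 / 2))%:E * (`|x| `^ (3 / 2))%:E
    + (expR (t * c / 2))%:E * (exceed t^-1 x)%:E + (expR (t * c))%:E * (exceed (c / 4) x)%:E)%E.
  by rewrite -!EFinM -!EFinD /g mulrA.
have g_ge x : (x < c)%R%:R * expR (t * x) <= g x.
  (* The polynomial part is nonnegative everywhere, so it can stay in the majorant where the terms
     in [exceed] do the work. *)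
  have lin : 0 <= 1 + t * x + 4 * (t `^ (3 / 2) * `|x| `^ (3 / 2)) /\
      (x <= t^-1 -> expR (t * x) <= 1 + t * x + 4 * (t `^ (3 / 2) * `|x| `^ (3 / 2))).
    have -> : t `^ (3 / 2) * `|x| `^ (3 / 2) = `|t * x| `^ (3 / 2).
      by rewrite normrM (gtr0_norm t0) powRM ?(ltW t0).
    have bnd : t * x <= 1 -> expR (t * x) <= 1 + t * x + 4 * `|t * x| `^ (3 / 2).
      exact: expR_le_pow32.
    split; last by move=> xt; apply: bnd; rewrite mulrC -ler_pdivlMr// div1r.
    have [h|h] := leP (t * x) 1; first exact: le_trans (expR_ge0 _) (bnd h).
    have := powR_ge0 `|t * x| (3 / 2); lra.
  have e2 : 0 <= expR (t * c / 2) by exact: expR_ge0.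
  have e3 : 0 <= expR (t * c) by exact: expR_ge0.
  rewrite /g; case: (ltP x c) => xc; last first.
    rewrite mul0r; apply: addr_ge0; last by rewrite mulr_ge0.
    by apply: addr_ge0; [exact: lin.1|rewrite mulr_ge0].
  rewrite mul1r; have [xt|xt] := leP x t^-1.
    rewrite -[leLHS]addr0 -addrA lerD ?lin.2// addr_ge0// mulr_ge0//.
  have [xc2|xc2] := ltP (c / 4) x.
    apply: (@le_trans _ _ (expR (t * c))).
      by rewrite ler_expR ler_wpM2l// ltW.
    rewrite /exceed xc2 mulr1 lerDr addr_ge0 ?lin.1// mulr_ge0//.
  apply: (@le_trans _ _ (expR (t * c / 2))).
    by rewrite ler_expR -mulrA ler_wpM2l ?(ltW t0)//; lra.
  rewrite {1}/exceed xt mulr1 -addrA addrCA lerDl addr_ge0 ?lin.1// mulr_ge0//.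
have g0 x : 0 <= g x by apply: le_trans (g_ge x); rewrite mulr_ge0 ?expR_ge0.
have intG : (\int[F]_x (g x)%:E = (1 + 4 * (t `^ (3 / 2) * fine m32) +
    expR (t * c / 2) * tail F t^-1 + expR (t * c) * tail F (c / 4))%:E)%E.
  under eq_integral do rewrite gE.
  have i1 := int1 1; have i2 := integrableZl measurableT t intF.
  have i3 := integrableZl measurableT (4 * t `^ (3 / 2)) intp.
  have i4 := integrableZl measurableT (expR (t * c / 2)) (intex t^-1).
  have i5 := integrableZl measurableT (expR (t * c)) (intex (c / 4)).
  rewrite integralD//; last by do 3!apply: integrableD => //.
  rewrite integralD//; last by do 2!apply: integrableD => //.
  rewrite integralD//; last by apply: integrableD => //.
  rewrite integralD// !integralZl//.
  rewrite meanF mule0 adde0 !exE -/m32 m32E integral_cst// [X in (1%:E * X)%E]probability_setT.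
  by rewrite -!EFinM -!EFinD mulr1 mulrA.
rewrite -lee_fin -intG /Rintegral fineK; last first.
  rewrite ge0_fin_numE; last by apply: integral_ge0 => x _; rewrite lee_fin expR_ge0.
  exact: truncated_mgf_lty (ltW t0).
rewrite integral_mkcond; apply: ge0_le_integral => //.
- by move=> x _; rewrite patchE; case: ifP => // _; rewrite lee_fin expR_ge0.
- apply/(measurable_restrictT _ _).1 => //; apply/measurable_EFinP/measurable_funTS.
  exact: measurable_exp_lin.
- apply/measurable_EFinP.
  apply: measurable_funD; last exact: measurable_funM.
  apply: measurable_funD; last exact: measurable_funM.
  apply: measurable_funD; last by do 2!apply: measurable_funM => //.
  by apply: measurable_funD => //; exact: measurable_funM.
- move=> x _; rewrite patchE; case: ifPn => [|_]; last by rewrite lee_fin.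
  rewrite inE/= in_itv/= => xc; rewrite lee_fin; apply: le_trans (g_ge x).
  by rewrite xc mul1r.
Qed.

End truncated_mgf.

(** * Finiteness of the moment of order 3/2 *)

Section moment.
Context d (T : measurableType d) {R : realType} (P : probability T R)
  (X : {RV P >-> R}).
Let F : probability R R := distribution P X.
Variables (alpha : R) (L : R -> R).
Hypothesis meanX : 'E_P[X]%E = 0%E.
Hypothesis slowL : slowly_varying L.
Hypothesis tailE : forall x, 0 < x -> tail F x = x `^ (- alpha) * L x.
Hypothesis smoothL : assumption2 L.
Hypothesis alpha_gt : 3 / 2 < alpha.

Lemma limf_esup_pinfty_lty (f : R -> R) :
  (limf_esup (fun x => (f x)%:E) +oo%R < +oo)%E ->
  exists M : R, exists2 A : R, 0 < A & forall x, A <= x -> f x <= M.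
Proof.
rewrite limf_esupE => /ereal_inf_lt[_ [V VF <-] Vlt].
have [B B0 BV] := (near_pinfty_exP V).1 VF.
have fV x : B <= x -> ((f x)%:E <= ereal_sup [set (f x)%:E | x in V])%E.
  by move=> Bx; apply: ereal_sup_ubound; exists x => //; exact: BV.
move: Vlt fV; case: (ereal_sup _) => [s _ h|//|_ h].
  by exists s; exists B => // x /h; rewrite lee_fin.
by have := h B (lexx _).
Qed.

Let absX32 : T -> R := fun w => `|X w| `^ (3 / 2).

Let mabsX32 : measurable_fun setT absX32.
Proof.
apply: (measurableT_comp (measurable_powR (3 / 2))).
by apply: measurableT_comp; [exact: normr_measurable|exact: measurable_funP].
Qed.

(** The moment is the integral over r > 0 of P(|X| > r^(2/3)), which is O(r^(-s)) with s = 2/3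
    (alpha - e), both tails being controlled by the right one. *)
Lemma moment32_of_tails (M A : R) : 0 < A ->
  (forall x, A <= x -> fine (P [set w | X w < - x]) <= M * tail F x) ->
  (\int[P]_w (absX32 w)%:E < +oo)%E.
Proof.
move=> A0 hM.
pose Y : {RV P >-> R} := mfun_Sub (mem_set mabsX32).
have -> : (\int[P]_w (absX32 w)%:E = 'E_P[Y])%E by rewrite unlock.
rewrite ge0_expectation_ccdf; last by move=> w; exact: powR_ge0.
(* Half of the margin in alpha > 3/2, which leaves s > 1. *)
pose e := (alpha - 3 / 2) / 2; have e0 : 0 < e by rewrite /e; move: alpha_gt; lra.
have [A1 A10 h1] := tail_potter slowL tailE smoothL e0.
pose A' := Num.max A A1; have A'0 : 0 < A' by rewrite lt_max A0.
pose B := A' `^ (3 / 2); have B0 : 0 < B by rewrite powR_gt0.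
pose s := 2 / 3 * (alpha - e).
have s1 : 1 < s by rewrite /s /e; move: alpha_gt; lra.
pose C := (`|M| + 1) * (tail F A' * A' `^ (alpha - e)).
have C0 : 0 <= C by rewrite mulr_ge0 ?addr_ge0// mulr_ge0 ?powR_ge0 ?tail_ge0.
have ccdf_le r : B <= r -> (ccdf Y r <= (C * r `^ (- s))%:E)%E.
  move=> Br; have r0 : 0 < r by exact: lt_le_trans Br.
  pose x := r `^ (2 / 3); have x0 : 0 < x by rewrite powR_gt0.
  have rx : r = x `^ (3 / 2).
    by rewrite /x -powRrM (_ : 2 / 3 * (3 / 2) = 1) ?powRr1 ?ltW//; field.
  have A'x : A' <= x.
    rewrite /x (_ : A' = B `^ (2 / 3)).
      by apply: ge0_ler_powR => //; rewrite ?nnegrE ?(ltW B0) ?(ltW r0).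
    by rewrite /B -powRrM (_ : 3 / 2 * (2 / 3) = 1) ?powRr1 ?ltW//; field.
  have [Ax A1x] : A <= x /\ A1 <= A' by split; [rewrite (le_trans _ A'x)// le_max lexx|rewrite le_max lexx orbT].
  have ltE : [set w | X w < - x] = X @^-1` `]-oo, (- x)[%classic.
    by apply/seteqP; split => w /=; rewrite in_itv.
  have gtE : [set w | x < X w] = X @^-1` `]x, +oo[%classic.
    by apply/seteqP; split => w /=; rewrite in_itv/= andbT.
  have mX (I : set R) : measurable I -> measurable (X @^-1` I).
    by move=> mI; rewrite -[_ @^-1` _]setTI; exact: measurable_funP.
  have step : (ccdf Y r <= P [set w | (X w < - x)%R] + P [set w | (x < X w)%R])%E.
    apply: (@le_trans _ _ (P ([set w | (X w < - x)%R] `|` [set w | (x < X w)%R]))).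
      rewrite /ccdf /distribution /= /pushforward; apply: le_measure; rewrite ?inE.
      - by rewrite -[Y @^-1` _]setTI; exact: measurable_funP.
      - by apply: measurableU; rewrite ?ltE ?gtE; exact: mX.
      move=> w /=; rewrite in_itv/= andbT /absX32 rx => xw.
      have : x < `|X w|.
        rewrite ltNge; apply/negP => wx; move: xw; rewrite ltNge => /negP; apply.
        by apply: ge0_ler_powR; rewrite ?nnegrE ?(ltW x0)//; lra.
      by rewrite ltr_normr => /orP[|]; [right|left; rewrite ltrNr].
    by apply: measureU2; rewrite ?ltE ?gtE; exact: mX.
  apply: (le_trans step).
  have -> : P [set w | (x < X w)%R] = (tail F x)%:E.
    by rewrite gtE /tail fineK ?fin_num_measure.
  have Px : P [set w | (X w < - x)%R] \is a fin_num.
    by rewrite ltE; apply: fin_num_measure; exact: mX.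
  rewrite -(fineK Px) -EFinD lee_fin.
  have t0 : 0 <= tail F x := tail_ge0 F x.
  apply: (@le_trans _ _ ((`|M| + 1) * tail F x)).
    rewrite mulrDl mul1r lerD2r; apply: (le_trans (hM x Ax)).
    by rewrite ler_wpM2r// ler_norm.
  rewrite /C -!mulrA ler_wpM2l ?addr_ge0//.
  apply: (le_trans (h1 A' x A1x A'x).1).
  rewrite ler_wpM2l ?tail_ge0// powR_divf//.
  have -> : r `^ (- s) = x `^ (e - alpha).
    by rewrite rx -powRrM; congr (_ `^ _); rewrite /s; field.
  by rewrite -(opprB e alpha) (powRN A') mulrC.
have mccdf : measurable_fun setT (ccdf Y) by exact: ccdf_measurable.
have ccdf0 r : (0 <= ccdf Y r)%E by exact: measure_ge0.
have ccdf1 r : (ccdf Y r <= 1)%E by exact: probability_le1.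
have -> : `[0%R, +oo[%classic = `[0, B[%classic `|` `[B, +oo[%classic :> set R.
  by rewrite -itv_bndbnd_setU// bnd_simp ltW.
rewrite ge0_integral_setU//; last 2 first.
- exact: measurable_funTS.
- apply/disj_setPS => u /= []; rewrite !in_itv/= andbT => /andP[_ uy] yu.
  by move: (lt_le_trans uy yu); rewrite ltxx.
apply: lte_add_pinfty.
  apply: (@le_lt_trans _ _ (\int[lebesgue_measure]_(r in `[0%R, B[) cst 1 r)%E).
    by apply: ge0_le_integral => //; exact: measurable_funTS.
  rewrite integral_cst//= mul1e lebesgue_measure_itv/= lte_fin.
  by case: ifP => _; rewrite ?ltry// -EFinB ltry.
apply: (@le_lt_trans _ _ (\int[lebesgue_measure]_(r in `[B, +oo[) (C%:E * (r `^ (- s))%:E))%E).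
  apply: ge0_le_integral => //.
  - exact: measurable_funTS.
  - apply: measurable_funeM; apply/measurable_EFinP/measurable_funTS.
    exact: measurable_powR.
  - by move=> r /=; rewrite in_itv/= andbT => Br; rewrite -EFinM; exact: ccdf_le.
rewrite ge0_integralZl//.
- by rewrite integral_powR_tail// -EFinM ltry.
- by apply/measurable_EFinP/measurable_funTS; exact: measurable_powR.
- by move=> r _; rewrite lee_fin powR_ge0.
Qed.

(** As [X] is centered its variance is the second moment, and |x|^(3/2) <= 1 + x^2. *)
Lemma moment32_of_variance : ('V_P[X] < +oo)%E -> (\int[P]_w (absX32 w)%:E < +oo)%E.
Proof.
have mX : measurable_fun setT X by exact: measurable_funP.
rewrite /variance unlock meanX /= unlock => V.
apply: (@le_lt_trans _ _ (\int[P]_w (1%:E + (X w ^+ 2)%:E))%E).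
  apply: ge0_le_integral => //.
  - by move=> w _; rewrite lee_fin powR_ge0.
  - exact/measurable_EFinP.
  - apply: emeasurable_funD => //; apply/measurable_EFinP.
    by apply: (measurable_funX 2).
  - move=> w _; rewrite -EFinD lee_fin /absX32.
    have [w1|w1] := leP `|X w| 1.
      rewrite -[leLHS]addr0 lerD ?sqr_ge0//.
      apply: (@le_trans _ _ (1 `^ (3 / 2))); last by rewrite powR1.
      by apply: ge0_ler_powR; rewrite ?nnegrE//; lra.
    rewrite -[X in 1 + X]real_normK ?num_real// -powR_mulrn//.
    apply: (@le_trans _ _ (`|X w| `^ 2)); last by rewrite lerDr.
    by apply: ler_powR; [exact: ltW|lra].
rewrite ge0_integralD//; last 2 first.
- by move=> w _; rewrite lee_fin sqr_ge0.
- by apply/measurable_EFinP; apply: (measurable_funX 2).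
apply: lte_add_pinfty.
  by rewrite integral_cst// mul1e [ltLHS]probability_setT ltry.
move: V; apply: le_lt_trans; rewrite le_eqVlt; apply/orP; left; apply/eqP.
apply: eq_integral => w _; transitivity (((X w - 0) * (X w - 0))%:E) => //.
by rewrite subr0 expr2.
Qed.

(** A finite variance dominates this moment; an infinite one is precisely the case in which the left
    tail is assumed comparable to the right tail. *)
Lemma moment32_lty :
  ('V_P[X] = +oo -> limf_esup
     (fun x : R => (fine (P [set w | X w < - x]%R) /
                    fine (P [set w | X w > x]%R))%:E) +oo%R < +oo)%E ->
  (\int[F]_x (`|x| `^ (3 / 2))%:E < +oo)%E.
Proof.
move=> h.
have mp : measurable_fun setT (fun x : R => (`|x| `^ (3 / 2))%:E).
  apply/measurable_EFinP; apply: (measurableT_comp (measurable_powR (3 / 2))).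
  exact: normr_measurable.
rewrite ge0_integral_distribution//.
have [Voo|Voo] := eqVneq ('V_P[X])%E +oo%E; last first.
  by apply: moment32_of_variance; rewrite ltey.
have [M [A A0 hM]] := limf_esup_pinfty_lty (h Voo).
apply: (moment32_of_tails A0 (M := M)) => x /hM.
have -> : P [set w | (x < X w)%R] = (tail F x)%:E.
  rewrite /tail fineK ?fin_num_measure//; congr (P _); apply/seteqP.
  by split => w /=; rewrite in_itv/= andbT.
by rewrite ler_pdivrMr// (tail_gt0 slowL tailE).
Qed.

End moment.

Lemma exprn_le_expR {R : realType} n : exists2 f : R, 0 < f &
  forall y, 0 <= y -> y ^+ n.+1 <= f * expR y.
Proof.
have f0 : 0 < n.+1`!%:R :> R by rewrite ltr0n fact_gt0.
exists n.+1`!%:R => // y y0; rewrite -ler_pdivrMl// mulrC.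
by apply: le_trans (expR_ge1Dxn n y0); rewrite lerDr.
Qed.

Section tilting.
Context {R : realType} (F : probability R R).
Variables (alpha : R) (L : R -> R).
Hypothesis slowL : slowly_varying L.
Hypothesis tailE : forall x, 0 < x -> tail F x = x `^ (- alpha) * L x.
Hypothesis smoothL : assumption2 L.
Hypotheses (alpha_gt : 3 / 2 < alpha) (alpha_le : alpha <= 2).
Hypothesis intF : F.-integrable setT (EFin \o (@id R)).
Hypothesis meanF : (\int[F]_x x%:E = 0)%E.
Hypothesis m32_lty : (\int[F]_x (`|x| `^ (3 / 2))%:E < +oo)%E.

(** A law carried by [c, oo) has mean at least c > 0, while [F] is centered. *)
Lemma lower_mass_neq0 (c : R) : 0 < c -> F `]-oo, c[%classic != 0%E.
Proof.
move=> c0; apply/eqP => F0.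
have mI : measurable (`]-oo, c[%classic : set R) by [].
have := meanF; rewrite (negligible_integral (N := `]-oo, c[%classic))// => int0.
have FC : F (setT `\` `]-oo, c[%classic) = 1%E.
  by rewrite setTD probability_setC// F0 sube0.
have : (c%:E <= 0)%E.
  rewrite -int0 -[leLHS]mule1 -FC -integral_cst//; last exact: measurableD.
  apply: ge0_le_integral => //.
  - exact: measurableD.

  - by move=> x _; rewrite lee_fin ltW.
  - by move=> x [_ /=]; rewrite in_itv/= => /negP; rewrite -leNgt lee_fin.
by rewrite lee_fin leNgt c0.
Qed.

(* With n tail(c) = exp(-y), the three error terms of [truncated_mgf_le] at
   t = y / c are, up to constants and after multiplication by n, at most
   c^(-1/2) y^(3/2), y^3 exp(-y/2) and 1. *)
Lemma mgf_rate (Kn : R) : 0 < Kn -> exists C : R, exists2 B : R, 0 <= C /\ 0 < B &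
  forall c n : R, B <= c -> 1 <= n -> n <= Kn * c -> n * tail F c <= expR (- 1) ->
  n * ln (\int[F]_(x in `]-oo, c[) expR (- ln (n * tail F c) / c * x)) <= C.
Proof.
move=> Kn0; have [A A0 h] := tail_potter slowL tailE smoothL (@ltr01 R).
have tA := tail_gt0 slowL tailE A.
pose m := fine (\int[F]_x (`|x| `^ (3 / 2))%:E)%E.
have m0 : 0 <= m by apply: fine_ge0; apply: integral_ge0 => x _; rewrite lee_fin powR_ge0.
(* The power 9: the tail at c is at least of order c^(-3), as alpha <= 2 and Potter's loss is 1, so
   exp(y) is O(c^3) and y^9 <= D c^3. Its sixth root reads y^(3/2) <= D^(1/6) c^(1/2), the factor
   c^(1/2) that n (y/c)^(3/2) can afford when n <= Kn c. *)
have [f f0 hf] := @exprn_le_expR R 8.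
pose D := f / (tail F A * A ^+ 3).
have D0 : 0 < D by rewrite divr_gt0 ?mulr_gt0 ?exprn_gt0.
(* One summand for each error term: 48 is 3! 2^3, from (y/2)^3 / 3! <= exp(y/2), and 64 is 4^3, from
   comparing the tails at c/4 and c. *)
exists (4 * m * (Kn * D `^ (1 / 6)) + 48 + 64).
(* Potter's bound is applied from c/4 and from c/y: 4 A serves the former, and D A^9 gives y <= c /
   A through y^9 <= D c^3. *)
exists (Num.max 1 (Num.max (4 * A) (D * A ^+ 9))).
  split; last by rewrite lt_max ltr01.
  by rewrite !addr_ge0// !mulr_ge0 ?powR_ge0 ?(ltW Kn0).
move=> c n; rewrite !ge_max => /andP[c1 /andP[Ac Dc]] n1 nK nt.
have c0 : 0 < c by lra.
have n0 : 0 < n by lra.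
have tc := tail_gt0 slowL tailE c.
have ntc : 0 < n * tail F c by rewrite mulr_gt0.
set y := - ln (n * tail F c).
have ey : expR (- y) = n * tail F c by rewrite /y opprK lnK ?posrE.
(* From n tail(c) <= exp(-1); it gives c / y <= c and lets y^(1 + alpha) be replaced by y^3. *)
have y1 : 1 <= y by move: nt; rewrite -ey ler_expR; lra.
have y0 : 0 < y by lra.
have Ac1 : A <= c by lra.
have eyE : expR y = (n * tail F c)^-1 by rewrite -ey expRN invrK.
have y9 : y ^+ 9 <= D * c ^+ 3.
  have h1 : y ^+ 9 <= f * expR y by exact: hf (ltW y0).
  have h2 : tail F A * (A ^+ 3 / c ^+ 3) <= tail F c.
    apply: le_trans (h A c (lexx A) Ac1).2; rewrite ler_wpM2l ?(ltW tA)//.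
    apply: (@le_trans _ _ ((c / A) `^ (- 3%:R))).
      rewrite powR_invn ?divr_ge0 ?(ltW c0) ?(ltW A0)//.
      by rewrite expr_div_n invf_div.
    apply: ler_powR; last by move: alpha_le; lra.
    by rewrite ler_pdivlMr// mul1r.
  have h3 : expR y <= c ^+ 3 / (tail F A * A ^+ 3).
    rewrite eyE -[leRHS]invrK lef_pV2 ?posrE ?invr_gt0 ?divr_gt0 ?mulr_gt0 ?exprn_gt0//.
    rewrite invf_div -mulrA; apply: (le_trans h2).
    by rewrite ler_peMl// ltW.
  apply: (le_trans h1); rewrite /D.
  rewrite [leRHS](_ : _ = f * (c ^+ 3 / (tail F A * A ^+ 3))); last by ring.
  by rewrite ler_pM2l.
have yA : A <= c / y.
  rewrite ler_pdivlMr// -ler_pdivlMl//.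
  have cA0 : 0 <= A^-1 * c by rewrite mulr_ge0 ?invr_ge0 ?(ltW A0) ?(ltW c0).
  rewrite -(@ler_pXn2r _ 9) ?nnegrE ?(ltW y0)//; apply: (le_trans y9).
  rewrite [leRHS](_ : _ = c ^+ 9 / A ^+ 9); last by rewrite exprMn exprVn mulrC.
  rewrite ler_pdivlMr ?exprn_gt0// mulrAC.
  apply: (@le_trans _ _ (c * c ^+ 3)).
    by rewrite ler_wpM2r// exprn_ge0// ltW.
  by rewrite -exprS ler_weXn2l.
have tcy : tail F (c / y) <= tail F c * y ^+ 3.
  have cy : c / y <= c by rewrite ler_pdivrMr// ler_peMr// ltW.
  have := (h (c / y) c yA cy).2; rewrite invf_div mulrCA divff ?gt_eqF// mulr1 => hy.
  have yp : y `^ (1 + alpha) <= y ^+ 3.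
    by rewrite -powR_mulrn ?(ltW y0)//; apply: ler_powR => //; move: alpha_le; lra.
  apply: (@le_trans _ _ (tail F c * y `^ (1 + alpha))); last by rewrite ler_wpM2l// ltW.
  rewrite -ler_pdivrMr ?powR_gt0// -powRN (_ : - (1 + alpha) = - 1 - alpha)//.
  by ring.
have tc4 : tail F (c / 4) <= tail F c * 64.
  have cc : c / 4 <= c by lra.
  have Ac4 : A <= c / 4 by lra.
  have := (h (c / 4) c Ac4 cc).2; rewrite invf_div mulrCA divff ?gt_eqF// mulr1 => h4.
  have yp : 4 `^ (1 + alpha) <= 64 :> R.
    apply: (@le_trans _ _ (4 `^ 3%:R)); last by rewrite powR_mulrn//; lra.
    by apply: ler_powR => //; [lra|move: alpha_le; lra].
  apply: (@le_trans _ _ (tail F c * 4 `^ (1 + alpha))); last by rewrite ler_wpM2l// ltW.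
  rewrite -ler_pdivrMr ?powR_gt0// -powRN (_ : - (1 + alpha) = - 1 - alpha)//.
  by ring.
have th0 : 0 < y / c by rewrite divr_gt0.
have mgf := truncated_mgf_le intF meanF m32_lty th0 c0.
set I := \int[F]_(x in _) _ in mgf *.
have I0 : 0 < I.
  exact: (truncated_mgf_gt0 lower_mass_neq0 c0 (ltW th0)).
have lnI : ln I <= I - 1.
  have := expR_ge1Dx (ln I); rewrite lnK ?posrE//; lra.
rewrite -/m invf_div divfK ?gt_eqF// in mgf.
apply: (@le_trans _ _ (n * (I - 1))); first by rewrite ler_wpM2l// ltW.
have T1 : n * (y / c) `^ (3 / 2) <= Kn * D `^ (1 / 6).
  have y32 : y `^ (3 / 2) <= D `^ (1 / 6) * c `^ (1 / 2).
    have -> : y `^ (3 / 2) = (y ^+ 9) `^ (1 / 6).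
      by rewrite -powR_mulrn ?(ltW y0)// -powRrM; congr (_ `^ _); field.
    have -> : c `^ (1 / 2) = (c ^+ 3) `^ (1 / 6).
      by rewrite -powR_mulrn ?(ltW c0)// -powRrM; congr (_ `^ _); field.
    rewrite -powRM ?(ltW D0) ?exprn_ge0 ?(ltW c0)//.
    apply: ge0_ler_powR => //.
      by rewrite nnegrE exprn_ge0// ltW.
    by rewrite nnegrE mulr_ge0 ?exprn_ge0 ?ltW.
  rewrite powR_divf// mulrA ler_pdivrMr ?powR_gt0//.
  apply: (@le_trans _ _ (Kn * c * (D `^ (1 / 6) * c `^ (1 / 2)))).
    by apply: ler_pM; rewrite ?powR_ge0 ?(ltW n0).
  rewrite le_eqVlt; apply/orP; left; apply/eqP.
  have -> : c `^ (3 / 2) = c * c `^ (1 / 2).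
    rewrite -[X in _ = X * _](powRr1 (ltW c0)) -powRD ?(gt_eqF c0) ?implybT//.
    by congr (_ `^ _); field.
  by ring.
have e2 : expR (y / 2) * expR (y / 2) = expR y by rewrite -expRD; congr expR; field.
have T2 : n * (expR (y / 2) * tail F (c / y)) <= 48.
  have : n * (expR (y / 2) * tail F (c / y)) <= n * (expR (y / 2) * (tail F c * y ^+ 3)).
    by rewrite ler_wpM2l ?(ltW n0)// ler_wpM2l ?expR_ge0.
  move/le_trans; apply.
  have -> : n * (expR (y / 2) * (tail F c * y ^+ 3)) = (expR (y / 2) / expR y) * y ^+ 3.
    by rewrite eyE invrK; ring.
  have -> : expR (y / 2) / expR y = (expR (y / 2))^-1.
    by rewrite -e2; field; rewrite gt_eqF ?expR_gt0.
  rewrite mulrC ler_pdivrMr ?expR_gt0//.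
  have := expR_ge1Dxn 2 (x := y / 2) (divr_ge0 (ltW y0) (ler0n R 2)).
  have -> : 3`!%:R = 6 :> R by [].
  rewrite expr_div_n; have -> : (2 ^+ 3 : R) = 8 by ring.
  by move=> ?; lra.
have T3 : n * (expR y * tail F (c / 4)) <= 64.
  have : n * (expR y * tail F (c / 4)) <= n * (expR y * (tail F c * 64)).
    by rewrite ler_wpM2l ?(ltW n0)// ler_wpM2l ?expR_ge0.
  move/le_trans; apply; rewrite eyE le_eqVlt; apply/orP; left; apply/eqP.
  by field; rewrite !gt_eqF.
have I1 : n * (I - 1) <= n * (4 * ((y / c) `^ (3 / 2) * m) + expR (y / 2) * tail F (c / y)
    + expR y * tail F (c / 4)).
  by rewrite ler_wpM2l ?(ltW n0)//; lra.
apply: (le_trans I1).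
rewrite !mulrDr !lerD//.
rewrite [leLHS](_ : _ = 4 * m * (n * (y / c) `^ (3 / 2))); last by ring.
by rewrite ler_wpM2l// mulr_ge0.
Qed.

End tilting.

(** * Large barriers *)

Section large_barriers.
Context {R : realType} (F : probability R R).
Variables (alpha : R) (L : R -> R).
Hypothesis slowL : slowly_varying L.
Hypothesis tailE : forall x, 0 < x -> tail F x = x `^ (- alpha) * L x.
Hypothesis smoothL : assumption2 L.
Hypotheses (alpha_gt : 3 / 2 < alpha) (alpha_le : alpha <= 2).
Hypothesis intF : F.-integrable setT (EFin \o (@id R)).
Hypothesis meanF : (\int[F]_x x%:E = 0)%E.
Hypothesis m32_lty : (\int[F]_x (`|x| `^ (3 / 2))%:E < +oo)%E.
Variables (mu : R) (r : nat).
Hypotheses (mu0 : 0 < mu) (r1 : (1 < r)%N).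

Local Notation n_ := (blk r).
Local Notation c_ := (barrier mu).

(** r / mu turns n_(k-1) mu <= c_k into a bound on r n_(k-1); the second r bounds the additive r of
    [blk_le], as c_k >= b >= 1. *)
Let Kn : R := r%:R / mu + r%:R.

Lemma blk_le_barrier (b : R) k : 1 <= b -> (1 <= k)%N -> (n_ k)%:R <= Kn * c_ b r k.
Proof.
move=> b1 k1.
have : (n_ k)%:R <= r%:R * (n_ k.-1)%:R + r%:R :> R.
  by rewrite -natrM -natrD ler_nat blk_le.
move/le_trans; apply; rewrite /Kn /barrier mulrDl lerD//.
  rewrite mulrDr [X in _ <= _ + X](_ : _ = r%:R * (n_ k.-1)%:R); last first.
    by field; rewrite gt_eqF.
  by rewrite lerDr mulr_ge0// ?divr_ge0// ?(ltW mu0)//; lra.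
by rewrite ler_peMr// (le_trans b1)// lerDl mulr_ge0// ltW.
Qed.

(** Uniform in k because the bound depends on c_k >= b alone: with n_k <= Kn c_k and Potter's loss
    1/4 the product is O(c_k^(1 + 1/4 - alpha)), and alpha > 3/2 puts the exponent below -1/4. *)
Lemma block_tail_small (eps : R) : 0 < eps -> exists2 B : R, 1 <= B &
  forall b k, B <= b -> (1 <= k)%N -> (n_ k)%:R * tail F (c_ b r k) <= eps.
Proof.
move=> eps0.
have e0 : 0 < 1 / 4 :> R by lra.
have [A A0 h] := tail_potter slowL tailE smoothL e0.
have r0 : 0 < r%:R :> R by rewrite ltr0n ltnW.
have Kn0 : 0 < Kn by rewrite addr_gt0// divr_gt0.
pose C := Kn * tail F A * A `^ (alpha - 1 / 4).
have C0 : 0 < C by rewrite !mulr_gt0 ?powR_gt0 ?(tail_gt0 slowL tailE).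
have := @cvg_powRN_pinfty R (1 / 4) e0.
move=> /cvgr0_norm_le /(_ (eps / C)) /(_ _)/near_pinfty_exP[|B B0 hB]; first by rewrite divr_gt0.
exists (Num.max 1 (Num.max A B)); first by rewrite le_max lexx.
move=> b k; rewrite !ge_max => /andP[b1 /andP[Ab Bb]] k1.
have bc : b <= c_ b r k by rewrite lerDl mulr_ge0// ltW.
set c := c_ b r k in bc *.
have c0 : 0 < c by lra.
have c1 : 1 <= c by lra.
have nK := blk_le_barrier b1 k1; rewrite -/c in nK.
apply: (@le_trans _ _ (Kn * c * (tail F A * (c / A) `^ (1 / 4 - alpha)))).
  apply: ler_pM => //; first exact: tail_ge0.
  by apply: (h A c (lexx _) _).1; lra.
have -> : Kn * c * (tail F A * (c / A) `^ (1 / 4 - alpha)) = C * c `^ (1 + 1 / 4 - alpha).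
  rewrite -addrA [c `^ (1 + _)]powRD ?(gt_eqF c0) ?implybT// (powRr1 (ltW c0)).
  by rewrite /C powR_divf// -(opprB (1 / 4) alpha) (powRN A); ring.
apply: (@le_trans _ _ (C * c `^ (- (1 / 4)))).
  by rewrite ler_wpM2l ?(ltW C0)//; apply: ler_powR => //; move: alpha_gt; lra.
rewrite -ler_pdivlMl// [leRHS]mulrC; apply: le_trans (hB c _); last by lra.
exact: ler_norm.
Qed.

(** Differentiability of [L] makes the tail continuous at large x, and an atom at x would be a jump:
    its mass is at most the increase of the tail between x and any point to the left of x. *)
Lemma no_atom : exists2 A : R, 0 < A & forall x, A <= x -> F [set x] = 0%E.
Proof.
have [t0 t00 [dL _]] := smoothL.
exists (t0 + 1); first by rewrite addr_gt0.
move=> x xt; have x0 : 0 < x by lra.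
have ct : {for x, continuous (tail F)}.
  have cpow : {for x, continuous (fun y : R => y `^ (- alpha))}.
    apply/differentiable_continuous/derivable1_diffP.
    by apply: derivable_powR; rewrite in_itv/= andbT.
  have cL : {for x, continuous L}.
    apply/differentiable_continuous/derivable1_diffP.
    by apply: (dL x _).1; lra.
  have cg : y `^ (- alpha) * L y @[y --> x] --> tail F x.
    by rewrite tailE//; exact: continuousM cpow cL.
  apply: cvg_trans cg; apply: near_eq_cvg.
  by near=> y; rewrite tailE//; near: y; exact: (lt_nbhsr x0).
apply/eqP; rewrite -measure_le0; apply/lee_addgt0Pr => e e0; rewrite add0e.
move/cvgrPdist_le : ct => /(_ e e0) [D /= D0 hD].
have D20 : 0 < D / 2 by rewrite divr_gt0.
have /= := hD (x - D / 2).
rewrite opprB addrCA subrr addr0 gtr0_norm// => /(_ _)/wrap[]; first by lra.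
move=> /ler_normlP[+ _]; rewrite opprB => tD.
have Fx : F [set x] \is a fin_num by rewrite fin_num_measure.
rewrite -(fineK Fx) lee_fin; apply: le_trans tD.
rewrite lerBrDr -fineD ?fin_num_measure// -measureU//; last first.
  by rewrite -subset0 => y [/= ->]; rewrite in_itv/= ltxx.
rewrite fine_le ?fin_num_measure ?le_measure ?inE//.
- exact: measurableU.
- exact: measurableU.
by move=> y /= [->|]; rewrite !in_itv/= !andbT => *; move: D20; lra.
Unshelve. all: by end_near. Qed.

Lemma admissible_near : \forall b \near +oo, admissible F mu r b.
Proof.
have [B B1 hB] := block_tail_small ltr01.
have [A A0 hA] := no_atom.
apply/near_pinfty_exP; exists (Num.max A B); first by rewrite lt_max A0.
move=> b; rewrite ge_max => /andP[Ab Bb]; have b0 : 0 < b by lra.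
split=> [k k1|n]; last first.
  by apply: hA; apply: (le_trans Ab); rewrite lerDl mulr_ge0// ltW.
have c0 : 0 < c_ b r k by rewrite ltr_pwDl// mulr_ge0// ltW.
rewrite /theta divr_ge0 ?(ltW c0)// oppr_ge0 ln_le0//.
exact: hB.
Qed.

Lemma estimators_le : exists C : R, exists2 B : R, 0 <= C /\ 0 < B &
  forall b k x, B <= b -> (1 <= k)%N ->
  [/\ Z1 F mu r b k x <= (n_ k)%:R * tail F (c_ b r k),
      Z2 F mu r b k x <= C * ((n_ k)%:R * tail F (c_ b r k)) &
      Z3 F mu r b k x <= (n_ k)%:R * tail F (c_ b r k)].
Proof.
have Kn0 : 0 < Kn by rewrite addr_gt0 ?divr_gt0// ltr0n ltnW.
have [C [B1 [C0 B10] hC]] := mgf_rate slowL tailE smoothL alpha_le intF meanF m32_lty Kn0.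
have [B2 B21 hB2] := block_tail_small (expR_gt0 (- 1)).
exists (expR C); exists (Num.max B1 B2).
  by split; [exact: expR_ge0|rewrite lt_max B10].
move=> b k x; rewrite ge_max => /andP[B1b B2b] k1.
have b0 : 0 < b by lra.
have b1 : 1 <= b by lra.
have bc : b <= c_ b r k by rewrite lerDl mulr_ge0// ltW.
have c0 : 0 < c_ b r k by lra.
have nt0 : 0 <= (n_ k)%:R * tail F (c_ b r k) by rewrite mulr_ge0// tail_ge0.
have nk1 : 1 <= (n_ k)%:R :> R by rewrite ler1n (leq_trans k1)// leq_blk_id.
have invn (N : nat) : N%:R^-1 <= 1 :> R.
  by case: N => [|N]; [rewrite invr0|rewrite invf_le1 ?ltr0n// ler1n].
have divle (q : R) (N : nat) (i : bool) : 0 <= q -> q / N%:R * i%:R <= q.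
  move=> q0; case: i; rewrite ?mulr0// mulr1 ler_piMr//.
split.
- rewrite Z1E; apply: (@le_trans _ _ (q_ F mu r b k)).
    by apply: divle; rewrite /q_ sumr_ge0// => i _; exact: tail_ge0.
  apply: (@le_trans _ _ (\sum_((n_ k.-1).+1 <= i < (n_ k).+1) tail F (c_ b r k))).
    rewrite /q_ !big_nat; apply: ler_sum => i /andP[ki _]; apply: tail_nincr.
    by rewrite /barrier lerD2l ler_pM2r// ler_nat ltnW.
  rewrite big_const_nat iter_addr_0 subSS -[leLHS]mulr_natl ler_wpM2r ?tail_ge0//.
  by rewrite ler_nat leq_subr.
- rewrite Z2E.
  (* The indicator of first passage is kept in the bound: at most one m contributes, so that summing
     over m costs no factor. *)
  have Z2_at_le m : m \in index_iota (n_ k.-1).+1 (n_ k).+1 ->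
      Z2_at F mu r b k m x <= expR C * ((n_ k)%:R * tail F (c_ b r k)) * (first_hit mu b x m)%:R.
    rewrite mem_index_iota ltnS => /andP[km mk].
    rewrite /Z2_at; case: (boolP (first_hit mu b x m)) => [hm|_]; last by rewrite !mulr0.
    rewrite mulr1 /=; apply: (@le_trans _ _ (expR (- theta F mu r b k * partial_sum x m
        + m%:R * Lambda F mu r b k (theta F mu r b k)))).
      by rewrite ler_piMr ?expR_ge0//; case: (allB _ _ _ _ _).
    have nt1 := hB2 b k B2b k1.
    have ntp : 0 < (n_ k)%:R * tail F (c_ b r k).
      by rewrite mulr_gt0 ?(tail_gt0 slowL tailE)//; lra.
    have th0 : 0 <= theta F mu r b k.
      rewrite /theta divr_ge0 ?(ltW c0)// oppr_ge0 ln_le0//.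
      by apply: (le_trans nt1); rewrite -[leRHS]expR0 ler_expR; lra.
    have hL : (n_ k)%:R * Lambda F mu r b k (theta F mu r b k) <= C.
      exact: (hC (c_ b r k) (n_ k)%:R (le_trans B1b bc) nk1 (blk_le_barrier b1 k1) nt1).
    (* The rate bounds n_k Lambda only; if Lambda >= 0 it passes to m <= n_k, and if Lambda < 0 the
       product is negative while C >= 0. *)
    have mL : m%:R * Lambda F mu r b k (theta F mu r b k) <= C.
      have [L0|L0] := leP 0 (Lambda F mu r b k (theta F mu r b k)).
        by apply: le_trans hL; rewrite ler_wpM2r// ler_nat.
      by apply: le_trans C0; rewrite mulr_ge0_le0// ltW.
    have Sm : c_ b r k <= partial_sum x m.
      move: hm => /andP[+ _]; rewrite /above ltrBrDr => /ltW; apply: le_trans.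
      by rewrite /barrier lerD2l ler_pM2r// ler_nat ltnW.
    have thS : theta F mu r b k * c_ b r k <= theta F mu r b k * partial_sum x m.
      by rewrite ler_wpM2l.
    (* This is the reason for the choice of theta_k: exp(- theta_k c_k) is exactly n_k times the
       tail at c_k. *)
    have thE : theta F mu r b k * c_ b r k = - ln ((n_ k)%:R * tail F (c_ b r k)).
      by rewrite /theta divfK// gt_eqF.
    rewrite -[X in _ <= _ * X]lnK ?posrE//.
    by rewrite -expRD ler_expR; lra.
  rewrite big_seq; apply: (le_trans (ler_sum _ Z2_at_le)).
  rewrite -big_seq -mulr_sumr -[leRHS]mulr1 ler_wpM2l ?mulr_ge0 ?expR_ge0 ?tail_ge0//.
  have [/hasP[m mk hm]|/hasPn nh] := boolP (has (first_hit mu b x) (index_iota (n_ k.-1).+1 (n_ k).+1)).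
    rewrite (bigD1_seq m)// ?iota_uniq//= hm big1 ?addr0// => n /negbTE nm.
    by case: (boolP (first_hit mu b x n)) => // /(first_hit_inj hm) mn; rewrite mn eqxx in nm.
  by rewrite big_seq big1 ?ler01// => m /nh /negbTE ->.
- by rewrite Z3E; apply: divle.
Qed.

End large_barriers.

(** * From second moments to strong efficiency *)

Lemma limf_esup_pinfty_lt {R : realType} (f : R -> \bar R) (M : R) :
  (\forall x \near +oo, (f x <= M%:E)%E) -> (limf_esup f +oo%R < +oo)%E.
Proof.
move=> fM; rewrite limf_esupE; apply: (@le_lt_trans _ _ M%:E); last exact: ltry.
apply: (@le_trans _ _ (ereal_sup [set f x | x in [set x | (f x <= M%:E)%E]])).
  by apply: ereal_inf_lbound; exists [set x | (f x <= M%:E)%E].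
by apply: ge_ereal_sup => _ [x /= fxM <-].
Qed.

(** Pointwise (Y - m)^2 <= Y^2 + m^2, as the cross term is nonpositive for Y, m >= 0. The crude
    summand m^2 only adds 1 to the final ratio, since m is then the passage probability. *)
Lemma variance_le_second_moment d (T : measurableType d) {R : realType}
    (Q : probability T R) (Y : T -> R) (M : R) :
  measurable_fun setT Y -> (forall w, 0 <= Y w) ->
  (\int[Q]_w ((Y w) ^+ 2)%:E <= M%:E)%E ->
  ('V_Q[Y] <= (M + fine 'E_Q[Y] ^+ 2)%:E)%E.
Proof.
move=> mY Y0 YM; set m := fine 'E_Q[Y]%E.
have m0 : 0 <= m by apply: fine_ge0; rewrite unlock; apply: integral_ge0 => w _; rewrite lee_fin.
have mY2 : measurable_fun setT (fun w => ((Y w) ^+ 2)%:E).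
  by apply/measurable_EFinP; exact: measurable_funX.
rewrite EFinD; apply: le_trans (leeD2r (m ^+ 2)%:E YM).
rewrite /variance unlock -/m.
have -> : (m ^+ 2)%:E = (\int[Q]_w (cst (m ^+ 2)%:E) w)%E.
  by rewrite integral_cst// [X in _ = (_ * X)%E](probability_setT Q) mule1.
rewrite -ge0_integralD//; last by move=> w _; rewrite lee_fin sqr_ge0.
rewrite unlock; apply: ge0_le_integral => //.
- by move=> w _; rewrite lee_fin -[leRHS]/((Y w - m) * (Y w - m)) -expr2 sqr_ge0.
- apply/measurable_EFinP; apply: measurable_funM; apply: measurable_funB => //;
    exact: measurable_cst.
- exact: emeasurable_funD.
- move=> w _; rewrite /= -EFinD lee_fin -[leLHS]/((Y w - m) * (Y w - m)).
  by have := mulr_ge0 m0 (Y0 w); lra.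
by move=> w _; rewrite lee_fin sqr_ge0.
Qed.

Theorem theorem4 (R : realType)
  (d : measure_display) (T : measurableType d) (P : probability T R)
  (X : nat -> {RV P >-> R})
  (mu : R) (r : nat) (alpha beta : R) (L : R -> R)
  (d' : R -> measure_display) (T' : forall b : R, measurableType (d' b))
  (Q : forall b : R, probability (T' b) R)
  (W : forall b : R, run (Q b)) :
  let F : probability R R := distribution P (X 0%N) in
  let p (b : R) := pK F mu r b alpha beta in
  let passes (b : R) := P [set w | (tau mu b (X ^~ w) < +oo)%E] in
  let Z (b : R) := Zrun F mu r b (W b) (p b) in
  iid X ->
  P.-integrable setT (EFin \o X 0%N) ->
  'E_P[X 0%N]%E = 0%E ->
  0 < mu ->
  (1 < r)%N ->
  assumption1 (X 0%N) alpha L ->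
  assumption2 L ->
  3 / 2 < alpha <= 2 ->
  2 < beta < 2 * alpha - 1 ->
  (forall b, 0 < b -> admissible F mu r b ->
     follows F mu r b (W b) (p b)) ->
  [/\ (forall b, 0 < b ->
         (forall k, (1 <= k)%N -> 0 < p b k) /\
         (\sum_(1 <= k <oo) (p b k)%:E = 1)%E),
      (\forall b \near +oo, admissible F mu r b) /\
      (forall b, 0 < b -> admissible F mu r b ->
         'E_(Q b)[Z b]%E = passes b),
      (limf_esup (fun b : R =>
         'V_(Q b)[Z b] * ((fine (passes b) ^+ 2)^-1)%:E) +oo%R < +oo)%E &
      exists2 eps : R -> R, eps b @[b --> +oo] --> (0 : R) &
        \forall b \near +oo,
          ('E_(Q b)[nu r (W b)]
             <= ((r%:R + eps b) / (mu * (beta - 2)) * b)%:E)%E].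
Proof.
move=> F p passes Z iidX intX meanX mu0 r1 [_ slowL tailE varX] smoothL.
move=> /andP[alpha_gt alpha_le] /andP[beta_gt beta_lt] fol.
have tailF_gt0 (x : R) : 0 < x -> 0 < tail F x by move=> _; exact: tail_gt0 slowL tailE x.
have intF : F.-integrable setT (EFin \o (@id R)).
  by apply: integrable_pushforward => //; exact/measurable_EFinP.
have meanF : (\int[F]_x x%:E = 0)%E.
  by rewrite integral_distribution//; move: meanX; rewrite unlock.
have m32_lty := moment32_lty meanX slowL tailE smoothL alpha_gt varX.
have Fneg := lower_mass_neq0 intF meanF.
have p_gt0 b (b0 : 0 < b) k : (1 <= k)%N -> 0 < p b k.
  exact: (pK_gt0 slowL tailE smoothL).
have p_sum b (b0 : 0 < b) : (\sum_(1 <= k <oo) (p b k)%:E = 1)%E.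
  exact: (sum_pK slowL tailE smoothL).
have adm := admissible_near slowL tailE smoothL alpha_gt mu0 r1.
have unbiased b (b0 : 0 < b) (admb : admissible F mu r b) : ('E_(Q b)[Z b] = passes b)%E.
  exact: (expectation_Zrun iidX mu0 b0 r1 admb tailF_gt0 Fneg (p_gt0 b b0) (p_sum b b0)
    (fol b b0 admb) (pK0 _ _ _ _ _ _)).
have [B0 B00 hadm] := (near_pinfty_exP _).1 adm.
split=> //.
- by move=> b b0; split; [exact: p_gt0|exact: p_sum].
- have [C [B1 [C0 B10] hZ]] :=
    estimators_le slowL tailE smoothL alpha_gt alpha_le intF meanF m32_lty mu0 r1.
  have [K [B2 B20 hK]] :=
    squared_weights_series slowL tailE smoothL alpha_le beta_gt mu0 r1 beta_lt.
  have [kap [B3 [kap0 B30] hkap]] := passage_lower_bound iidX intX slowL tailE smoothL mu0.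
  (* C + 2 bounds the sum of the three estimators relative to n_k times the tail at c_k, K bounds
     the series and kap bounds the passage probability from below; the summand 1 is the squared mean
     over itself, by unbiasedness. *)
  apply: (limf_esup_pinfty_lt (M := (C + 2) ^+ 2 * K / kap ^+ 2 + 1)).
  apply/near_pinfty_exP; exists (Num.max (Num.max B0 B1) (Num.max B2 B3)).
    by rewrite !lt_max B00.
  move=> b; rewrite !ge_max => /andP[/andP[bB0 bB1] /andP[bB2 bB3]].
  have b0 : 0 < b by lra.
  have admb := hadm b bB0.
  have tb0 := tailF_gt0 b b0.
  (* The sign of [K] is read off from the series of nonnegative terms that it bounds. *)
  have K0 : 0 <= K.
    rewrite -(pmulr_lge0 _ (exprn_gt0 2 (mulr_gt0 b0 tb0))) -lee_fin; apply: le_trans (hK b bB2).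
    apply: nneseries_ge0 => k k1 _; rewrite lee_fin divr_ge0 ?sqr_ge0//.
    by apply/ltW/p_gt0.
  pose q k := (blk r k)%:R * tail F (barrier mu b r k).
  have q0 k : 0 <= q k by rewrite mulr_ge0// tail_ge0.
  have Z_le w : Z b w <= (C + 2) * q (run_K (W b) w) / p b (run_K (W b) w).
    rewrite /Z /Zrun; have [->|k1] := posnP (run_K (W b) w).
      by rewrite /p pK0 invr0 !mulr0.
    rewrite ler_pM2r ?invr_gt0 ?p_gt0// /Zk.
    have [h1 _ _] := hZ b _ (run_inc1 (W b) ^~ w) bB1 k1.
    have [_ h2 _] := hZ b _ (splice mu b (run_pre2 (W b) ^~ w) (run_post2 (W b) ^~ w)) bB1 k1.
    have [_ _ h3] := hZ b _ (run_inc3 (W b) ^~ w) bB1 k1.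
    by move: h1 h2 h3; rewrite -/F -/(q _); lra.
  have Z0 w : 0 <= Z b w by apply: Zrun_ge0; [exact: p_gt0|exact: pK0].
  have mZ : measurable_fun setT (Z b) by exact: measurable_Zrun.
  have Z2_le : (\int[Q b]_w ((Z b w) ^+ 2)%:E <=
      ((C + 2) ^+ 2 * (K * (b * tail F b) ^+ 2))%:E)%E.
    apply: (@le_trans _ _ (\int[Q b]_w (((C + 2) * q (run_K (W b) w) / p b (run_K (W b) w)) ^+ 2)%:E)%E).
      apply: ge0_le_integral => //.
      - by move=> w _; rewrite lee_fin sqr_ge0.
      - by apply/measurable_EFinP; exact: measurable_funX.
      - apply/measurable_EFinP.
        by apply: (measurableT_comp (f := fun k => ((C + 2) * q k / p b k) ^+ 2)).
      by move=> w _; rewrite lee_fin ler_sqr ?nnegrE//; apply: le_trans (Z_le w).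
    rewrite (integral_run_K mu0 b0 r1 admb tailF_gt0 Fneg (p_sum b b0) (fol b b0 admb)
      (f := fun k => ((C + 2) * q k / p b k) ^+ 2)); last by move=> k; exact: sqr_ge0.
    rewrite EFinM; apply: le_trans (lee_wpmul2l _ (hK b bB2)); last first.
      by rewrite lee_fin sqr_ge0.
    rewrite -nneseriesZl; last first.
      move=> k _; rewrite lee_fin divr_ge0 ?sqr_ge0//.
      by have [->|k1] := posnP k; [rewrite /p pK0|exact/ltW/p_gt0].
    rewrite (eq_nneseries_from1 (g := fun k => ((C + 2) ^+ 2)%:E * (q k ^+ 2 / p b k)%:E)%E)//.
    move=> k k1; rewrite -EFinM; congr EFin.
    by field; rewrite gt_eqF// p_gt0.
  have := variance_le_second_moment mZ Z0 Z2_le; rewrite unbiased//.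
  have passes_fin : passes b \is a fin_num by rewrite fin_num_measure//; exact: measurable_passage.
  have := hkap b bB3; rewrite -/(passes b) -(fineK passes_fin) lee_fin.
  set m := fine (passes b) => mk /= hv.
  have kb0 : 0 < kap * (b * tail F b) by rewrite !mulr_gt0.
  have m0 : 0 < m by apply: lt_le_trans mk.
  apply: le_trans (lee_wpmul2r _ hv) _; first by rewrite lee_fin invr_ge0 sqr_ge0.
  rewrite -EFinM lee_fin mulrDl divff ?gt_eqF ?exprn_gt0// lerD2r.
  rewrite ler_pdivrMr ?exprn_gt0//.
  apply: (@le_trans _ _ ((C + 2) ^+ 2 * K / kap ^+ 2 * (kap * (b * tail F b)) ^+ 2)).
    by rewrite le_eqVlt; apply/orP; left; apply/eqP; field; rewrite gt_eqF.
  apply: ler_wpM2l; last by rewrite ler_sqr ?nnegrE ?(ltW kb0) ?(ltW m0).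
  by rewrite mulr_ge0 ?invr_ge0 ?sqr_ge0// mulr_ge0 ?sqr_ge0.
- have [eps eps0 heps] := mean_length_asymptotics slowL tailE smoothL alpha_le beta_gt mu0 r1.
  exists eps => //; have [B1 B10 hB1] := (near_pinfty_exP _).1 heps.
  apply/near_pinfty_exP; exists (Num.max B0 B1); first by rewrite lt_max B00.
  move=> b; rewrite ge_max => /andP[bB0 bB1].
  have b0 : 0 < b by lra.
  apply: le_trans (hB1 b bB1); rewrite unlock.
  rewrite (integral_run_K mu0 b0 r1 (hadm b bB0) tailF_gt0 Fneg (p_sum b b0)
    (fol b b0 (hadm b bB0)) (f := fun k => (blk r k)%:R))//.
Qed.
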